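(* Let $\mathcal C$ be one of the sets $\mathcal K^{2,r}_{\mathbf m,\mathbf p}$ (with $N=2$), $\mathcal K^{N}_{\mathbf m,\mathbf p}$, ${}^c\mathcal K^{N,r}_{\mathbf m,\mathbf p}$ (for some $c>0$), or $\overline{\mathcal K}^{N,r}_{\mathbf m,\mathbf p}$, and suppose the generating dictionary satisfies $\mathbf D^0\in\mathcal C$ and the coefficient, noise and parameter assumptions below hold. Then for any $\rho$ with $\bar\lambda C_{\min}<\rho<\bar\lambda C_{\max}$ and $\frac{M_\epsilon}{M_x}<\frac72(\bar\lambda C_{\max}-\rho)$, the function $\mathbf D\in\mathcal C\mapsto f_{\mathcal P}(\mathbf D)$ has a local minimum $\mathbf D^*$ (local relative to $\mathcal C$) with $\|\mathbf D^*-\mathbf D^0\|_F<\rho$.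
   Context: Let $N\ge2$, $m_n,p_n\ge1$, $m=\prod_n m_n$, $p=\prod_n p_n$. The oblique manifold $\mathcal D_{m\times p}$ is the set of $m\times p$ matrices with unit $\ell_2$-norm columns. The separation rank $\mathfrak R^N_{\mathbf m,\mathbf p}(\mathbf A)$ is the minimum $r$ with $\mathbf A=\sum_{k=1}^r\mathbf A^k_1\otimes\cdots\otimes\mathbf A^k_N$, $\mathbf A^k_n\in\mathbb R^{m_n\times p_n}$. Define $\mathcal K^{N,r}_{\mathbf m,\mathbf p}=\{\mathbf D\in\mathcal D_{m\times p}:\mathfrak R^N_{\mathbf m,\mathbf p}(\mathbf D)\le r\}$, $\mathcal K^N_{\mathbf m,\mathbf p}=\mathcal K^{N,1}_{\mathbf m,\mathbf p}$, $\mathcal K^{2,r}_{\mathbf m,\mathbf p}$ the case $N=2$, ${}^c\mathcal K^{N,r}_{\mathbf m,\mathbf p}$ the set of $\mathbf D\in\mathcal D_{m\times p}$ expressible as $\sum_{k=1}^r\bigotimes_n\mathbf D^k_n$ with $\|\bigotimes_n\mathbf D^k_n\|_F\le c$ for all $k$, and $\overline{\mathcal K}^{N,r}_{\mathbf m,\mathbf p}$ the closure of $\mathcal K^{N,r}_{\mathbf m,\mathbf p}$ in Frobenius norm. Generative model: a sample is $\mathbf y=\mathbf D^0\mathbf x^0+\boldsymbol\varepsilon\in\mathbb R^m$, where a support $\mathcal J\subset[p]$ with $|\mathcal J|=s$ is chosen uniformly at random and $\mathbf x^0\in\mathbb R^p$ is a random vector supported on $\mathcal J$; $\mathbf s^0=\mathrm{sgn}(\mathbf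 x^0)$. Coefficient assumption: for a real random variable $x$ and constants $M_x,\underline x>0$: $\mathbb E\{\mathbf x^0_{\mathcal J}[\mathbf x^0_{\mathcal J}]^T|\mathcal J\}=\mathbb E\{x^2\}\mathbf I_s$, $\mathbb E\{\mathbf s^0_{\mathcal J}[\mathbf s^0_{\mathcal J}]^T|\mathcal J\}=\mathbf I_s$, $\mathbb E\{\mathbf s^0_{\mathcal J}[\mathbf x^0_{\mathcal J}]^T|\mathcal J\}=\mathbb E\{|x|\}\mathbf I_s$, $\|\mathbf x^0\|_2\le M_x$ and $\min_{j\in\mathcal J}|x^0_j|\ge\underline x$ a.s. Noise assumption: for a real random variable $\epsilon$ and constant $M_\epsilon>0$: $\mathbb E\{\boldsymbol\varepsilon\boldsymbol\varepsilon^T|\mathcal J\}=\mathbb E\{\epsilon^2\}\mathbf I_m$, $\mathbb E\{\mathbf x^0\boldsymbol\varepsilon^T|\mathcal J\}=\mathbb E\{\mathbf s^0\boldsymbol\varepsilon^T|\mathcal J\}=0$, $\|\boldsymbol\varepsilon\|_2\le M_\epsilon$ a.s. Parameters: $\lambda>0$, $\bar\lambda=\lambda/\mathbb E\{|x|\}$, $C_{\min}=24\frac{\mathbb E\{|x|\}^2}{\mathbb E\{x^2\}}(\|\mathbf D^0\|_2+1)^2\frac sp\|[\mathbf D^0]^T\mathbf D^0-\mathbf I\|_F$, $C_{\max}=\frac{2\mathbb E\{|x|\}}{7M_x}(1-2\mu_s(\mathbf D^0))$, where the cumulative coherence is $\mu_s(\mathbf D)=\max_{|\mathcal J|\le s}\max_{j\notin\mathcal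 J}\|\mathbf D_{\mathcal J}^T\mathbf d_j\|_1$. Parameter assumption: $C_{\min}\le C_{\max}$, $\lambda\le\underline x/4$, $s\le\frac{p}{16(\|\mathbf D^0\|_2+1)^2}$, $\mu_s(\mathbf D^0)\le1/4$, $\frac{M_\epsilon}{M_x}<\frac72(C_{\max}-C_{\min})\bar\lambda$. Objective: $f_{\mathbf y}(\mathbf D)=\inf_{\mathbf x\in\mathbb R^p}\frac12\|\mathbf y-\mathbf D\mathbf x\|_2^2+\lambda\|\mathbf x\|_1$ and $f_{\mathcal P}(\mathbf D)=\mathbb E_{\mathbf y}f_{\mathbf y}(\mathbf D)$ with $\mathbf y$ drawn from the model. *)

(* Defs.v *)
From HB Require Import structures.
From mathcomp Require Import all_boot all_order all_algebra.
From mathcomp Require Import all_classical all_reals all_analysis.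
Set Implicit Arguments. Unset Strict Implicit. Unset Printing Implicit Defensive.
Import Order.TTheory GRing.Theory Num.Theory.
Import numFieldNormedType.Exports.
Local Open Scope classical_set_scope.
Local Open Scope ring_scope.

Section Defs.
Variable R : realType.

Definition dimprod (N : nat) (f : 'I_N -> nat) : nat := (\prod_(n < N) f n)%N.

Definition mx_at (a b : nat) (A : 'M[R]_(a, b)) (i j : nat) : R :=
  match (insub i : option 'I_a), (insub j : option 'I_b) with
  | Some i', Some j' => A i' j'
  | _, _ => 0
  end.

(* n-th mixed-radix digit of an index of the Kronecker product
   (first factor most significant, standard Kronecker ordering) *)
Definition kdigit (N : nat) (f : 'I_N -> nat) (n : 'I_N) (i : nat) : nat :=
  ((i %/ \prod_(k < N | n < k) f k) %% f n)%N.

Definition kron (N : nat) (ms ps : 'I_N -> nat)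
  (A : forall n : 'I_N, 'M[R]_(ms n, ps n)) : 'M[R]_(dimprod ms, dimprod ps) :=
  \matrix_(i, j) \prod_(n < N) mx_at (A n) (kdigit ms n i) (kdigit ps n j).

Definition frob (a b : nat) (A : 'M[R]_(a, b)) : R :=
  Num.sqrt (\sum_(i < a) \sum_(j < b) A i j ^+ 2).

Definition l1norm (p : nat) (x : 'cV[R]_p) : R := \sum_(i < p) `|x i 0|.

Definition opnorm (a b : nat) (A : 'M[R]_(a, b)) : R :=
  sup [set frob (A *m v) | v in [set v : 'cV[R]_b | frob v <= 1]].

Definition oblique (a b : nat) : set 'M[R]_(a, b) :=
  [set D | forall j : 'I_b, frob (col j D) = 1].

Definition kron_sum (N : nat) (ms ps : 'I_N -> nat) (r : nat)
  (A : 'M[R]_(dimprod ms, dimprod ps)) : Prop :=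
  exists F : 'I_r -> forall n : 'I_N, 'M[R]_(ms n, ps n),
    A = \sum_(k < r) kron (F k).

Definition seprank_le (N : nat) (ms ps : 'I_N -> nat) (A : 'M[R]_(dimprod ms, dimprod ps))
  (r : nat) : Prop :=
  exists2 r' : nat, (r' <= r)%N & kron_sum r' A.

Definition Kset (N : nat) (ms ps : 'I_N -> nat) (r : nat) : set 'M[R]_(dimprod ms, dimprod ps) :=
  [set D | oblique D /\ seprank_le D r].

Definition cKset (N : nat) (ms ps : 'I_N -> nat) (c : R) (r : nat)
  : set 'M[R]_(dimprod ms, dimprod ps) :=
  [set D | oblique D /\
     exists F : 'I_r -> forall n : 'I_N, 'M[R]_(ms n, ps n),
       D = \sum_(k < r) kron (F k) /\ forall k, frob (kron (F k)) <= c].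

Definition frob_closure (a b : nat) (S : set 'M[R]_(a, b)) : set 'M[R]_(a, b) :=
  [set D | forall e : R, 0 < e -> exists2 D', S D' & frob (D - D') < e].

Definition cum_coherence (a b : nat) (s : nat) (D : 'M[R]_(a, b)) : R :=
  \big[Num.max/0]_(J : {set 'I_b} | (#|J| <= s)%N)
    \big[Num.max/0]_(j : 'I_b | j \notin J)
      \sum_(i in J) `|((col i D)^T *m col j D) 0 0|.

Definition lasso_obj (a b : nat) (lambda : R) (y : 'cV[R]_a) (D : 'M[R]_(a, b)) : R :=
  inf [set (2^-1 * frob (y - D *m x) ^+ 2 + lambda * l1norm x) | x in [set: 'cV[R]_b]].

Definition sgv (p : nat) (x : 'cV[R]_p) : 'cV[R]_p := map_mx (fun t => Num.sg t) x.

Definition Cmin (a b : nat) (Ex2 Eax : R) (s : nat) (D0 : 'M[R]_(a, b)) : R :=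
  24 * (Eax ^+ 2 / Ex2) * (opnorm D0 + 1) ^+ 2 * (s%:R / b%:R)
     * frob (D0^T *m D0 - 1%:M).

Definition Cmax (a b : nat) (Eax Mx : R) (s : nat) (D0 : 'M[R]_(a, b)) : R :=
  (2 * Eax) / (7 * Mx) * (1 - 2 * cum_coherence s D0).

Definition fP (d : measure_display) (T : measurableType d) (P : probability T R)
  (a b : nat) (lambda : R) (y : T -> 'cV[R]_a) (D : 'M[R]_(a, b)) : \bar R :=
  (\int[P]_t (lasso_obj lambda (y t) D)%:E)%E.

End Defs.

Arguments Kset {R N} ms ps r.
Arguments cKset {R N} ms ps c r.

(* Main.v *)
(* The objective is Lipschitz on oblique dictionaries and each of the four constraint sets is
   closed, so the objective attains a minimum on the compact set of dictionaries of [C] at distance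
   at most rho from D0. It suffices to show that the objective is larger than at D0 on the sphere of
   radius rho: then the minimum is interior.

   For a support S and signs sg the LASSO value has the closed form
   |y|^2/2 - <z, H z>/2, where z = D_S^T y - lambda sg and H is the inverse of the Gram matrix of
   D_S. A dual certificate shows that for D on the sphere the LASSO value is at least this closed
   form for the true support and signs, while at D0 it is at most the closed form. Conditionally
   on S, the expected difference of the closed forms is
     E x^2 / 2 * tr D0_S^T (1 - P_S) D0_S - lambda E|x| tr (1 - D_S^+ D0_S)
       + lambda^2 / 2 * tr (H0 - H),
   with P_S the projection on the range of D_S. Averaging over S, an off-diagonal p x p matrix
   restricted to S x S has mean squared Frobenius norm at most (s/p)^2 times the original one,
   which makes all terms but the leading one, of order (s/p) rho^2 E x^2, small. *)
Require Import Defs.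
From HB Require Import structures.
From mathcomp Require Import all_boot all_order all_algebra.
From mathcomp Require Import all_classical all_reals all_analysis.
From mathcomp Require Import measurable_realfun ring lra.
Set Implicit Arguments. Unset Strict Implicit. Unset Printing Implicit Defensive.
Import Order.TTheory GRing.Theory Num.Theory.
Import numFieldNormedType.Exports.
Local Open Scope classical_set_scope.
Local Open Scope ring_scope.

(** * Frobenius inner product and norm *)

Section FrobeniusNorm.
Variable R : realType.
Implicit Types a b c : nat.

(** The numbers come from one chain. The upper condition on [rho] unfolds to Meps + 7/2 rho Mx <
    lambda (1 - 2 mu_s(D0)); with lambda <= xlow/4 and sqrt s xlow <= Mx it forces 14 sqrt s rho <=
    1. So the coherence on the sphere stays below 2/5, restricted inverse Gram matrices have norm at
    most 5/3, and the dual certificate survives the drift from D0 to D. The obstacle is that traces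
    linear in E = D - D0 could swamp the quadratic gain. Unit columns prevent it: D^T E has diagonal
    |e_j|^2/2 and D^T D - D0^T D0 has diagonal 0, so the identity part of H meets only quadratically
    small terms, and the rest pairs two off-diagonal matrices and averages to order (s/p)^2. What
    stays linear in rho carries D0^T D0 - 1 and is beaten by rho > lambda/E|x| Cmin. The noise
    variance cancels because both projections have trace s. Closedness has a different reason for
    each set: quadratic equations for one Kronecker product, ordinary matrix rank for two factors,
    compactness under the bound c, and the definition for the closure. For s = 0 there is no strict
    gap, so that case is separate. *)

Definition fdot a b (A B : 'M[R]_(a, b)) : R :=
  \sum_(i < a) \sum_(j < b) A i j * B i j.

Lemma fdotE a b (A B : 'M[R]_(a, b)) : fdot A B = \tr (A^T *m B).
Proof.
rewrite /fdot exchange_big /=; apply: eq_bigr => j _.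
by rewrite mxE; apply: eq_bigr => i _; rewrite mxE.
Qed.

Lemma fdotC a b (A B : 'M[R]_(a, b)) : fdot A B = fdot B A.
Proof. by apply: eq_bigr => i _; apply: eq_bigr => j _; rewrite mulrC. Qed.

Lemma fdotDr a b (A B C : 'M[R]_(a, b)) : fdot A (B + C) = fdot A B + fdot A C.
Proof. by rewrite !fdotE mulmxDr raddfD. Qed.

Lemma fdotNr a b (A B : 'M[R]_(a, b)) : fdot A (- B) = - fdot A B.
Proof. by rewrite !fdotE mulmxN raddfN. Qed.

Lemma fdotBr a b (A B C : 'M[R]_(a, b)) : fdot A (B - C) = fdot A B - fdot A C.
Proof. by rewrite fdotDr fdotNr. Qed.

Lemma fdotZr a b (k : R) (A B : 'M[R]_(a, b)) : fdot A (k *: B) = k * fdot A B.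
Proof. by rewrite !fdotE -scalemxAr linearZ. Qed.

Lemma fdotDl a b (A B C : 'M[R]_(a, b)) : fdot (A + B) C = fdot A C + fdot B C.
Proof. by rewrite fdotC fdotDr !(fdotC C). Qed.

Lemma fdotNl a b (A B : 'M[R]_(a, b)) : fdot (- A) B = - fdot A B.
Proof. by rewrite fdotC fdotNr (fdotC B). Qed.

Lemma fdotBl a b (A B C : 'M[R]_(a, b)) : fdot (A - B) C = fdot A C - fdot B C.
Proof. by rewrite fdotDl fdotNl. Qed.

Lemma fdotZl a b (k : R) (A B : 'M[R]_(a, b)) : fdot (k *: A) B = k * fdot A B.
Proof. by rewrite fdotC fdotZr (fdotC B). Qed.

Lemma fdot0l a b (B : 'M[R]_(a, b)) : fdot 0 B = 0.
Proof. by rewrite fdotE trmx0 mul0mx raddf0. Qed.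

Lemma fdotT a b (A B : 'M[R]_(a, b)) : fdot A^T B^T = fdot A B.
Proof.
rewrite /fdot exchange_big; apply: eq_bigr => i _.
by apply: eq_bigr => j _; rewrite !mxE.
Qed.

Lemma fdot_mulmxl a b c (M : 'M[R]_(a, b)) (A : 'M[R]_(b, c)) (B : 'M[R]_(a, c)) :
  fdot (M *m A) B = fdot A (M^T *m B).
Proof. by rewrite !fdotE trmx_mul mulmxA. Qed.

Lemma fdot_col p (u v : 'cV[R]_p) : fdot u v = \sum_i u i 0 * v i 0.
Proof. by apply: eq_bigr => i _; rewrite big_ord1. Qed.

Lemma frob_ge0 a b (A : 'M[R]_(a, b)) : 0 <= frob A.
Proof. exact: sqrtr_ge0. Qed.

Lemma frob_sqr a b (A : 'M[R]_(a, b)) : frob A ^+ 2 = fdot A A.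
Proof.
rewrite sqr_sqrtr; last by apply: sumr_ge0 => i _; apply: sumr_ge0 => j _; exact: sqr_ge0.
by apply: eq_bigr => i _; apply: eq_bigr => j _; rewrite expr2.
Qed.

Lemma frob_sqrE a b (A : 'M[R]_(a, b)) : frob A ^+ 2 = \sum_i \sum_j A i j ^+ 2.
Proof.
by rewrite frob_sqr; apply: eq_bigr => i _; apply: eq_bigr => j _; rewrite expr2.
Qed.

Lemma frob_eq0 a b (A : 'M[R]_(a, b)) : (frob A == 0) = (A == 0).
Proof.
apply/idP/eqP => [A0|->]; last first.
  rewrite /frob big1 ?sqrtr0 // => i _; rewrite big1 // => j _.
  by rewrite mxE expr0n.
have: frob A ^+ 2 == 0 by rewrite sqrf_eq0.
rewrite frob_sqrE psumr_eq0 => [/allP A2|i _]; last by apply: sumr_ge0 => j _; exact: sqr_ge0.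
apply/matrixP => i j; rewrite mxE.
have := A2 i (mem_index_enum _); rewrite psumr_eq0 => [/allP|? _]; last exact: sqr_ge0.
by move=> /(_ j (mem_index_enum _)); rewrite sqrf_eq0 => /eqP.
Qed.

Lemma frob0 a b : frob (0 : 'M[R]_(a, b)) = 0.
Proof. by apply/eqP; rewrite frob_eq0. Qed.

Lemma frobT a b (A : 'M[R]_(a, b)) : frob A^T = frob A.
Proof.
by apply/eqP; rewrite -(eqrXn2 (ltn0Sn 1)) ?frob_ge0 // !frob_sqr fdotT.
Qed.

Lemma frobN a b (A : 'M[R]_(a, b)) : frob (- A) = frob A.
Proof.
by apply/eqP; rewrite -(eqrXn2 (ltn0Sn 1)) ?frob_ge0 // !frob_sqr fdotNl fdotNr opprK.
Qed.

Lemma frobBC a b (A B : 'M[R]_(a, b)) : frob (A - B) = frob (B - A).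
Proof. by rewrite -frobN opprB. Qed.

Lemma frobZ a b (k : R) (A : 'M[R]_(a, b)) : frob (k *: A) = `|k| * frob A.
Proof.
apply/eqP; rewrite -(eqrXn2 (ltn0Sn 1)) ?mulr_ge0 ?frob_ge0 // exprMn !frob_sqr.
by rewrite fdotZl fdotZr mulrA -expr2 real_normK ?num_real.
Qed.

(** Cauchy-Schwarz, from expanding the square of [frob B *: A - frob A *: B]. *)
Lemma fdot_le a b (A B : 'M[R]_(a, b)) : fdot A B <= frob A * frob B.
Proof.
have [/eqP|A0] := eqVneq (frob A) 0.
  by rewrite frob_eq0 => /eqP ->; rewrite frob0 mul0r fdot0l.
have [/eqP|B0] := eqVneq (frob B) 0.
  by rewrite frob_eq0 => /eqP ->; rewrite frob0 mulr0 fdotC fdot0l.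
have : 0 <= frob (frob B *: A - frob A *: B) ^+ 2 by exact: sqr_ge0.
rewrite frob_sqr !(fdotBl, fdotBr, fdotZl, fdotZr) -!frob_sqr (fdotC B A).
have Ap : 0 < frob A by rewrite lt_def A0 frob_ge0.
have Bp : 0 < frob B by rewrite lt_def B0 frob_ge0.
have ABp := mulr_gt0 Ap Bp.
rewrite -[_ <= _ * _](ler_pM2l ABp) => h; nra.
Qed.

Lemma normr_fdot_le a b (A B : 'M[R]_(a, b)) : `|fdot A B| <= frob A * frob B.
Proof. by rewrite ler_norml fdot_le lerNl -fdotNl -(frobN A) fdot_le. Qed.

Lemma frobD a b (A B : 'M[R]_(a, b)) : frob (A + B) <= frob A + frob B.
Proof.
rewrite -ler_sqr ?nnegrE ?addr_ge0 ?frob_ge0 //.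
rewrite frob_sqr !(fdotDl, fdotDr) -!frob_sqr (fdotC B A).
have := fdot_le A B; nra.
Qed.

Lemma frobB a b (A B : 'M[R]_(a, b)) : frob (A - B) <= frob A + frob B.
Proof. by rewrite -(frobN B) frobD. Qed.

Lemma frob_cols a b (A : 'M[R]_(a, b)) : frob A ^+ 2 = \sum_j frob (col j A) ^+ 2.
Proof.
rewrite frob_sqrE exchange_big; apply: eq_bigr => j _; rewrite frob_sqrE.
by apply: eq_bigr => i _; rewrite big_ord1 mxE.
Qed.

Lemma frob_col_le a b (A : 'M[R]_(a, b)) j : frob (col j A) <= frob A.
Proof.
rewrite -ler_sqr ?nnegrE ?frob_ge0 // [leRHS]frob_cols (bigD1 j) //= lerDl.
by apply: sumr_ge0 => k _; exact: sqr_ge0.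
Qed.

Lemma normr_entry_le a b (A : 'M[R]_(a, b)) i j : `|A i j| <= frob A.
Proof.
rewrite -ler_sqr ?nnegrE ?frob_ge0 // frob_sqrE (bigD1 i) //= (bigD1 j) //=.
rewrite real_normK ?num_real // -addrA lerDl addr_ge0 // sumr_ge0 // => k _.
  exact: sqr_ge0.
by apply: sumr_ge0 => l _; exact: sqr_ge0.
Qed.

Lemma frob_mulmx a b c (A : 'M[R]_(a, b)) (B : 'M[R]_(b, c)) :
  frob (A *m B) <= frob A * frob B.
Proof.
rewrite -ler_sqr ?nnegrE ?mulr_ge0 ?frob_ge0 // exprMn -(frobT A) frob_sqrE !frob_cols.
rewrite mulr_suml; apply: ler_sum => i _.
rewrite mulr_sumr; apply: ler_sum => j _.
have -> : (A *m B) i j = fdot (col i A^T) (col j B).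
  by rewrite fdot_col mxE; apply: eq_bigr => k _; rewrite !mxE.
rewrite -exprMn -real_normK ?num_real // ler_sqr ?nnegrE ?mulr_ge0 ?frob_ge0 //.
exact: normr_fdot_le.
Qed.

Lemma frob_mulmx_le_cV a b c (A : 'M[R]_(a, b)) (k : R) : 0 <= k ->
  (forall v : 'cV[R]_b, frob (A *m v) <= k * frob v) ->
  forall B : 'M[R]_(b, c), frob (A *m B) <= k * frob B.
Proof.
move=> k0 hA B; rewrite -ler_sqr ?nnegrE ?mulr_ge0 ?frob_ge0 //.
rewrite exprMn !frob_cols mulr_sumr; apply: ler_sum => j _.
rewrite -exprMn ler_sqr ?nnegrE ?mulr_ge0 ?frob_ge0 //.
by rewrite colE -mulmxA -colE; exact: hA.
Qed.

(** Since |A^T B|^2 = <B, A A^T B>, the bound for [A] applied to [A^T *m B] and Cauchy-Schwarz leave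
    one factor |A^T B| to cancel. *)
Lemma frob_mulmx_trmx_le a b c (A : 'M[R]_(a, b)) (k : R) : 0 <= k ->
  (forall B : 'M[R]_(b, c), frob (A *m B) <= k * frob B) ->
  forall B : 'M[R]_(a, c), frob (A^T *m B) <= k * frob B.
Proof.
move=> k0 hA B; have [->|n0] := eqVneq (frob (A^T *m B)) 0.
  by rewrite mulr_ge0 ?frob_ge0.
have np : 0 < frob (A^T *m B) by rewrite lt_def n0 frob_ge0.
rewrite -(ler_pM2l np) -expr2 frob_sqr fdot_mulmxl trmxK.
apply: (le_trans (fdot_le _ _)).
apply: (le_trans (ler_wpM2l (frob_ge0 B) (hA _))).
lra.
Qed.

End FrobeniusNorm.

(** * Diagonally dominant matrices *)

Section DominantDiagonal.
Variables (R : realType) (p : nat).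

Lemma opnorm_ge0 m (A : 'M[R]_(m, p)) : 0 <= opnorm A.
Proof.
apply: sup_upper_bound; first split.
- by exists (frob (A *m (0 : 'cV_p))), 0 => //=; rewrite frob0.
- exists (frob A) => _ [v /= v1 <-]; rewrite (le_trans (frob_mulmx A v)) //.
  by rewrite ler_piMr ?frob_ge0.
by exists (0 : 'cV_p); rewrite /= ?mulmx0 ?frob0 ?ler01.
Qed.

Lemma frob_mulmx_le_opnorm m c (A : 'M[R]_(m, p)) (B : 'M[R]_(p, c)) :
  frob (A *m B) <= opnorm A * frob B.
Proof.
apply: frob_mulmx_le_cV => [|v]; first exact: opnorm_ge0.
have [/eqP|v0] := eqVneq (frob v) 0.
  by rewrite frob_eq0 => /eqP ->; rewrite mulmx0 !frob0 mulr0.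
have vp : 0 < frob v by rewrite lt_def v0 frob_ge0.
rewrite -ler_pdivrMr //; apply: sup_upper_bound; first split.
- by exists (frob (A *m (0 : 'cV_p))), 0 => //=; rewrite frob0.
- exists (frob A) => _ [w /= w1 <-]; rewrite (le_trans (frob_mulmx A w)) //.
  by rewrite ler_piMr ?frob_ge0.
exists ((frob v)^-1 *: v) => /=; first by rewrite frobZ ger0_norm ?invr_ge0 ?frob_ge0 // mulVf.
by rewrite -scalemxAr frobZ ger0_norm ?invr_ge0 ?frob_ge0 // mulrC.
Qed.

Variables (A : 'M[R]_p) (mu : R).
Hypotheses (symA : A^T = A) (rowA : forall i, \sum_j `|A i j| <= mu).

(** Schur test: 2 |A_ij B_ik B_jk| <= |A_ij| (B_ik^2 + B_jk^2), and by symmetry of [A] both halves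
    have the same sum [T], which the row sums control. *)
Lemma normr_fdot_mulmx_le c (B : 'M[R]_(p, c)) :
  `|fdot B (A *m B)| <= mu * frob B ^+ 2.
Proof.
have AC i j : A i j = A j i by rewrite -[in LHS]symA mxE.
pose T := \sum_i \sum_k \sum_j `|A i j| * B i k ^+ 2.
have Tmu : T <= mu * frob B ^+ 2.
  rewrite frob_sqrE mulr_sumr; apply: ler_sum => i _.
  rewrite mulr_sumr; apply: ler_sum => k _.
  by rewrite -mulr_suml ler_wpM2r ?sqr_ge0.
apply: (le_trans _ Tmu).
have -> : T = 2^-1 * (T + \sum_i \sum_k \sum_j `|A i j| * B j k ^+ 2).
  suff -> : \sum_i \sum_k \sum_j `|A i j| * B j k ^+ 2 = T by lra.
  rewrite /T exchange_big [RHS]exchange_big /=; apply: eq_bigr => k _.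
  rewrite exchange_big /=; apply: eq_bigr => i _; apply: eq_bigr => j _.
  by rewrite AC.
rewrite /T -big_split mulr_sumr (le_trans (ler_norm_sum _ _ _)) //.
apply: ler_sum => i _; rewrite -big_split mulr_sumr (le_trans (ler_norm_sum _ _ _)) //.
apply: ler_sum => k _; rewrite mxE mulr_sumr -big_split mulr_sumr.
rewrite (le_trans (ler_norm_sum _ _ _)) //; apply: ler_sum => j _ /=.
rewrite !normrM -(real_normK (num_real (B i k))) -(real_normK (num_real (B j k))).
have := mulr_ge0 (normr_ge0 (A i j)) (sqr_ge0 (`|B i k| - `|B j k|)); lra.
Qed.

Hypothesis (mu1 : mu < 1).

Lemma frob_addmx_ge c (B : 'M[R]_(p, c)) : (1 - mu) * frob B <= frob ((1%:M + A) *m B).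
Proof.
have [->|n0] := eqVneq (frob B) 0; first by rewrite mulr0 frob_ge0.
have Bp : 0 < frob B by rewrite lt_def n0 frob_ge0.
rewrite -(ler_pM2l Bp); apply: le_trans (fdot_le _ _).
rewrite mulmxDl mul1mx fdotDr -frob_sqr.
by have := normr_fdot_mulmx_le B; rewrite ler_norml => /andP[]; nra.
Qed.

(** The lower bound makes 1 + A injective; symmetry turns the left kernel computed by [kermx] into a
    right one. *)
Lemma addmx_unit : 1%:M + A \in unitmx.
Proof.
rewrite -row_free_unit -kermx_eq0 -trmx_eq0 -frob_eq0 eq_le frob_ge0 andbT.
have /(congr1 trmx) := mulmx_ker (1%:M + A).
rewrite trmx_mul linearD /= symA trmx1 trmx0 => K0.
have := frob_addmx_ge (kermx (1%:M + A))^T; rewrite K0 frob0.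
by rewrite pmulr_rle0 // subr_gt0.
Qed.

Lemma frob_invmx_le c (B : 'M[R]_(p, c)) :
  (1 - mu) * frob (invmx (1%:M + A) *m B) <= frob B.
Proof.
by apply: le_trans (frob_addmx_ge _) _; rewrite mulmxA mulmxV ?addmx_unit // mul1mx.
Qed.

Lemma sup_invmx_le (v : 'cV[R]_p) (k : R) : (forall i, `|v i 0| <= k) ->
  forall i, (1 - mu) * `|(invmx (1%:M + A) *m v) i 0| <= k.
Proof.
move=> vk i; set w := invmx _ *m v.
have vE : v = (1%:M + A) *m w by rewrite mulmxA mulmxV ?addmx_unit // mul1mx.
clearbody w.
(* At a coordinate [l] where |w| is largest, the contribution of [A] to row [l] is at most mu
   |w_l|. *)
have [l _ lmax] := arg_maxP (fun i => `|w i 0|) (erefl (predT i)).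
apply: le_trans (vk l); apply: le_trans (_ : (1 - mu) * `|w l 0| <= _).
  by rewrite ler_wpM2l ?subr_ge0 ?(ltW mu1) //; exact: lmax.
rewrite vE mulmxDl mul1mx mxE [X in _ <= `|_ + X|]mxE.
apply: le_trans (lerB_normD _ _); rewrite mulrBl mul1r lerB //.
apply: le_trans (ler_norm_sum _ _ _) _.
apply: le_trans (ler_wpM2r (normr_ge0 (w l 0)) (rowA l)).
by rewrite mulr_suml; apply: ler_sum => j _; rewrite normrM ler_wpM2l //; exact: lmax.
Qed.

End DominantDiagonal.

(** * Gram matrices restricted to a support *)

Section MaskedGram.
Variables (R : realType) (m p : nat).
Implicit Types (S : {set 'I_p}) (D : 'M[R]_(m, p)).

Definition selmx S : 'M[R]_p := diag_mx (\row_i (i \in S)%:R).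

Definition gramoff D : 'M[R]_p := D^T *m D - 1%:M.

Definition maskmx S (A : 'M[R]_p) : 'M[R]_p := selmx S *m A *m selmx S.

(* Filling the complement of [S] with the identity keeps the Gram matrix of the
   columns in [S] of size p; its inverse is then block diagonal. *)
Definition invgram S D : 'M[R]_p := invmx (1%:M + maskmx S (gramoff D)).

Lemma selmx_mulE S n (A : 'M[R]_(p, n)) i j : (selmx S *m A) i j = (i \in S)%:R * A i j.
Proof. by rewrite mul_diag_mx !mxE. Qed.

Lemma mulmx_selmxE S n (A : 'M[R]_(n, p)) i j : (A *m selmx S) i j = A i j * (j \in S)%:R.
Proof. by rewrite mul_mx_diag !mxE. Qed.

Lemma maskmxE S A i j : maskmx S A i j = (i \in S)%:R * A i j * (j \in S)%:R.
Proof. by rewrite mulmx_selmxE selmx_mulE. Qed.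

Lemma trmx_selmx S : (selmx S)^T = selmx S.
Proof. exact: tr_diag_mx. Qed.

Lemma selmx_idem S : selmx S *m selmx S = selmx S.
Proof.
apply/matrixP => i j; rewrite selmx_mulE !mxE.
by case: (i \in S); rewrite ?mul1r // mul0r mul0rn.
Qed.

Lemma selmx_idemA S n (A : 'M[R]_(p, n)) : selmx S *m (selmx S *m A) = selmx S *m A.
Proof. by rewrite mulmxA selmx_idem. Qed.

Lemma selmx_idemAr S n (A : 'M[R]_(n, p)) : A *m selmx S *m selmx S = A *m selmx S.
Proof. by rewrite -mulmxA selmx_idem. Qed.

Lemma trmx_maskmx S A : (maskmx S A)^T = maskmx S A^T.
Proof. by rewrite !trmx_mul trmx_selmx mulmxA. Qed.

Lemma trmx_gramoff D : (gramoff D)^T = gramoff D.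
Proof. by rewrite linearB /= trmx1 trmx_mul trmxK. Qed.

Lemma gramE D i j : (D^T *m D) i j = fdot (col i D) (col j D).
Proof. by rewrite fdot_col mxE; apply: eq_bigr => k _; rewrite !mxE. Qed.

Lemma gramoff_diag D j : oblique D -> gramoff D j j = 0.
Proof.
by move=> oD; rewrite /gramoff mxE gramE -frob_sqr oD !mxE eqxx expr1n subrr.
Qed.

Lemma gramoff_neq D i j : i != j -> gramoff D i j = fdot (col i D) (col j D).
Proof. by move=> /negPf ij; rewrite /gramoff mxE gramE !mxE ij subr0. Qed.

Lemma cum_coherence_ge0 s D : 0 <= cum_coherence s D.
Proof. exact: bigmax_ge_id. Qed.

Lemma cum_coherence_ge s D S j : (#|S| <= s)%N -> j \notin S ->
  \sum_(i in S) `|fdot (col i D) (col j D)| <= cum_coherence s D.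
Proof.
move=> Ss jS; pose F (U : {set 'I_p}) k := \sum_(i in U) `|((col i D)^T *m col k D) 0 0|.
have -> : \sum_(i in S) `|fdot (col i D) (col j D)| = F S j.
  by apply: eq_bigr => i _; rewrite fdotE /mxtrace big_ord1.
apply: le_trans (le_bigmax_cond 0 (F S) jS) _.
exact: (le_bigmax_cond 0 (fun U : {set 'I_p} => \big[Num.max/0]_(k | k \notin U) F U k) Ss).
Qed.

Lemma cum_coherence_le s D (k : R) : 0 <= k ->
  (forall S j, (#|S| <= s)%N -> j \notin S ->
     \sum_(i in S) `|fdot (col i D) (col j D)| <= k) -> cum_coherence s D <= k.
Proof.
move=> k0 hk; apply: bigmax_le => // S Ss; apply: bigmax_le => // j jS.
apply: le_trans (hk _ _ Ss jS); rewrite le_eqVlt; apply/orP; left; apply/eqP.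
by apply: eq_bigr => i _; rewrite fdotE /mxtrace big_ord1.
Qed.

(** The diagonal of [gramoff D] vanishes, so row [i] only sees [S :\ i], a set that avoids [i] as
    the cumulative coherence requires. This provides the diagonal dominance behind [invgram]. *)
Lemma maskmx_gramoff_row s D S : oblique D -> (#|S| <= s)%N ->
  forall i, \sum_j `|maskmx S (gramoff D) i j| <= cum_coherence s D.
Proof.
move=> oD Ss i; have [iS|iS] := boolP (i \in S); last first.
  rewrite big1 ?cum_coherence_ge0 // => j _.
  by rewrite maskmxE (negPf iS) !mul0r normr0.
apply: le_trans (@cum_coherence_ge s D (S :\ i) i _ _); last 2 first.
- by rewrite (leq_trans _ Ss) // subset_leq_card // subsetDl.
- by rewrite !inE eqxx.
rewrite [leRHS]big_mkcond; apply: ler_sum => j _ /=.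
rewrite maskmxE iS mul1r !inE; have [->|ji] := eqVneq j i.
  by rewrite gramoff_diag // mul0r normr0.
case: (j \in S); last by rewrite mulr0 normr0.
by rewrite mulr1 gramoff_neq 1?eq_sym // fdotC.
Qed.

Section Inverse.
Variables (s : nat) (S : {set 'I_p}) (D : 'M[R]_(m, p)).
Hypotheses (Ss : (#|S| <= s)%N) (oD : oblique D) (mu1 : cum_coherence s D < 1).

Let symA : (maskmx S (gramoff D))^T = maskmx S (gramoff D).
Proof. by rewrite trmx_maskmx trmx_gramoff. Qed.

Let rowA := maskmx_gramoff_row oD Ss.

Lemma selmx_addmx : selmx S *m (1%:M + maskmx S (gramoff D)) = maskmx S (D^T *m D).
Proof.
rewrite mulmxDr mulmx1 /maskmx /gramoff !mulmxA selmx_idem mulmxBr mulmxBl mulmx1.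
by rewrite selmx_idem addrC subrK mulmxA.
Qed.

Lemma addmx_selmx : (1%:M + maskmx S (gramoff D)) *m selmx S = maskmx S (D^T *m D).
Proof.
rewrite mulmxDl mul1mx /maskmx /gramoff selmx_idemAr mulmxBr mulmxBl mulmx1.
by rewrite selmx_idem addrC subrK.
Qed.

Lemma invgram_unit : 1%:M + maskmx S (gramoff D) \in unitmx.
Proof. exact: addmx_unit symA rowA mu1. Qed.

Lemma trmx_invgram : (invgram S D)^T = invgram S D.
Proof. by rewrite trmx_inv linearD /= trmx1 symA. Qed.

(** The padded Gram matrix is block diagonal with respect to [S], and so is its inverse. *)
Lemma invgramC : invgram S D *m selmx S = selmx S *m invgram S D.
Proof.
rewrite -[LHS]mulmx1 -(mulmxV invgram_unit) mulmxA -(mulmxA (invgram S D)) selmx_addmx.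
by rewrite -addmx_selmx mulmxA mulVmx ?invgram_unit // mul1mx.
Qed.

Lemma invgram_gram : invgram S D *m maskmx S (D^T *m D) = selmx S.
Proof. by rewrite -addmx_selmx mulmxA mulVmx ?invgram_unit // mul1mx. Qed.

Lemma frob_invgram_le c (B : 'M[R]_(p, c)) :
  (1 - cum_coherence s D) * frob (invgram S D *m B) <= frob B.
Proof. exact: frob_invmx_le symA rowA mu1 _ _. Qed.

Lemma sup_invgram_le (v : 'cV[R]_p) (k : R) : (forall i, `|v i 0| <= k) ->
  forall i, (1 - cum_coherence s D) * `|(invgram S D *m v) i 0| <= k.
Proof. exact: sup_invmx_le rowA mu1 _ _. Qed.

End Inverse.
End MaskedGram.

(** * LASSO values and their dual bounds *)

Section Lasso.
Variables (R : realType) (m p : nat) (lambda : R).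
Hypothesis lambda0 : 0 < lambda.
Implicit Types (S : {set 'I_p}) (D : 'M[R]_(m, p)) (y : 'cV[R]_m) (x : 'cV[R]_p).

Definition lasso_cost y D x : R := 2^-1 * frob (y - D *m x) ^+ 2 + lambda * l1norm x.

Lemma l1norm_ge0 x : 0 <= l1norm x.
Proof. exact: sumr_ge0. Qed.

Lemma lasso_cost_ge0 y D x : 0 <= lasso_cost y D x.
Proof.
by rewrite addr_ge0 // mulr_ge0 ?sqr_ge0 ?l1norm_ge0 // ltW.
Qed.

Lemma lasso_obj_le y D x : lasso_obj lambda y D <= lasso_cost y D x.
Proof.
apply: inf_lbound; last by exists x.
by exists 0 => _ [z _ <-]; exact: lasso_cost_ge0.
Qed.

Lemma lasso_obj_ge y D (k : R) : (forall x, k <= lasso_cost y D x) ->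
  k <= lasso_obj lambda y D.
Proof.
move=> h; apply: lb_le_inf; first by exists (lasso_cost y D 0), 0.
by move=> _ [x _ <-]; exact: h.
Qed.

Lemma lasso_obj_ge0 y D : 0 <= lasso_obj lambda y D.
Proof. by apply: lasso_obj_ge => x; exact: lasso_cost_ge0. Qed.

Lemma lasso_obj_le_sqr y D : lasso_obj lambda y D <= 2^-1 * frob y ^+ 2.
Proof.
rewrite (le_trans (lasso_obj_le y D 0)) // /lasso_cost mulmx0 subr0 /l1norm big1 ?mulr0 ?addr0 //.
by move=> i _; rewrite mxE normr0.
Qed.

Lemma lasso_obj_lt y D (e : R) : 0 < e ->
  exists x, lasso_cost y D x < lasso_obj lambda y D + e.
Proof.
move=> e0; have [] := @inf_adherent _ [set lasso_cost y D x | x in setT] e e0.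
  split; first by exists (lasso_cost y D 0), 0.
  by exists 0 => _ [z _ <-]; exact: lasso_cost_ge0.
by move=> _ [x _ <-] h; exists x.
Qed.

Lemma fdot_le_sup (u x : 'cV[R]_p) (k : R) :
  (forall j, `|u j 0| <= k) -> fdot u x <= k * l1norm x.
Proof.
move=> uk; rewrite fdot_col mulr_sumr; apply: ler_sum => i _.
by rewrite (le_trans (ler_norm _)) // normrM ler_wpM2r.
Qed.

(** Weak duality: [u] is feasible for the dual, <D^T u, x> <= lambda |x|_1, and the remaining slack
    is |y - D x - u|^2 / 2. *)
Lemma lasso_dual y D (u : 'cV[R]_m) : (forall j, `|(D^T *m u) j 0| <= lambda) ->
  fdot u y - 2^-1 * frob u ^+ 2 <= lasso_obj lambda y D.
Proof.
move=> du; apply: lasso_obj_ge => x; rewrite /lasso_cost.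
have := fdot_le_sup x du; rewrite fdot_mulmxl trmxK => h1.
have [v vE] : exists v, v = y - D *m x by eexists.
rewrite -vE; have : 0 <= frob (v - u) ^+ 2 by exact: sqr_ge0.
have -> : fdot u y = fdot v u + fdot u (D *m x) by rewrite vE (fdotC (y - _)) -fdotDr subrK.
rewrite frob_sqr fdotBl !fdotBr -!frob_sqr (fdotC u v); lra.
Qed.

(** Stationarity on [S] with signs [sg] reads D_S^T D_S x = D_S^T y - lambda sg. This is the
    right-hand side; for [sg] supported in [S], [lasso_sol] is the solution padded with zeros. *)
Definition lasso_rhs S D y (sg : 'cV[R]_p) := selmx R S *m (D^T *m y) - lambda *: sg.

Definition lasso_sol S D y sg := invgram S D *m lasso_rhs S D y sg.

(* Value of the LASSO when [S] and [sg] are the support and signs of its solution. *)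
Definition lasso_phi S D y sg : R :=
  2^-1 * frob y ^+ 2 - 2^-1 * fdot (lasso_rhs S D y sg) (lasso_sol S D y sg).

Section ClosedForm.
Variables (s : nat) (S : {set 'I_p}) (D : 'M[R]_(m, p)) (y : 'cV[R]_m) (sg : 'cV[R]_p).
Hypotheses (Ss : (#|S| <= s)%N) (oD : oblique D) (mu1 : cum_coherence s D < 1).
Hypothesis sgS : selmx R S *m sg = sg.

Let z := lasso_rhs S D y sg.
Let x := lasso_sol S D y sg.

Lemma selmx_lasso_rhs : selmx R S *m z = z.
Proof. by rewrite /z /lasso_rhs mulmxBr selmx_idemA -scalemxAr sgS. Qed.

Lemma selmx_lasso_sol : selmx R S *m x = x.
Proof. by rewrite /x /lasso_sol mulmxA -(invgramC Ss) // -mulmxA selmx_lasso_rhs. Qed.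

Lemma gram_lasso_sol : selmx R S *m (D^T *m (D *m x)) = z.
Proof.
have /(congr1 trmx) := @invgram_gram _ _ _ s S D Ss oD mu1.
rewrite trmx_mul trmx_maskmx trmx_mul trmxK trmx_invgram // trmx_selmx => e.
have : maskmx S (D^T *m D) *m x = z by rewrite /x /lasso_sol mulmxA e selmx_lasso_rhs.
by rewrite /maskmx -!mulmxA selmx_lasso_sol.
Qed.

Lemma fdot_lasso_sol : frob (D *m x) ^+ 2 = fdot z x.
Proof.
rewrite frob_sqr fdot_mulmxl -gram_lasso_sol fdotC [RHS]fdot_mulmxl trmx_selmx.
by rewrite selmx_lasso_sol.
Qed.

Lemma fdot_lasso_rhs : fdot y (D *m x) = fdot z x + lambda * fdot sg x.
Proof.
have -> : fdot y (D *m x) = fdot (D^T *m y) (selmx R S *m x).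
  by rewrite selmx_lasso_sol fdotC fdot_mulmxl fdotC.
by rewrite fdotC fdot_mulmxl trmx_selmx fdotC -fdotZl -fdotDl subrK.
Qed.

(** Primal bound: the sign condition makes the penalty linear, and the cost of [x] is then exactly
    [lasso_phi]. *)
Lemma lasso_obj_le_phi : l1norm x = fdot sg x ->
  lasso_obj lambda y D <= lasso_phi S D y sg.
Proof.
move=> l1; apply: le_trans (lasso_obj_le y D x) _; rewrite /lasso_cost l1 /lasso_phi -/z -/x.
rewrite [frob (y - _) ^+ 2]frob_sqr fdotBl !fdotBr -!frob_sqr fdot_lasso_sol (fdotC _ y).
rewrite fdot_lasso_rhs; lra.
Qed.

(** Dual bound with the residual y - D x as dual variable: its dual value is (|y|^2 - |D x|^2) / 2,
    and |D x|^2 = <z, x>. *)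
Lemma lasso_phi_le : (forall j, `|(D^T *m (y - D *m x)) j 0| <= lambda) ->
  lasso_phi S D y sg <= lasso_obj lambda y D.
Proof.
move=> du; apply: le_trans (lasso_dual y du); rewrite /lasso_phi -/z -/x -fdot_lasso_sol.
by rewrite [frob (y - _) ^+ 2]frob_sqr !fdotBl !fdotBr -!frob_sqr (fdotC _ y); lra.
Qed.

End ClosedForm.
End Lasso.

(** * Exact recovery of the support and signs *)

Section Recovery.
Variables (R : realType) (m p : nat).
Implicit Types (S : {set 'I_p}) (D : 'M[R]_(m, p)).

Lemma frob_mul_selmx D S : frob (D *m selmx R S) ^+ 2 = \sum_(i in S) frob (col i D) ^+ 2.
Proof.
rewrite frob_cols [RHS]big_mkcond; apply: eq_bigr => j _.
rewrite !frob_sqrE (_ : (if _ then _ else _) = (j \in S)%:R * \sum_i \sum_k col j D i k ^+ 2).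
  rewrite mulr_sumr; apply: eq_bigr => i _; rewrite !big_ord1 mxE mulmx_selmxE mxE.
  by case: (j \in S); rewrite ?mulr1 ?mul1r // mulr0 expr0n mul0r.
by case: (j \in S); rewrite ?mul1r ?mul0r // frob_sqrE.
Qed.

Lemma frob_supported_sign_le S (v : 'cV[R]_p) :
  frob (\col_i ((i \in S)%:R * Num.sg (v i 0)) : 'cV[R]_p) ^+ 2 <= #|S|%:R.
Proof.
rewrite frob_sqrE -sum1_card natr_sum [leRHS]big_mkcond; apply: ler_sum => i _.
rewrite big_ord1 mxE; case: (i \in S); last by rewrite mul0r expr0n.
by rewrite mul1r sqr_sg ler_nat leq_b1.
Qed.

Lemma sum_normr_fdot S (v : 'cV[R]_p) :
  \sum_(i in S) `|v i 0| = fdot (\col_i ((i \in S)%:R * Num.sg (v i 0)) : 'cV[R]_p) v.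
Proof.
rewrite fdot_col [LHS]big_mkcond; apply: eq_bigr => i _; rewrite mxE.
by case: (i \in S); rewrite ?mul1r ?mul0r // normrEsg.
Qed.

(** A restricted isometry bound: |D v|^2 - |v|^2 = <v, (D^T D - 1) v>, where only the block on [S]
    acts on [v]. *)
Lemma frob_mulmx_supported_le s S D (v : 'cV[R]_p) : (#|S| <= s)%N -> oblique D ->
  selmx R S *m v = v ->
  frob (D *m v) ^+ 2 <= (1 + cum_coherence s D) * frob v ^+ 2.
Proof.
move=> Ss oD Sv; have symA : (maskmx S (gramoff D))^T = maskmx S (gramoff D).
  by rewrite trmx_maskmx trmx_gramoff.
have := normr_fdot_mulmx_le symA (maskmx_gramoff_row oD Ss) v.
have -> : fdot v (maskmx S (gramoff D) *m v) = frob (D *m v) ^+ 2 - frob v ^+ 2.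
  rewrite /maskmx -!mulmxA Sv -{1}(trmx_selmx R S) -fdot_mulmxl Sv.
  by rewrite mulmxBl mul1mx fdotBr -frob_sqr -mulmxA fdotC fdot_mulmxl trmxK -frob_sqr.
by rewrite ler_norml mulrDl mul1r => /andP[_]; lra.
Qed.

(** With [w] the signs of the correlations on [S], their absolute sum is <D w, d_j> = <D0 w, d0_j> +
    <D0 w, e_j> + <E w, d_j>. The first term is at most the coherence of [D0], the others are linear
    in [E]. *)
Lemma cum_coherence_perturb s D D0 : oblique D -> oblique D0 ->
  cum_coherence s D0 <= 4^-1 ->
  cum_coherence s D <= cum_coherence s D0 + 3 / 2 * Num.sqrt s%:R * frob (D - D0).
Proof.
move=> oD oD0 mu4; apply: cum_coherence_le.
  by rewrite addr_ge0 ?cum_coherence_ge0 // mulr_ge0 ?frob_ge0 // mulr_ge0 ?sqrtr_ge0.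
move=> S j Ss jS; set E := D - D0.
pose v : 'cV[R]_p := D^T *m col j D.
pose w : 'cV[R]_p := \col_i ((i \in S)%:R * Num.sg (v i 0)).
have Sw : selmx R S *m w = w.
  apply/matrixP => i k; rewrite selmx_mulE !mxE.
  by case: (i \in S); rewrite ?mul1r // !mul0r.
have ws : frob w <= Num.sqrt s%:R.
  rewrite -ler_sqr ?nnegrE ?frob_ge0 ?sqrtr_ge0 // [leRHS]sqr_sqrtr ?ler0n //.
  by apply: le_trans (frob_supported_sign_le S v) _; rewrite ler_nat.
have -> : \sum_(i in S) `|fdot (col i D) (col j D)| = fdot w v.
  rewrite -sum_normr_fdot; apply: eq_bigr => i _.
  by rewrite /v mxE fdot_col; congr (`| _ |); apply: eq_bigr => k _; rewrite !mxE.
have -> : fdot w v = fdot (D0 *m w) (col j D0) + fdot (D0 *m w) (col j E)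
                     + fdot (E *m w) (col j D).
  rewrite /v -fdot_mulmxl -fdotDr /E mulmxBl fdotBl -[in LHS](subrK (D0 *m w) (D *m w)).
  rewrite fdotDl fdotBl addrC; congr (_ + _); congr fdot.
  by apply/matrixP => k l; rewrite !mxE addrC subrK.
have c2 : Num.sqrt (5 / 4) ^+ 2 = 5 / 4 :> R by rewrite sqr_sqrtr //; lra.
have t1 : fdot (D0 *m w) (col j D0) <= cum_coherence s D0.
  apply: le_trans (cum_coherence_ge D0 Ss jS).
  rewrite fdot_mulmxl fdot_col [leRHS]big_mkcond; apply: ler_sum => i _.
  rewrite mxE; case: (i \in S); last by rewrite !mul0r.
  rewrite mul1r (le_trans (ler_norm _)) // normrM normr_sg.
  rewrite [X in `|X|]mxE fdot_col (_ : \sum_k _ = \sum_k col i D0 k 0 * col j D0 k 0).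
    by rewrite ler_piMl // lern1 leq_b1.
  by apply: eq_bigr => k _; rewrite !mxE.
have t2 : fdot (D0 *m w) (col j E) <= Num.sqrt (5 / 4) * Num.sqrt s%:R * frob (col j E).
  apply: le_trans (fdot_le _ _) _; rewrite ler_wpM2r ?frob_ge0 //.
  rewrite -ler_sqr ?nnegrE ?frob_ge0 ?mulr_ge0 ?sqrtr_ge0 //.
  rewrite [leRHS]exprMn c2.
  apply: le_trans (frob_mulmx_supported_le Ss oD0 Sw) _.
  apply: ler_pM; rewrite ?addr_ge0 ?cum_coherence_ge0 ?sqr_ge0 //; first by lra.
  by rewrite ler_sqr ?nnegrE ?frob_ge0 ?sqrtr_ge0.
have t3 : fdot (E *m w) (col j D) <= Num.sqrt s%:R * frob (E *m selmx R S).
  apply: le_trans (fdot_le _ _) _; rewrite oD mulr1 -{1}Sw mulmxA.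
  by rewrite (le_trans (frob_mulmx _ _)) // mulrC ler_wpM2r ?frob_ge0.
have ab : frob (E *m selmx R S) ^+ 2 + frob (col j E) ^+ 2 <= frob E ^+ 2.
  rewrite frob_mul_selmx (frob_cols E) [leRHS](bigID (mem S)) /= lerD2l.
  rewrite (bigD1 j) //= lerDl; apply: sumr_ge0 => i _; exact: sqr_ge0.
(* Since [j] is outside [S], the two norms are legs of a vector of length at most |E|;
   Cauchy-Schwarz gives the factor sqrt (5/4 + 1) = 3/2. *)
have : Num.sqrt (5 / 4) * frob (col j E) + frob (E *m selmx R S) <= 3 / 2 * frob E.
  rewrite -ler_sqr ?nnegrE ?addr_ge0 ?mulr_ge0 ?frob_ge0 ?sqrtr_ge0 //.
  move: ab c2; move: (Num.sqrt (5 / 4)) (frob (col j E)) (frob _) (frob E) => c b a e ab c2.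
  have := sqr_ge0 (c * a - b); nra.
have := sqrtr_ge0 (s%:R : R); nra.
Qed.

Variables (lambda : R) (s : nat) (D0 : 'M[R]_(m, p)) (S : {set 'I_p}).
Variables (x0 : 'cV[R]_p) (eps : 'cV[R]_m) (Mx xlow Meps : R).
Hypotheses (lambda0 : 0 < lambda) (Ss : #|S| = s) (oD0 : oblique D0).
Hypotheses (x0S : forall j, j \notin S -> x0 j 0 = 0) (x0M : frob x0 <= Mx).
Hypotheses (x0low : forall j, j \in S -> xlow <= `|x0 j 0|) (epsM : frob eps <= Meps).
Hypotheses (mu4 : cum_coherence s D0 <= 4^-1).

Let y := D0 *m x0 + eps.

Lemma selmx_supported (v : 'cV[R]_p) : (forall j, j \notin S -> v j 0 = 0) ->
  selmx R S *m v = v.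
Proof.
move=> vS; apply/matrixP => i k; rewrite selmx_mulE (ord1 k).
by have [iS|/vS ->] := boolP (i \in S); rewrite ?mul1r ?mulr0.
Qed.

Lemma sgv_supported : selmx R S *m sgv x0 = sgv x0.
Proof. by apply: selmx_supported => j jS; rewrite mxE x0S // sgr0. Qed.

Lemma normr_sgv_le1 j : `|sgv x0 j 0| <= 1.
Proof. by rewrite mxE normr_sg lern1 leq_b1. Qed.

(** The closed-form solution at [D0] is x0 + H0 (D0_S^T eps - lambda sgn x0), and the correction is
    too small to flip a sign. *)
Lemma lasso_obj_le_phi_recovery : lambda <= xlow / 4 -> Meps <= lambda ->
  lasso_obj lambda y D0 <= lasso_phi lambda S D0 y (sgv x0).
Proof.
move=> lx Ml; have l0 := lambda0.
have mu1 : cum_coherence s D0 < 1 by apply: le_lt_trans mu4 _; lra.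
have Ss' : (#|S| <= s)%N by rewrite Ss.
apply: (lasso_obj_le_phi lambda0 Ss') => //; first exact: sgv_supported.
set x := lasso_sol _ _ _ _ _.
have xE : x = x0 + invgram S D0 *m (selmx R S *m (D0^T *m eps) - lambda *: sgv x0).
  rewrite /x /lasso_sol /lasso_rhs /y (mulmxDr D0^T) (mulmxDr (selmx R S)) -addrA.
  rewrite [LHS]mulmxDr; congr (_ + _).
  have := invgram_gram Ss' oD0 mu1.
  move=> /(congr1 (mulmx^~ x0)); rewrite (selmx_supported x0S) => {2}<-.
  by rewrite /maskmx -!mulmxA (selmx_supported x0S).
have wle i : `|(selmx R S *m (D0^T *m eps) - lambda *: sgv x0) i 0| <= Meps + lambda.
  rewrite mxE (le_trans (ler_normD _ _)) // lerD //; last first.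
    by rewrite !mxE normrN normrM gtr0_norm // ler_piMr ?(ltW lambda0) // normr_sg lern1 leq_b1.
  rewrite (le_trans _ epsM) //.
  have -> : (selmx R S *m (D0^T *m eps)) i 0 = (i \in S)%:R * fdot (col i D0) eps.
    rewrite selmx_mulE; congr (_ * _); rewrite mxE fdot_col.
    by apply: eq_bigr => k _; rewrite !mxE.
  rewrite normrM (le_trans (_ : _ <= 1 * `|fdot (col i D0) eps|)) //.
    by rewrite ler_wpM2r // normr_nat lern1 leq_b1.
  by rewrite mul1r (le_trans (normr_fdot_le _ _)) // oD0 mul1r.
have xS : selmx R S *m x = x by apply: selmx_lasso_sol Ss' oD0 mu1 sgv_supported.
clearbody x; rewrite fdot_col; apply: eq_bigr => i _; rewrite [sgv x0 i 0]mxE.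
have [iS|iS] := boolP (i \in S); last first.
  by rewrite -xS selmx_mulE (negPf iS) mul0r normr0 mulr0.
have := sup_invgram_le Ss' oD0 mu1 wle i.
have := x0low iS; rewrite xE [(x0 + _) i 0]mxE.
move: ((_ *m _) i 0) => d h1 h2.
(* Here (1 - mu) |d| <= Meps + lambda <= 2 lambda with mu <= 1/4, so |d| <= 8/3 lambda < 4 lambda <=
   xlow. *)
have {}h2 : `|d| < `|x0 i 0|.
  have mu4' : 0 <= 4^-1 - cum_coherence s D0 by rewrite subr_ge0.
  have := mulr_ge0 mu4' (normr_ge0 d); lra.
move: h2; rewrite ltr_norml; have [h|h|->] := ltrgt0P (x0 i 0).
- by rewrite gtr0_sg // mul1r => /andP[? ?]; rewrite ger0_norm //; lra.
- by rewrite ltr0_sg // mulN1r => /andP[? ?]; rewrite ler0_norm //; lra.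
- by move=> /andP[]; lra.
Qed.

(** With signs 0 [lasso_sol] is the least squares solution on [S], so the residual is an orthogonal
    projection of [r]. *)
Lemma frob_residual_le D (r : 'cV[R]_m) : oblique D -> cum_coherence s D < 1 ->
  frob (r - D *m lasso_sol lambda S D r 0) <= frob r.
Proof.
move=> oD mu1; have Ss' : (#|S| <= s)%N by rewrite Ss.
have S0 : selmx R S *m (0 : 'cV[R]_p) = 0 by rewrite mulmx0.
have := fdot_lasso_rhs lambda r Ss' oD mu1 S0.
have := fdot_lasso_sol lambda r Ss' oD mu1 S0.
rewrite fdot0l mulr0 addr0.
move=> <-; move: (D *m _) => a ra; rewrite -ler_sqr ?nnegrE ?frob_ge0 //.
rewrite [leLHS]frob_sqr fdotBl !fdotBr -!frob_sqr (fdotC a) ra.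
by have := sqr_ge0 (frob a); lra.
Qed.

Variables (D : 'M[R]_(m, p)) (rho : R).
Hypotheses (oD : oblique D) (Drho : frob (D - D0) <= rho).

(** The residual is dual feasible: on [S] its correlations equal lambda sgn x0 by stationarity;
    outside [S] the noise and the drift of [D] use lambda (1 - 2 mu) and the sign term 2 lambda
    mu. *)
Lemma lasso_phi_le_recovery : cum_coherence s D <= 2^-1 ->
  Meps + rho * Mx <= lambda * (1 - 2 * cum_coherence s D) ->
  lasso_phi lambda S D y (sgv x0) <= lasso_obj lambda y D.
Proof.
move=> mu2 hM; have l0 := lambda0; have mu1 : cum_coherence s D < 1 by lra.
have Ss' : (#|S| <= s)%N by rewrite Ss.
apply: (lasso_phi_le Ss') => //; first exact: sgv_supported.
set x := lasso_sol _ _ _ _ _; move=> j.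
have [jS|jS] := boolP (j \in S).
  have -> : (D^T *m (y - D *m x)) j 0 = (selmx R S *m (D^T *m (y - D *m x))) j 0.
    by rewrite selmx_mulE jS mul1r.
  rewrite mulmxBr mulmxBr (gram_lasso_sol _ _ Ss' oD mu1 sgv_supported) opprB addrC subrK.
  by rewrite mxE normrM gtr0_norm // ler_piMr ?(ltW lambda0) // normr_sgv_le1.
(* Seen from [D], the observation is [D *m x0 + r]: the drift from [D0] acts as additional noise.
   The part [D *m x0] is reproduced exactly by the solution. *)
pose r := eps - (D - D0) *m x0; pose x' := lasso_sol lambda S D r 0.
have uE : y - D *m x = (r - D *m x') + lambda *: (D *m (invgram S D *m sgv x0)).
  have yE : y = D *m x0 + r.
    rewrite /y /r mulmxBl; move: (D *m x0) (D0 *m x0) => a b.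
    by apply/matrixP => i k; rewrite !mxE; ring.
  have -> : x = x0 + x' - lambda *: (invgram S D *m sgv x0).
    rewrite /x /x' /lasso_sol /lasso_rhs yE scaler0 subr0 mulmxBr -scalemxAr; congr (_ - _).
    rewrite !mulmxDr; congr (_ + _).
    have := invgram_gram Ss' oD mu1.
    move=> /(congr1 (mulmx^~ x0)); rewrite (selmx_supported x0S) => {2}<-.
    by rewrite /maskmx -!mulmxA (selmx_supported x0S).
  rewrite mulmxBr mulmxDr yE -scalemxAr.
  move: (D *m x0) (D *m x') (D *m (_ *m _)) => a b c.
  by apply/matrixP => i k; rewrite !mxE; ring.
have uj : (D^T *m (y - D *m x)) j 0 = fdot (col j D) (y - D *m x).
  by rewrite mxE fdot_col; apply: eq_bigr => k _; rewrite !mxE.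
rewrite uj uE fdotDr fdotZr (le_trans (ler_normD _ _)) //.
have t1 : `|fdot (col j D) (r - D *m x')| <= Meps + rho * Mx.
  rewrite (le_trans (normr_fdot_le _ _)) // oD mul1r.
  apply: le_trans (_ : frob r <= _).
    exact: frob_residual_le.
  rewrite /r (le_trans (frobB _ _)) // lerD // (le_trans (frob_mulmx _ _)) //.
  by apply: ler_pM; rewrite ?frob_ge0.
have t2 : `|fdot (col j D) (D *m (invgram S D *m sgv x0))| * (1 - cum_coherence s D)
           <= cum_coherence s D.
  have hS : selmx R S *m (invgram S D *m sgv x0) = invgram S D *m sgv x0.
    by rewrite mulmxA -(invgramC Ss' oD mu1) -mulmxA sgv_supported.
  rewrite -hS.
  have := sup_invgram_le Ss' oD mu1 normr_sgv_le1.
  set h := invgram S D *m _; move=> hh.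
  rewrite fdotC fdot_mulmxl fdot_col.
  apply: le_trans (cum_coherence_ge D Ss' jS).
  rewrite mulrC; apply: le_trans (ler_wpM2l _ (ler_norm_sum _ _ _)) _; first lra.
  rewrite mulr_sumr [leRHS]big_mkcond; apply: ler_sum => i _.
  rewrite selmx_mulE; case: (i \in S); last by rewrite !mul0r normr0 mulr0.
  rewrite mul1r normrM mulrA (_ : (D^T *m col j D) i 0 = fdot (col i D) (col j D)).
    by rewrite ler_piMl.
  by rewrite mxE fdot_col; apply: eq_bigr => k _; rewrite !mxE.
rewrite normrM gtr0_norm //.
have := cum_coherence_ge0 s D; have := normr_ge0 (fdot (col j D) (D *m (invgram S D *m sgv x0))).
move: t2; set k := `|fdot _ (D *m (_ *m _))| => t2 k0 c0.
(* From k (1 - mu) <= mu and mu <= 1/2. *)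
have : k <= 2 * cum_coherence s D by nra.
nra.
Qed.

End Recovery.

(** * Averages over random supports *)

Section SubsetCounting.
Variables (R : realType) (p s : nat).

(** Supports avoiding [A] are the s-subsets of its complement, a single binomial; memberships are
    recovered from such counts by inclusion-exclusion. *)
Lemma sum_subsets_avoiding (A : {set 'I_p}) :
  \sum_(S : {set 'I_p} | #|S| == s) (S \subset ~: A)%:R = 'C(p - #|A|, s)%:R :> R.
Proof.
rewrite -natr_sum -big_mkcondr /= sum1_card -cardsE; congr _%:R.
have -> : (p - #|A|)%N = #|~: A| by rewrite [RHS]cardsCs finset.setCK card_ord.
by rewrite -cards_draws; apply: eq_card => S; rewrite !inE andbC.
Qed.

Lemma sum_subsets1 : \sum_(S : {set 'I_p} | #|S| == s) 1 = 'C(p, s)%:R :> R.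
Proof.
rewrite -[in RHS](subn0 p) -(cards0 'I_p) -sum_subsets_avoiding.
by apply: eq_bigr => S _; rewrite finset.setC0 finset.subsetT.
Qed.

Hypothesis sp : (s <= p)%N.

Let bin_down (q : nat) : (0 < q)%N -> (s <= q)%N ->
  q%:R * 'C(q.-1, s)%:R = (q%:R - s%:R) * 'C(q, s)%:R :> R.
Proof. by move=> q0 sq; rewrite -natrB // -!natrM mul_bin_down. Qed.

Lemma sum_subsets_mem (i : 'I_p) :
  p%:R * \sum_(S : {set 'I_p} | #|S| == s) (i \in S)%:R = s%:R * 'C(p, s)%:R :> R.
Proof.
have -> : \sum_(S : {set 'I_p} | #|S| == s) (i \in S)%:R =
    \sum_(S : {set 'I_p} | #|S| == s) 1
    - \sum_(S : {set 'I_p} | #|S| == s) (S \subset ~: [set i])%:R :> R.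
  rewrite -sumrB; apply: eq_bigr => S _.
  by rewrite finset.subsetC finset.sub1set inE; case: (i \in S); rewrite ?subrr ?subr0.
have p0 : (0 < p)%N by apply: leq_ltn_trans (ltn_ord i).
rewrite sum_subsets1 sum_subsets_avoiding cards1 subn1 mulrBr bin_down //; ring.
Qed.

(** Drawing without replacement: a pair has frequency s (s - 1) / (p (p - 1)), which is at most
    (s/p)^2. *)
Lemma sum_subsets_mem2 (i j : 'I_p) : i != j ->
  p%:R ^+ 2 * \sum_(S : {set 'I_p} | #|S| == s) (i \in S)%:R * (j \in S)%:R
    <= s%:R ^+ 2 * 'C(p, s)%:R :> R.
Proof.
move=> ij.
have -> : \sum_(S : {set 'I_p} | #|S| == s) (i \in S)%:R * (j \in S)%:R =
    \sum_(S : {set 'I_p} | #|S| == s) 1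
    - \sum_(S : {set 'I_p} | #|S| == s) (S \subset ~: [set i])%:R
    - \sum_(S : {set 'I_p} | #|S| == s) (S \subset ~: [set j])%:R
    + \sum_(S : {set 'I_p} | #|S| == s) (S \subset ~: [set i; j])%:R :> R.
  rewrite -!sumrB -big_split; apply: eq_bigr => S _ /=.
  rewrite ![S \subset _]finset.subsetC finset.subUset !finset.sub1set !inE.
  by case: (i \in S); case: (j \in S) => /=; ring.
rewrite sum_subsets1 !sum_subsets_avoiding !cards1 cards2 ij subn1 subn2.
have p1 : (1 < p)%N by have := max_card [set i; j]%SET; rewrite cards2 ij card_ord.
have p0 : (0 < p)%N by apply: leq_trans p1.
have h1 := bin_down p0 sp.
(* The recursion from [p.-1] to [p.-2] requires [s <= p.-1]; in the remaining case s = p, both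
   avoiding counts are 0. *)
have [sp1|] := leqP s p.-1; last first.
  move=> h; have sE : s = p by apply/eqP; rewrite eqn_leq sp /= -(prednK p0).
  rewrite sE (@bin_small p.-1) ?prednK // (@bin_small p.-2) ?subr0 ?addr0 ?lexx //.
  by rewrite (leq_ltn_trans (leq_pred _)) // prednK.
have h2 : (p%:R - 1) * 'C(p.-2, s)%:R = (p%:R - 1 - s%:R) * 'C(p.-1, s)%:R :> R.
  have := bin_down (_ : 0 < p.-1)%N sp1; rewrite -subn1 natrB // => -> //.
  by rewrite subn_gt0.
move: h1 h2; set c := 'C(p, s)%:R; set c1 := 'C(p.-1, s)%:R; set c2 := 'C(p.-2, s)%:R.
have c0 : 0 <= c :> R by exact: ler0n.
have s0 : 0 <= s%:R :> R by exact: ler0n.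
have psR : s%:R <= p%:R :> R by rewrite ler_nat.
have p1R : 1 < p%:R :> R by rewrite ltr1n.
move: c0 s0 psR p1R; move: c c1 c2 (s%:R : R) (p%:R : R) => c c1 c2 x y c0 x0 xy y1 h1 h2.
(* A factor p - 1 lets both counting identities apply; the two sides then differ by C(p, s) s (p -
   s). *)
have yy : 0 < y - 1 by lra.
suff : (y - 1) * (y ^+ 2 * (c - c1 - c1 + c2)) <= (y - 1) * (x ^+ 2 * c) by rewrite ler_pM2l.
have -> : (y - 1) * (y ^+ 2 * (c - c1 - c1 + c2)) =
   y ^+ 2 * ((y - 1) * c) - 2 * (y - 1) * y * (y * c1) + y ^+ 2 * ((y - 1) * c2) by ring.
rewrite h2 h1.
have -> : y ^+ 2 * ((y - 1 - x) * c1) = y * (y - 1 - x) * (y * c1) by ring.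
rewrite h1 -subr_ge0.
have -> : (y - 1) * (x ^+ 2 * c) - (y ^+ 2 * ((y - 1) * c) - 2 * (y - 1) * y * ((y - x) * c) +
   y * (y - 1 - x) * ((y - x) * c)) = c * (x * (y - x)) by ring.
by rewrite !mulr_ge0 // subr_ge0.
Qed.

End SubsetCounting.

(** * Mean Frobenius norms of matrices restricted to a random support *)

Section MaskedAverages.
Variables (R : realType) (p s : nat).
Hypothesis sp : (s <= p)%N.

(** Cauchy-Schwarz for sums over a predicate, obtained from [fdot_le] by listing the values in row
    vectors. *)
Lemma sum_mul_le (I : finType) (P : pred I) (a b : I -> R) (x y : R) :
  0 <= x -> 0 <= y -> \sum_(i | P i) a i ^+ 2 <= x ^+ 2 ->
  \sum_(i | P i) b i ^+ 2 <= y ^+ 2 -> \sum_(i | P i) a i * b i <= x * y.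
Proof.
move=> x0 y0 ax bx; pose rv (f : I -> R) : 'rV[R]_#|P| := \row_k f (enum_val k).
have rvE f g : fdot (rv f) (rv g) = \sum_(i | P i) f i * g i.
  rewrite /fdot big_ord1 -(eq_bigl (mem P) _ (fun _ => erefl)) (big_enum_val (fun i => f i * g i)).
  by apply: eq_bigr => k _; rewrite !mxE.
rewrite -rvE; apply: le_trans (fdot_le _ _) _; apply: ler_pM; rewrite ?frob_ge0 //.
  rewrite -ler_sqr ?nnegrE ?frob_ge0 // frob_sqr rvE; apply: le_trans ax.
  by apply: ler_sum => i _; rewrite expr2.
rewrite -ler_sqr ?nnegrE ?frob_ge0 // frob_sqr rvE; apply: le_trans bx.
by apply: ler_sum => i _; rewrite expr2.
Qed.

Lemma sum_frob_selmx m (E : 'M[R]_(m, p)) : (0 < p)%N ->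
  \sum_(S : {set 'I_p} | #|S| == s) frob (E *m selmx R S) ^+ 2
    = 'C(p, s)%:R * (s%:R / p%:R) * frob E ^+ 2.
Proof.
move=> p0; have p0R : p%:R != 0 :> R by rewrite pnatr_eq0 -lt0n.
rewrite (eq_bigr (fun S : {set 'I_p} => \sum_i (i \in S)%:R * frob (col i E) ^+ 2)); last first.
  move=> S _; rewrite frob_mul_selmx big_mkcond; apply: eq_bigr => i _.
  by case: (i \in S); rewrite ?mul1r ?mul0r.
rewrite exchange_big frob_cols mulr_sumr; apply: eq_bigr => i _ /=.
rewrite -mulr_suml; congr (_ * _); apply: (mulfI p0R); rewrite sum_subsets_mem //.
by rewrite mulrCA mulrC [p%:R * _]mulrC divfK.
Qed.

(** Off-diagonal entries survive with frequency at most (s/p)^2, diagonal ones only with s/p; the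
    zero diagonal secures the better rate. *)
Lemma sum_frob_maskmx_le (X : 'M[R]_p) : (0 < p)%N -> (forall i, X i i = 0) ->
  \sum_(S : {set 'I_p} | #|S| == s) frob (maskmx S X) ^+ 2
    <= 'C(p, s)%:R * (s%:R / p%:R * frob X) ^+ 2.
Proof.
move=> p0 X0; have p0R : 0 < p%:R :> R by rewrite ltr0n.
rewrite (eq_bigr (fun S : {set 'I_p} =>
    \sum_i \sum_j (i \in S)%:R * (j \in S)%:R * X i j ^+ 2)); last first.
  move=> S _; rewrite frob_sqrE; apply: eq_bigr => i _; apply: eq_bigr => j _.
  by rewrite maskmxE; case: (i \in S); case: (j \in S); rewrite ?mul1r ?mulr1 ?mul0r ?mulr0 ?expr0n ?mul0r.
rewrite exchange_big exprMn frob_sqrE mulrA mulr_sumr; apply: ler_sum => i _ /=.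
rewrite exchange_big mulr_sumr; apply: ler_sum => j _ /=.
rewrite -mulr_suml; have [<-|ij] := eqVneq i j; first by rewrite X0 expr0n !mulr0.
rewrite ler_wpM2r ?sqr_ge0 // -(ler_pM2l (exprn_gt0 2 p0R)).
apply: (le_trans (sum_subsets_mem2 R sp ij)).
by rewrite mulrCA -exprMn (mulrC p%:R) divfK ?lt0r_neq0 // mulrC.
Qed.

End MaskedAverages.

(** * Lower bound on the expected gap *)

Section Gap.
Variables (R : realType) (m p : nat).
Implicit Types (S : {set 'I_p}) (D : 'M[R]_(m, p)).

(** When the columns in [S] are independent, this is their pseudoinverse with zero rows outside
    [S]. *)
Definition pinvS S D : 'M[R]_(p, m) := invgram S D *m selmx R S *m D^T.

Definition projS S D : 'M[R]_m := D *m selmx R S *m pinvS S D.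

(* The conditional expectation of [lasso_phi] at [D] minus its value at [D0],
   given the support [S]. *)
Definition phi_gap (Ex2 Eax Eeps2 lambda : R) (D0 D : 'M[R]_(m, p)) S : R :=
  - 2^-1 * Ex2 * \tr (selmx R S *m (D0^T *m (projS S D - projS S D0) *m D0))
  - 2^-1 * Eeps2 * \tr (projS S D - projS S D0)
  + lambda * Eax * \tr (selmx R S *m ((pinvS S D - pinvS S D0) *m D0))
  - 2^-1 * lambda ^+ 2 * \tr (selmx R S *m (invgram S D - invgram S D0)).

(** Applied to D^T (D - D0), whose diagonal is nonzero but quadratically small: the diagonal is
    bounded directly, and the rest qualifies for the (s/p)^2 average. *)
Definition offdiag (B : 'M[R]_p) : 'M[R]_p := \matrix_(i, j) (B i j * (i != j)%:R).

Lemma offdiag_diag B i : offdiag B i i = 0.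
Proof. by rewrite mxE eqxx mulr0. Qed.

Lemma frob_offdiag_le B : frob (offdiag B) <= frob B.
Proof.
rewrite -ler_sqr ?nnegrE ?frob_ge0 // !frob_sqrE; apply: ler_sum => i _.
apply: ler_sum => j _; rewrite mxE exprMn ler_piMr ?sqr_ge0 //.
by case: (i != j); rewrite ?expr1n // expr0n.
Qed.

Lemma frob_maskmx_offdiag S B :
  frob (maskmx S B) ^+ 2 = frob (maskmx S (offdiag B)) ^+ 2 + \sum_(i in S) B i i ^+ 2.
Proof.
rewrite [X in _ + X]big_mkcond !frob_sqrE -big_split; apply: eq_bigr => i _ /=.
rewrite (bigD1 i) //= [X in _ = X + _](bigD1 i) //= !maskmxE offdiag_diag mulr0 mul0r expr0n add0r.
rewrite addrC; congr (_ + _); last by case: (i \in S); rewrite ?mul1r ?mulr1 // mulr0 expr0n.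
by apply: eq_bigr => j ji; rewrite !maskmxE mxE eq_sym ji mulr1.
Qed.

Lemma mxtrace_fdot n (A B : 'M[R]_n) : \tr (A *m B) = fdot A^T B.
Proof. by rewrite fdotE trmxK. Qed.

Section FixedSupport.
Variables (s : nat) (S : {set 'I_p}) (D D0 : 'M[R]_(m, p)).
Hypotheses (Ss : (#|S| <= s)%N) (oD : oblique D) (oD0 : oblique D0).
Hypotheses (mu : cum_coherence s D <= 2 / 5) (mu0 : cum_coherence s D0 <= 2 / 5).

Local Notation Q := (selmx R S).
Local Notation H := (invgram S D).
Local Notation H0 := (invgram S D0).
Local Notation E := (D - D0).
Local Notation B := (D^T *m E).
Local Notation A := (gramoff D).
Local Notation A0 := (gramoff D0).

Let mu1 : cum_coherence s D < 1. Proof. by have h := mu; lra. Qed.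
Let mu01 : cum_coherence s D0 < 1. Proof. by have h := mu0; lra. Qed.

(** The constant is 1 / (1 - 2/5). *)
Lemma frob_invgram_le53 c (M : 'M[R]_(p, c)) (D' : 'M[R]_(m, p)) : oblique D' ->
  cum_coherence s D' <= 2 / 5 -> frob (invgram S D' *m M) <= 5 / 3 * frob M.
Proof.
move=> oD' mu'; have mu'1 : cum_coherence s D' < 1 by lra.
have := frob_invgram_le Ss oD' mu'1 M; have := frob_ge0 (invgram S D' *m M); nra.
Qed.

Lemma invgram_selmx_gram (D' : 'M[R]_(m, p)) : oblique D' -> cum_coherence s D' < 1 ->
  pinvS S D' *m D' *m Q = Q.
Proof.
move=> oD' mu'; rewrite -[RHS](invgram_gram Ss oD' mu') /pinvS /maskmx.
by rewrite !mulmxA.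
Qed.

Lemma mxtrace_projS (D' : 'M[R]_(m, p)) : oblique D' -> cum_coherence s D' < 1 ->
  \tr (projS S D') = \tr Q.
Proof.
by move=> oD' mu'; rewrite /projS mxtrace_mulC mulmxA invgram_selmx_gram.
Qed.

Lemma pinvS_mul_selmx : pinvS S D *m D0 *m Q = Q - H *m maskmx S B.
Proof.
rewrite /maskmx (mulmxBr D^T) (mulmxBr Q) mulmxBl mulmxBr opprB addrCA !mulmxA.
have := invgram_selmx_gram oD mu1; rewrite /pinvS => ->.
by rewrite subrr addr0.
Qed.

(** The left side is |(1 - P_S) D0_S|^2. As 1 - P_S kills D_S, D0_S may be replaced by E_S, which
    leaves |E_S|^2 - |P_S E_S|^2. *)
Lemma signal_gap : 
  - \tr (Q *m (D0^T *m (projS S D - projS S D0) *m D0))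
   = frob (E *m Q) ^+ 2 - fdot (maskmx S B) (H *m maskmx S B).
Proof.
have tQ (M : 'M[R]_p) : \tr (Q *m M) = \tr (Q *m M *m Q).
  by rewrite [RHS]mxtrace_mulC mulmxA selmx_idem.
have e0 : \tr (Q *m (D0^T *m projS S D0 *m D0)) = frob (D0 *m Q) ^+ 2.
  rewrite tQ frob_sqr fdotE trmx_mul trmx_selmx /projS; congr (\tr _).
  have := invgram_selmx_gram oD0 mu01; move=> /(congr1 (mulmx (Q *m D0^T *m D0 *m Q))).
  by rewrite !mulmxA => ->; rewrite selmx_idemAr.
have e1 : \tr (Q *m (D0^T *m projS S D *m D0)) =
    fdot (maskmx S (D^T *m D0)) (Q - H *m maskmx S B).
  rewrite tQ fdotE trmx_maskmx trmx_mul trmxK -pinvS_mul_selmx /projS /maskmx.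
  by congr (\tr _); rewrite !mulmxA -(mulmxA _ Q) .
have -> : D0^T *m (projS S D - projS S D0) *m D0 =
    D0^T *m projS S D *m D0 - D0^T *m projS S D0 *m D0 by rewrite mulmxBr mulmxBl.
rewrite mulmxBr linearB /= e0 e1.
have -> : maskmx S (D^T *m D0) = maskmx S (D^T *m D) - maskmx S B.
  rewrite /maskmx -mulmxBl -mulmxBr; congr (_ *m _ *m _).
  by rewrite -mulmxBr opprB addrCA subrr addr0.
have -> : D0 *m Q = D *m Q - E *m Q by rewrite -mulmxBl opprB addrCA subrr addr0.
have GH M : fdot (maskmx S (D^T *m D)) (H *m M) = fdot Q M.
  by rewrite -{1}(trmx_invgram S D) -fdot_mulmxl (invgram_gram Ss oD mu1).
have GQ : fdot (maskmx S (D^T *m D)) Q = frob (D *m Q) ^+ 2.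
  rewrite frob_sqr fdot_mulmxl fdotC fdotE [RHS]fdotE trmx_selmx /maskmx.
  by rewrite !mulmxA selmx_idem.
have BQ : fdot Q (maskmx S B) = fdot (D *m Q) (E *m Q).
  by rewrite fdot_mulmxl !fdotE trmx_selmx /maskmx !mulmxA selmx_idem.
rewrite !fdotBl !fdotBr GH GQ frob_sqr.
rewrite (fdotC (maskmx S B) Q) BQ -fdotBr.
set X := D *m Q; set Y := (D - D0) *m Q.
rewrite (frob_sqr (X - Y)) (fdotBl X Y) !(fdotBr _ X Y) !frob_sqr (fdotC Y X); ring.
Qed.

Lemma pinv_gap :
  \tr (Q *m ((pinvS S D - pinvS S D0) *m D0)) = - fdot H (maskmx S B).
Proof.
have -> : Q *m ((pinvS S D - pinvS S D0) *m D0) =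
    Q *m (pinvS S D *m D0) - Q *m (pinvS S D0 *m D0) by rewrite mulmxBl mulmxBr.
rewrite linearB /= !(mxtrace_mulC Q) (invgram_selmx_gram oD0 mu01) pinvS_mul_selmx.
by rewrite linearB /= addrAC subrr add0r mxtrace_fdot trmx_invgram.
Qed.

Lemma invgram_sub1 (D' : 'M[R]_(m, p)) : oblique D' -> cum_coherence s D' < 1 ->
  invgram S D' = 1%:M - invgram S D' *m maskmx S (gramoff D').
Proof.
move=> oD' mu'; apply/eqP; rewrite eq_sym subr_eq eq_sym -{1}(mulmx1 (invgram S D')) -mulmxDr.
by rewrite mulVmx // (invgram_unit Ss).
Qed.

(** The resolvent identity gives H - H0 = - H0 (A - A0)_S H. In H H0 the identity pairs to 0 with
    the zero diagonal of A - A0; what remains has a factor A or A0, hence a second small factor. *)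
Lemma invgram_gap :
  - \tr (Q *m (H - H0)) =
  - fdot (H *m maskmx S A *m H0 + H0 *m maskmx S A0) (maskmx S (A - A0)).
Proof.
have mD : maskmx S (A - A0) = maskmx S A - maskmx S A0.
  by rewrite /maskmx mulmxBr mulmxBl.
have e : H - H0 = - (H0 *m maskmx S (A - A0) *m H).
  have := invgram_unit Ss oD mu1; have := invgram_unit Ss oD0 mu01 => u0 u.
  have -> : maskmx S (A - A0) = (1%:M + maskmx S A) - (1%:M + maskmx S A0).
    by rewrite mD opprD addrACA subrr add0r.
  by rewrite mulmxBr mulVmx // mulmxBl mul1mx -mulmxA mulmxV // mulmx1 opprB.
rewrite e mulmxN linearN opprK /=.
have -> : \tr (Q *m (H0 *m maskmx S (A - A0) *m H)) = fdot (H *m H0) (maskmx S (A - A0)).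
  rewrite !mulmxA mxtrace_mulC !mulmxA -(mulmxA H Q H0) -(invgramC Ss oD0 mu01).
  rewrite mulmxA selmx_idemAr.
  have -> : H *m H0 *m Q *m (A - A0) *m Q = H *m H0 *m maskmx S (A - A0).
    by rewrite /maskmx !mulmxA.
  rewrite mxtrace_fdot -fdotT trmxK trmx_maskmx.
  by congr fdot; rewrite /maskmx linearB /= !trmx_gramoff.
have X0 : fdot 1%:M (maskmx S (A - A0)) = 0.
  rewrite fdotE trmx1 mul1mx /mxtrace big1 // => i _.
  rewrite maskmxE (_ : (A - A0) i i = 0) ?mulr0 ?mul0r //.
  by rewrite mxE gramoff_diag // mxE gramoff_diag // subrr.
have -> : H *m H0 = 1%:M - (H *m maskmx S A *m H0 + H0 *m maskmx S A0).
  rewrite {1}(invgram_sub1 oD mu1) mulmxBl mul1mx {1}(invgram_sub1 oD0 mu01).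
  by rewrite opprD addrA addrAC.
by rewrite fdotBl X0 sub0r.
Qed.

(** Both d_j and d_j - e_j are unit vectors, so <d_j, e_j> = |e_j|^2 / 2. *)
Lemma diag_gram_sub j : B j j = 2^-1 * frob (col j E) ^+ 2.
Proof.
have -> : B j j = fdot (col j D) (col j E).
  by rewrite mxE fdot_col; apply: eq_bigr => k _; rewrite !mxE.
have e : col j D0 = col j D - col j E.
  by apply/matrixP => i k; rewrite !mxE opprB addrCA subrr addr0.
have : frob (col j D - col j E) ^+ 2 = 1 by rewrite -e oD0 expr1n.
rewrite {1}frob_sqr fdotBl !fdotBr -!frob_sqr oD (fdotC (col j E)); lra.
Qed.

Lemma invgram_diag_le i : H i i <= 5 / 3.
Proof.
have := frob_invgram_le53 (col i 1%:M) oD mu; rewrite colE mul1mx -colE => h.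
have -> : H i i = col i H i 0 by rewrite mxE.
apply: le_trans (ler_norm _) _; apply: le_trans (normr_entry_le _ _ _) _.
apply: le_trans h _; rewrite ler_piMr //.
have : frob (delta_mx i 0 : 'cV[R]_p) ^+ 2 = 1.
  rewrite frob_sqr fdot_col (bigD1 i) //= big1 => [|k /negPf ki].
    by rewrite mxE !eqxx addr0 mulr1.
  by rewrite mxE ki mul0r.
by move=> f1; rewrite -ler_sqr ?nnegrE ?frob_ge0 // f1 expr1n.
Qed.

Lemma fdot1_offdiag X : fdot 1%:M (maskmx S (offdiag X)) = 0.
Proof.
rewrite fdotE trmx1 mul1mx /mxtrace big1 // => i _.
by rewrite maskmxE offdiag_diag mulr0 mul0r.
Qed.

(** The diagonal contributes H_ii |e_i|^2 / 2 with H_ii <= 5/3. Against the off-diagonal part of B,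
    the identity in H = 1 - H A_S pairs to 0. *)
Lemma fdot_invgram_le : fdot H (maskmx S B) <=
  5 / 6 * frob (E *m Q) ^+ 2
  + 5 / 3 * (frob (maskmx S A) * frob (maskmx S (offdiag B))).
Proof.
have -> : fdot H (maskmx S B) =
    fdot H (maskmx S (offdiag B)) + \sum_(i in S) H i i * B i i.
  rewrite [\sum_(i in S) _]big_mkcond -big_split; apply: eq_bigr => i _ /=.
  rewrite (bigD1 i) //= [X in _ = X + _](bigD1 i) //= !maskmxE offdiag_diag mulr0 mul0r mulr0 add0r.
  rewrite addrC; congr (_ + _); last by case: (i \in S); rewrite ?mul1r ?mulr1 // !mul0r mulr0.
  by apply: eq_bigr => j ji; rewrite !maskmxE [offdiag _ _ _]mxE eq_sym ji mulr1.
rewrite addrC lerD //.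
  rewrite frob_mul_selmx mulr_sumr; apply: ler_sum => i _; rewrite diag_gram_sub.
  have := invgram_diag_le i; have := sqr_ge0 (frob (col i E)); nra.
rewrite {1}(invgram_sub1 oD mu1) fdotBl fdot1_offdiag sub0r mulrA.
apply: le_trans (ler_norm _) _; rewrite normrN (le_trans (normr_fdot_le _ _)) //.
by rewrite ler_wpM2r ?frob_ge0 // frob_invgram_le53.
Qed.

Lemma phi_gap_ge (Ex2 Eax Eeps2 lambda rho : R) :
  0 <= Ex2 -> 0 <= Eax -> 0 <= lambda -> frob E <= rho ->
  2^-1 * Ex2 * ((1 - 5 / 12 * rho ^+ 2) * frob (E *m Q) ^+ 2
                - 5 / 3 * frob (maskmx S (offdiag B)) ^+ 2)
  - lambda * Eax * (5 / 6 * frob (E *m Q) ^+ 2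
                    + 5 / 3 * (frob (maskmx S A) * frob (maskmx S (offdiag B))))
  - 2^-1 * lambda ^+ 2 * ((25 / 9 * frob (maskmx S A) + 5 / 3 * frob (maskmx S A0))
                          * frob (maskmx S (A - A0)))
  <= phi_gap Ex2 Eax Eeps2 lambda D0 D S.
Proof.
move=> X0 a0 l0 Erho; rewrite /phi_gap pinv_gap.
(* Both projections have the trace of [Q], so the noise variance drops out. *)
rewrite [\tr (projS S D - _)]linearB /= !mxtrace_projS // subrr mulr0 subr0.
(* The loss 5/12 is the bound 5/3 on H times 1/4, from B_ii^2 = |e_i|^4 / 4 <= rho^2 |e_i|^2 / 4. *)
have h1 : (1 - 5 / 12 * rho ^+ 2) * frob (E *m Q) ^+ 2
    - 5 / 3 * frob (maskmx S (offdiag B)) ^+ 2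
    <= - \tr (Q *m (D0^T *m (projS S D - projS S D0) *m D0)).
  rewrite signal_gap.
  have : fdot (maskmx S B) (H *m maskmx S B) <= 5 / 3 * frob (maskmx S B) ^+ 2.
    rewrite (le_trans (fdot_le _ _)) // expr2 mulrCA ler_wpM2l ?frob_ge0 //.
    exact: frob_invgram_le53.
  have : \sum_(i in S) B i i ^+ 2 <= 4^-1 * rho ^+ 2 * frob (E *m Q) ^+ 2.
    rewrite frob_mul_selmx mulr_sumr; apply: ler_sum => i _; rewrite diag_gram_sub.
    have : frob (col i E) ^+ 2 <= rho ^+ 2.
      rewrite ler_sqr ?nnegrE ?frob_ge0 ?(le_trans (frob_ge0 E)) //.
      exact: le_trans (frob_col_le _ _) Erho.
    by have := sqr_ge0 (frob (col i E)); nra.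
  rewrite frob_maskmx_offdiag; lra.
have h3 : - ((25 / 9 * frob (maskmx S A) + 5 / 3 * frob (maskmx S A0)) * frob (maskmx S (A - A0)))
    <= - \tr (Q *m (H - H0)).
  rewrite invgram_gap lerN2.
  apply: le_trans (fdot_le _ _) _; rewrite ler_wpM2r ?frob_ge0 //.
  apply: le_trans (frobD _ _) _; apply: lerD; last exact: frob_invgram_le53.
  rewrite -mulmxA; apply: le_trans (frob_invgram_le53 _ oD mu) _.
  have : frob (maskmx S A *m H0) <= 5 / 3 * frob (maskmx S A).
    rewrite -frobT trmx_mul trmx_invgram trmx_maskmx trmx_gramoff.
    exact: frob_invgram_le53.
  by lra.
have := ler_wpM2l (mulr_ge0 (ltW (_ : 0 < 2^-1 :> R)) X0) h1.
have := ler_wpM2l (mulr_ge0 l0 a0) fdot_invgram_le.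
have := ler_wpM2l (mulr_ge0 (ltW (_ : 0 < 2^-1 :> R)) (sqr_ge0 lambda)) h3.
rewrite invr_gt0 ltr0n => /(_ isT) + + /(_ isT).
move: (\tr _) (\tr _) (fdot _ _) => u v w; lra.
Qed.

End FixedSupport.
End Gap.

(** * Positivity of the gap summed over supports *)

Section AveragedGap.
Variable R : realType.

(* [pi] stands for s/p, [K] for |||D0||| + 1, and [A0], [A], [B], [C] for the Frobenius norms of
   D0^T D0 - 1, D^T D - 1, the off-diagonal part of D^T (D - D0), and D^T D - D0^T D0. *)
Lemma gap_budget (X a l pi K rho A0 A B C : R) :
  0 < a -> a ^+ 2 <= X -> 0 < l -> 4 * l <= a -> 0 < pi -> 1 <= K ->
  16 * (K ^+ 2 * pi) <= 1 -> 0 < rho -> 14 * rho <= 1 ->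
  0 <= A0 -> 24 * (l * a * (K ^+ 2 * pi * A0)) <= X * rho ->
  0 <= A -> A <= A0 + 2 * K * rho -> 0 <= B -> B <= K * rho -> 0 <= C -> C <= 2 * K * rho ->
  0 < 2^-1 * X * ((1 - 5 / 12 * rho ^+ 2) * (pi * rho ^+ 2) - 5 / 3 * (pi * B) ^+ 2)
    - l * a * (5 / 6 * (pi * rho ^+ 2) + 5 / 3 * (pi * A * (pi * B)))
    - 2^-1 * l ^+ 2 * (25 / 9 * (pi * A * (pi * C)) + 5 / 3 * (pi * A0 * (pi * C))).
Proof.
move=> a0 aX l0 la pi0 K1 Kpi rho0 rho14 A00 hA0 A_ge0 hA B0 hB C_ge0 hC.
have X0 : 0 < X by apply: lt_le_trans aX; rewrite exprn_gt0.
have laX : 4 * (l * a) <= X.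
  by apply: le_trans aX; rewrite mulrA expr2 ler_wpM2r // ltW.
have la0 : 0 < l * a by rewrite mulr_gt0.
have l2 : 4 * l ^+ 2 <= l * a by rewrite expr2 mulrCA ler_wpM2l // ltW.
(* Twice the leading gain; every loss is measured as a fraction of [T]. *)
pose T := X * (pi * rho ^+ 2).
have T0 : 0 < T by rewrite !mulr_gt0 // exprn_gt0.
have K0 : 0 < K by apply: lt_le_trans K1.
have prho2 : 0 <= pi * rho ^+ 2 by rewrite mulr_ge0 ?sqr_ge0 // ltW.
have b1 : 16 * (X * (pi * B) ^+ 2) <= T.
  have h : (pi * B) ^+ 2 <= pi * rho ^+ 2 * (K ^+ 2 * pi).
    have -> : pi * rho ^+ 2 * (K ^+ 2 * pi) = (pi * (K * rho)) ^+ 2 by ring.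
    by rewrite ler_sqr ?nnegrE ?mulr_ge0 // ?ler_wpM2l // ltW.
  have h' := ler_wpM2l prho2 Kpi.
  rewrite mulrCA /T ler_wpM2l ?(ltW X0) //; lra.
have r2 : X * (rho ^+ 2 * (pi * rho ^+ 2)) <= T / 196.
  rewrite /T -mulrA ler_wpM2l ?(ltW X0) // [leRHS]mulrC ler_wpM2r //.
  have := mulr_ge0 (ltW rho0) (_ : 0 <= 1 - 14 * rho); rewrite subr_ge0 => /(_ rho14).
  lra.
have m1 : l * a * (pi * rho ^+ 2) <= T / 4.
  by have := ler_wpM2r prho2 laX; rewrite /T; lra.
(* The lower bound on [rho] enters here: it turns a term linear in [rho] into a fraction of [T]. *)
have k1 : l * a * (pi * A0 * (pi * (K * rho))) <= T / 24.
  have -> : l * a * (pi * A0 * (pi * (K * rho))) = pi * rho * (l * a * (K * pi * A0)) by ring.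
  have h : l * a * (K * pi * A0) <= l * a * (K ^+ 2 * pi * A0).
    rewrite ler_wpM2l ?(ltW la0) // ler_wpM2r // ler_wpM2r ?(ltW pi0) //.
    by rewrite expr2 ler_peMl // ltW.
  have := ler_wpM2l (mulr_ge0 (ltW pi0) (ltW rho0)) (le_trans (ler_wpM2l (ler0n _ 24) h) hA0).
  by rewrite /T; lra.
have k2 : l * a * (pi * (2 * K * rho) * (pi * (K * rho))) <= T / 32.
  have -> : l * a * (pi * (2 * K * rho) * (pi * (K * rho))) =
    2 * (l * a * (pi * rho ^+ 2)) * (K ^+ 2 * pi) by ring.
  have h0 : 0 <= l * a * (pi * rho ^+ 2) by rewrite mulr_ge0 // ltW.
  have := ler_wpM2l h0 Kpi; lra.
have AKpi (Y : R) : 0 <= Y -> Y <= K * rho -> l * a * (pi * A * (pi * Y)) <= T * (7 / 96).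
  move=> Y0 hY; apply: le_trans (_ : _ <= l * a * (pi * (A0 + 2 * K * rho) * (pi * (K * rho)))) _.
    by rewrite ler_wpM2l ?(ltW la0) // ler_pM ?mulr_ge0 ?ler_wpM2l ?(ltW pi0).
  lra.
have t2 := AKpi _ B0 hB.
have t3 : l ^+ 2 * (pi * A * (pi * C)) <= T * (7 / 192).
  have C0 : 0 <= C / 2 by lra.
  have hC2 : C / 2 <= K * rho by lra.
  have := AKpi _ C0 hC2.
  have : 0 <= pi * A * (pi * C) by rewrite !mulr_ge0 // ltW.
  move=> h0; have := ler_wpM2r h0 l2; lra.
have t4 : l ^+ 2 * (pi * A0 * (pi * C)) <= T / 48.
  have : 0 <= pi * A0 * (pi * C) by rewrite !mulr_ge0 // ltW.
  move=> h0; have := ler_wpM2r h0 l2.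
  have : l * a * (pi * A0 * (pi * C)) <= l * a * (pi * A0 * (pi * (2 * K * rho))).
    by rewrite ler_wpM2l ?(ltW la0) // ler_wpM2l ?mulr_ge0 ?ler_wpM2l ?(ltW pi0).
  lra.
(* Against the gain T/2 stand the losses 5/24 * 1/196, 5/96, 5/24, 35/288, 175/3456 and 5/288 of
   [T], in total below 0.46 T. *)
rewrite /T in T0 b1 r2 m1 t2 t3 t4; lra.
Qed.

Variables (m p s : nat) (D D0 : 'M[R]_(m, p)).

Lemma sum_phi_gap_gt0 (Ex2 Eax Eeps2 lambda K : R) :
  (0 < s <= p)%N -> oblique D -> oblique D0 ->
  cum_coherence s D <= 2 / 5 -> cum_coherence s D0 <= 2 / 5 ->
  0 < Eax -> Eax ^+ 2 <= Ex2 -> 0 < lambda -> 4 * lambda <= Eax ->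
  opnorm D0 + 1 <= K -> 16 * (K ^+ 2 * (s%:R / p%:R)) <= 1 ->
  0 < frob (D - D0) -> 14 * frob (D - D0) <= 1 ->
  24 * (lambda * Eax * (K ^+ 2 * (s%:R / p%:R) * frob (gramoff D0))) <= Ex2 * frob (D - D0) ->
  0 < \sum_(S : {set 'I_p} | #|S| == s) phi_gap Ex2 Eax Eeps2 lambda D0 D S.
Proof.
move=> /andP[s0 sp] oD oD0 mu mu0 a0 aX l0 la hK Kpi rho0 rho14 hC.
have p0 : (0 < p)%N by apply: leq_trans sp.
set rho := frob (D - D0) in rho0 rho14 hC *; set pi := s%:R / p%:R in Kpi hC *.
have X0 : 0 < Ex2 by apply: lt_le_trans aX; rewrite exprn_gt0.
have pi0 : 0 < pi by rewrite divr_gt0 // ltr0n.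
have K1 : 1 <= K by have := opnorm_ge0 D0; lra.
have hD0 c (M : 'M[R]_(p, c)) : frob (D0 *m M) <= K * frob M.
  rewrite (le_trans (frob_mulmx_le_opnorm _ _)) // ler_wpM2r ?frob_ge0 //; lra.
(* The operator norm of [D] exceeds that of [D0] by at most rho <= 1, which the + 1 in [K]
   absorbs. *)
have hD c (M : 'M[R]_(p, c)) : frob (D *m M) <= K * frob M.
  rewrite -(subrK D0 D) mulmxDl (le_trans (frobD _ _)) //.
  have h1 := frob_mulmx (D - D0) M; have h2 := frob_mulmx_le_opnorm D0 M.
  have := frob_ge0 M; rewrite -/rho in h1 *; nra.
pose B := offdiag (D^T *m (D - D0)).
have K0 : 0 <= K by apply: le_trans K1.
have hB : frob B <= K * rho.
  apply: le_trans (frob_offdiag_le _) _; exact: frob_mulmx_trmx_le K0 (hD _) _.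
have hG : frob (gramoff D - gramoff D0) <= 2 * K * rho.
  have -> : gramoff D - gramoff D0 = D^T *m (D - D0) + (D0^T *m (D - D0))^T.
    have -> : (D0^T *m (D - D0))^T = D^T *m D0 - D0^T *m D0.
      by rewrite mulmxBr linearB /= !trmx_mul !trmxK.
    rewrite /gramoff mulmxBr; move: (D^T *m D) (D^T *m D0) (D0^T *m D0) => M M' M''.
    by apply/matrixP => i k; rewrite !mxE; ring.
  apply: le_trans (frobD _ _) _; rewrite frobT.
  have := @frob_mulmx_trmx_le _ _ _ _ D K K0 (hD _) (D - D0).
  have := @frob_mulmx_trmx_le _ _ _ _ D0 K K0 (hD0 _) (D - D0); rewrite -/rho; lra.
have hA : frob (gramoff D) <= frob (gramoff D0) + 2 * K * rho.
  rewrite -[gramoff D in X in X <= _](subrK (gramoff D0)) (le_trans (frobD _ _)) //; lra.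
have c0 : 0 < 'C(p, s)%:R :> R by rewrite ltr0n bin_gt0.
have := gap_budget a0 aX l0 la pi0 K1 Kpi rho0 rho14 (frob_ge0 _) hC (frob_ge0 _) hA
  (frob_ge0 _) hB (frob_ge0 _) hG.
rewrite -(pmulr_rgt0 _ c0); move=> /lt_le_trans; apply.
have dA i : gramoff D i i = 0 by exact: gramoff_diag.
have dA0 i : gramoff D0 i i = 0 by exact: gramoff_diag.
have dG i : (gramoff D - gramoff D0) i i = 0 by rewrite mxE dA mxE dA0 subrr.
(* The bound is written as a square so that [sum_mul_le] can pair two of these averages. *)
have avg (M : 'M[R]_p) : (forall i, M i i = 0) ->
    \sum_(S : {set 'I_p} | #|S| == s) frob (maskmx S M) ^+ 2
      <= (Num.sqrt 'C(p, s)%:R * (pi * frob M)) ^+ 2.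
  by move=> M0; rewrite [leRHS]exprMn [X in _ <= X * _]sqr_sqrtr ?(ltW c0) //; exact: sum_frob_maskmx_le.
have avg2 (M M' : 'M[R]_p) : (forall i, M i i = 0) -> (forall i, M' i i = 0) ->
    \sum_(S : {set 'I_p} | #|S| == s) frob (maskmx S M) * frob (maskmx S M')
      <= 'C(p, s)%:R * (pi * frob M * (pi * frob M')).
  move=> M0 M'0; have sq0 (N : 'M[R]_p) : 0 <= Num.sqrt 'C(p, s)%:R * (pi * frob N).
    by rewrite mulr_ge0 ?sqrtr_ge0 // mulr_ge0 ?frob_ge0 // ltW.
  apply: le_trans (sum_mul_le (sq0 M) (sq0 M') (avg _ M0) (avg _ M'0)) _.
  by rewrite mulrACA -expr2 sqr_sqrtr ?(ltW c0).
apply: le_trans (_ : _ <= \sum_(S : {set 'I_p} | #|S| == s)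
   (2^-1 * Ex2 * ((1 - 5 / 12 * rho ^+ 2) * frob ((D - D0) *m selmx R S) ^+ 2
                - 5 / 3 * frob (maskmx S B) ^+ 2)
  - lambda * Eax * (5 / 6 * frob ((D - D0) *m selmx R S) ^+ 2
                    + 5 / 3 * (frob (maskmx S (gramoff D)) * frob (maskmx S B)))
  - 2^-1 * lambda ^+ 2 * ((25 / 9 * frob (maskmx S (gramoff D)) + 5 / 3 * frob (maskmx S (gramoff D0)))
                          * frob (maskmx S (gramoff D - gramoff D0))))) _; last first.
  apply: ler_sum => S /eqP Ss; apply: (@phi_gap_ge _ _ _ s) => //; first by rewrite Ss.
  - exact: (ltW X0).
  - exact: (ltW a0).
  - exact: (ltW l0).
have h1 := @sum_frob_selmx R p s sp m (D - D0) p0.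
have h2 := @sum_frob_maskmx_le R p s sp B p0 (@offdiag_diag _ _ _).
have h3 := avg2 _ _ dA (@offdiag_diag _ _ (D^T *m (D - D0))).
have h4 := avg2 _ _ dA dG.
have h5 := avg2 _ _ dA0 dG.
rewrite -/rho -/pi -/B in h1 h2 h3.
have splitS (x1 x2 x3 x4 x5 : {set 'I_p} -> R) (a1 a2 a3 a4 a5 : R) :
    \sum_(S : {set 'I_p} | #|S| == s)
      (a1 * x1 S - a2 * x2 S - a3 * x3 S - a4 * x4 S - a5 * x5 S) =
    a1 * (\sum_(S : {set 'I_p} | #|S| == s) x1 S)
    - a2 * (\sum_(S : {set 'I_p} | #|S| == s) x2 S)
    - a3 * (\sum_(S : {set 'I_p} | #|S| == s) x3 S)
    - a4 * (\sum_(S : {set 'I_p} | #|S| == s) x4 S)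
    - a5 * (\sum_(S : {set 'I_p} | #|S| == s) x5 S) by rewrite !sumrB -!mulr_sumr.
rewrite [leRHS](eq_bigr (fun S : {set 'I_p} =>
  (2^-1 * Ex2 * (1 - 5 / 12 * rho ^+ 2) - lambda * Eax * (5 / 6))
     * frob ((D - D0) *m selmx R S) ^+ 2
  - 2^-1 * Ex2 * (5 / 3) * frob (maskmx S B) ^+ 2
  - lambda * Eax * (5 / 3) * (frob (maskmx S (gramoff D)) * frob (maskmx S B))
  - 2^-1 * lambda ^+ 2 * (25 / 9) *
      (frob (maskmx S (gramoff D)) * frob (maskmx S (gramoff D - gramoff D0)))
  - 2^-1 * lambda ^+ 2 * (5 / 3) *
      (frob (maskmx S (gramoff D0)) * frob (maskmx S (gramoff D - gramoff D0)))));
  last by move=> S _; ring.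
rewrite splitS h1.
have la0 : 0 <= lambda * Eax * (5 / 3) by rewrite !mulr_ge0 // ltW.
have l20 : 0 <= 2^-1 * lambda ^+ 2 by rewrite mulr_ge0 ?sqr_ge0.
have X20 : 0 <= 2^-1 * Ex2 * (5 / 3) by rewrite !mulr_ge0 // ltW.
have := ler_wpM2l X20 h2; have := ler_wpM2l la0 h3.
have := ler_wpM2l l20 h4; have := ler_wpM2l l20 h5; lra.
Qed.

End AveragedGap.

(** * Integrals of bilinear forms *)

Section BoundedFunctions.
Context (R : realType) (d : measure_display) (T : measurableType d).
Variable P : probability T R.

Lemma ae_le_Rintegral (A : set T) (f g : T -> R) : measurable A ->
  P.-integrable A (EFin \o f) -> P.-integrable A (EFin \o g) ->
  {ae P, forall t, A t -> f t <= g t} ->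
  \int[P]_(t in A) f t <= \int[P]_(t in A) g t.
Proof.
move=> mA fi gi [N [mN PN fgN]].
rewrite /Rintegral (negligible_integral mN) // [leRHS](congr1 fine (negligible_integral mN mA gi PN)).
have mAN : measurable (A `\` N) by exact: measurableD.
apply: le_Rintegral => //.
- by apply: integrableS fi => //; exact: subDsetl.
- by apply: integrableS gi => //; exact: subDsetl.
- move=> t [At Nt]; apply: contrapT => h; apply: Nt; apply: fgN => /= /(_ At).
  by move/(_ : ~ _); apply.
Qed.

Lemma ae_eq_Rintegral (A : set T) (f g : T -> R) : measurable A ->
  P.-integrable A (EFin \o f) -> P.-integrable A (EFin \o g) ->
  {ae P, forall t, A t -> f t = g t} ->
  \int[P]_(t in A) f t = \int[P]_(t in A) g t.
Proof.
move=> mA fi gi fg; apply/eqP; rewrite eq_le !ae_le_Rintegral //.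
  by apply: filterS fg => t h At; rewrite h.
by apply: filterS fg => t h At; rewrite h.
Qed.

Lemma ae_bounded_integrable (A : set T) (f : T -> R) (k : R) : measurable A ->
  measurable_fun A f -> {ae P, forall t, A t -> `|f t| <= k} ->
  P.-integrable A (EFin \o f).
Proof.
move=> mA mf fk; apply/integrableP; split; first exact/measurable_EFinP.
apply: (@le_lt_trans _ _ (\int[P]_(t in A) `|k|%:E)%E).
  apply: ae_ge0_le_integral => //.
  - by do 2 apply: measurableT_comp => //.
  - apply: filterS fk => t h At /=; rewrite lee_fin (le_trans (h At)) //.
    exact: ler_norm.
rewrite integral_cst //= lte_mul_pinfty // ?lee_fin //.
by rewrite (le_lt_trans (probability_le1 P mA)) // ltry.
Qed.

Lemma integrable_sumr (I : finType) (A : set T) (f : I -> T -> R) : measurable A ->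
  (forall i, P.-integrable A (EFin \o f i)) ->
  P.-integrable A (EFin \o (fun t => \sum_i f i t)).
Proof.
move=> mA fi; have -> : EFin \o (fun t => \sum_i f i t) = (fun t => \sum_i (f i t)%:E)%E.
  by apply/funext => t /=; rewrite sumEFin.
by apply: integrable_sum => // i _; exact: fi.
Qed.

Lemma Rintegral_sum (I : finType) (A : set T) (f : I -> T -> R) : measurable A ->
  (forall i, P.-integrable A (EFin \o f i)) ->
  \int[P]_(t in A) (\sum_i f i t) = \sum_i \int[P]_(t in A) f i t.
Proof.
move=> mA fi; rewrite /Rintegral; under eq_integral do rewrite -sumEFin.
rewrite integral_sum // -sum_fine // => i _.
by apply: integrable_fin_num => //; exact: fi.
Qed.

Section BilinearForms.
Variables (m n : nat) (A : set T) (u : T -> 'cV[R]_m) (v : T -> 'cV[R]_n).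
Hypothesis mA : measurable A.
Hypothesis uv : forall i j, P.-integrable A (EFin \o (fun t => u t i 0 * v t j 0)).

Let fdot_sum (M : 'M[R]_(m, n)) :
  (fun t => fdot (u t) (M *m v t)) = (fun t => \sum_i \sum_j M i j * (u t i 0 * v t j 0)).
Proof.
apply/funext => t; rewrite fdot_col; apply: eq_bigr => i _.
by rewrite mxE mulr_sumr; apply: eq_bigr => j _; rewrite mulrCA.
Qed.

Let integrableM (M : 'M[R]_(m, n)) i j :
  P.-integrable A (EFin \o (fun t => M i j * (u t i 0 * v t j 0))).
Proof. by apply: (integrableZl mA (M i j) (uv i j)). Qed.

Lemma integrable_fdot (M : 'M[R]_(m, n)) :
  P.-integrable A (EFin \o (fun t => fdot (u t) (M *m v t))).
Proof. by rewrite fdot_sum; do 2 apply: integrable_sumr => // ?. Qed.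

Lemma Rintegral_fdot (M W : 'M[R]_(m, n)) :
  (forall i j, \int[P]_(t in A) (u t i 0 * v t j 0) = W i j) ->
  \int[P]_(t in A) fdot (u t) (M *m v t) = fdot W M.
Proof.
move=> uvW; rewrite fdot_sum Rintegral_sum //; last by move=> i; exact: integrable_sumr.
apply: eq_bigr => i _; rewrite Rintegral_sum //; apply: eq_bigr => j _.
by rewrite RintegralZl // uvW mulrC.
Qed.

End BilinearForms.
End BoundedFunctions.

(** * Regularity of the LASSO value *)

Section LassoRegularity.
Variables (R : realType) (m p : nat) (lambda : R).
Hypothesis lambda0 : 0 < lambda.
Implicit Types (D : 'M[R]_(m, p)) (y : 'cV[R]_m) (x : 'cV[R]_p).

Lemma l1normD x x' : l1norm (x + x') <= l1norm x + l1norm x'.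
Proof.
by rewrite /l1norm -big_split ler_sum // => i _; rewrite mxE ler_normD.
Qed.

Lemma frob_le_l1norm x : frob x <= l1norm x.
Proof.
rewrite -ler_sqr ?nnegrE ?frob_ge0 ?l1norm_ge0 // frob_sqr fdot_col.
rewrite [leRHS]expr2 mulr_suml; apply: ler_sum => i _.
rewrite -expr2 -real_normK ?num_real // expr2 ler_wpM2l //.
by rewrite /l1norm (bigD1 i) //= lerDl sumr_ge0.
Qed.

Lemma frob_oblique_mul_le D x : oblique D -> frob (D *m x) <= l1norm x.
Proof.
move=> oD.
have -> : D *m x = \sum_i x i 0 *: col i D.
  apply/matrixP => k j; rewrite (ord1 j) !mxE summxE; apply: eq_bigr => i _.
  by rewrite !mxE mulrC.
apply: (big_ind2 (fun (a : 'cV[R]_m) b => frob a <= b)) => [|a b c e h h'|i _].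
- by rewrite frob0.
- by rewrite (le_trans (frobD _ _)) // lerD.
- by rewrite frobZ oD mulr1.
Qed.

(** Continuity in [x] with an explicit constant, for the passage to rational vectors. *)
Lemma lasso_cost_perturb y D x h (e : R) : 0 <= e <= 1 -> l1norm h <= e ->
  lasso_cost lambda y D (x + h) <= lasso_cost lambda y D x
    + e * (frob (y - D *m x) * frob D + frob D ^+ 2 + lambda).
Proof.
move=> /andP[e0 e1] he; rewrite /lasso_cost.
have l1 := l1normD x h.
have f1 : frob (y - D *m (x + h)) <= frob (y - D *m x) + frob D * e.
  rewrite mulmxDr opprD addrA (le_trans (frobB _ _)) // lerD2l.
  rewrite (le_trans (frob_mulmx _ _)) // ler_wpM2l ?frob_ge0 //.
  exact: le_trans (frob_le_l1norm h) he.
have f0 := frob_ge0 (y - D *m (x + h)).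
have f2 : frob (y - D *m (x + h)) ^+ 2 <= (frob (y - D *m x) + frob D * e) ^+ 2.
  by rewrite ler_sqr ?nnegrE ?addr_ge0 ?mulr_ge0 ?frob_ge0.
have h1 : lambda * l1norm (x + h) <= lambda * (l1norm x + e).
  by rewrite ler_wpM2l ?(ltW lambda0) // (le_trans l1) // lerD2l.
have h2 : (frob D * e) ^+ 2 <= frob D ^+ 2 * e.
  by rewrite exprMn ler_wpM2l ?sqr_ge0 // expr2 ler_piMl.
have h3 : 0 <= frob D ^+ 2 * e by rewrite mulr_ge0 ?sqr_ge0.
lra.
Qed.

Definition rat_vec (q : 'cV[rat]_p) : 'cV[R]_p := map_mx (@ratr R) q.

Lemma rat_vec_dense x (e : R) : 0 < e -> exists q, l1norm (rat_vec q - x) <= e.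
Proof.
move=> e0; pose k := e / p.+1%:R.
have k0 : 0 < k by rewrite divr_gt0.
have qi i : exists q : rat, `|ratr q - x i 0| <= k.
  have [|q] := @rat_in_itvoo _ (x i 0 - k) (x i 0 + k); first by lra.
  by rewrite in_itv /= => /andP[h1 h2]; exists q; rewrite ler_norml; apply/andP; split; lra.
have [q qE] := boolp.choice qi; exists (\col_i q i).
rewrite /l1norm (le_trans (_ : _ <= \sum_(i < p) k)) //.
  by apply: ler_sum => i _; rewrite !mxE.
rewrite sumr_const card_ord -mulr_natr mulrAC ler_pdivrMr ?ltr0n // ler_wpM2l ?(ltW e0) //.
by rewrite ler_nat.
Qed.

(** An enumeration of all rational vectors; codes of no vector are sent to 0. *)
Definition rat_vec_seq (n : nat) : 'cV[R]_p := rat_vec (odflt 0 (unpickle n)).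

(** A countable infimum, by density of the rational vectors; this is what makes the LASSO value
    measurable in [y]. *)
Lemma lasso_obj_infs y D :
  lasso_obj lambda y D = infs (fun n => lasso_cost lambda y D (rat_vec_seq n)) 0%N.
Proof.
have lb : has_lbound (sdrop (fun n => lasso_cost lambda y D (rat_vec_seq n)) 0).
  by exists 0 => _ [n _ <-]; exact: lasso_cost_ge0.
apply/eqP; rewrite eq_le; apply/andP; split.
  apply: lb_le_inf; first by exists (lasso_cost lambda y D (rat_vec_seq 0)), 0%N.
  by move=> _ [n _ <-]; exact: lasso_obj_le.
apply: lasso_obj_ge => x; apply/ler_addgt0Pr => e e0.
pose k := frob (y - D *m x) * frob D + frob D ^+ 2 + lambda.
have k0 : 0 < k by rewrite ltr_wpDl // addr_ge0 ?sqr_ge0 ?mulr_ge0 ?frob_ge0.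
pose eta := Num.min 1 (e / k).
have eta0 : 0 < eta by rewrite lt_min ltr01 divr_gt0.
have [q qx] := rat_vec_dense x eta0.
apply: le_trans (_ : _ <= lasso_cost lambda y D (rat_vec q)) _.
  apply: ge_inf => //; exists (pickle q) => //.
  by rewrite /rat_vec_seq pickleK.
rewrite -[rat_vec q](subrK x) addrC.
apply: le_trans (lasso_cost_perturb _ _ _ _ qx) _.
  by rewrite (ltW eta0) ge_min lexx.
rewrite lerD2l -/k -ler_pdivlMr //.
by rewrite ge_min lexx orbT.
Qed.

Lemma measurable_lasso_obj (d : measure_display) (T : measurableType d)
    (y : T -> 'cV[R]_m) D : (forall i, measurable_fun setT (fun t => y t i 0)) ->
  measurable_fun setT (fun t => lasso_obj lambda (y t) D).
Proof.
move=> my; under eq_fun do rewrite lasso_obj_infs.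
apply: measurable_fun_infs => [t _|n].
  by exists 0 => _ [n _ <-]; exact: lasso_cost_ge0.
apply: measurable_funD => //; apply: measurable_funM => //.
under eq_fun do rewrite frob_sqrE; apply: measurable_sum => i.
apply: measurable_sum => j; apply: measurable_funX.
rewrite (ord1 j).
have -> : (fun t => (y t - D *m rat_vec_seq n) i 0) = (fun t => y t i 0 - (D *m rat_vec_seq n) i 0).
  by apply/funext => t; rewrite mxE; congr (_ + _); rewrite mxE.
exact: measurable_funB.
Qed.

(** A near minimizer [x] for [D'] has l1 norm at most [L], since its penalty is at most |y|^2 / 2 +
    1; the costs of this same [x] at [D] and [D'] are compared. *)
Lemma lasso_obj_lipschitz y D D' (Y : R) : oblique D -> oblique D' -> frob y <= Y ->
  let L := (2^-1 * Y ^+ 2 + 1) / lambda in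
  lasso_obj lambda y D <= lasso_obj lambda y D' + frob (D - D') * (L * (Y + L)).
Proof.
move=> oD oD' yY /=; set L := _ / lambda; apply/ler_addgt0Pr => e e0.
have Y0 : 0 <= Y by apply: le_trans (frob_ge0 y) yY.
(* Capping the error at 1 keeps [L] independent of [e]. *)
pose e' := Num.min e 1; have e'0 : 0 < e' by rewrite lt_min e0 ltr01.
have [x xe] := lasso_obj_lt lambda0 y D' e'0.
have e'1 : e' <= 1 by rewrite ge_min lexx orbT.
have e'e : e' <= e by rewrite ge_min lexx.
have yY2 : frob y ^+ 2 <= Y ^+ 2 by rewrite ler_sqr ?nnegrE ?frob_ge0.
have L0 : 0 <= L by rewrite divr_ge0 ?(ltW lambda0) // addr_ge0 // mulr_ge0 ?sqr_ge0.
have xL : l1norm x <= L.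
  rewrite ler_pdivlMr // mulrC.
  have := lasso_obj_le_sqr lambda0 y D'; move: xe; rewrite /lasso_cost.
  have := sqr_ge0 (frob (y - D' *m x)); lra.
have xL2 := le_trans (frob_le_l1norm x) xL.
apply: le_trans (lasso_obj_le lambda0 y D x) _.
apply: le_trans (_ : _ <= lasso_cost lambda y D' x + frob (D - D') * (L * (Y + L))) _; last first.
  by move: (frob _ * _) => c; lra.
rewrite /lasso_cost [leRHS]addrAC lerD2r.
have b (D1 : 'M[R]_(m, p)) : oblique D1 -> frob (y - D1 *m x) <= Y + L.
  move=> oD1; rewrite (le_trans (frobB _ _)) // lerD //.
  by rewrite (le_trans (frob_oblique_mul_le _ oD1)).
have ab : frob (y - D *m x) <= frob (y - D' *m x) + frob (D - D') * L.
  have -> : y - D *m x = (y - D' *m x) - (D - D') *m x.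
    rewrite mulmxBl; move: (D *m x) (D' *m x) => a c.
    by apply/matrixP => i k; rewrite !mxE; ring.
  rewrite (le_trans (frobB _ _)) // lerD2l (le_trans (frob_mulmx _ _)) //.
  by rewrite ler_wpM2l ?frob_ge0.
have := b _ oD; have := b _ oD'; move: ab.
have := frob_ge0 (y - D *m x); have := frob_ge0 (y - D' *m x); have := frob_ge0 (D - D').
move: (frob (y - D *m x)) (frob (y - D' *m x)) (frob (D - D')) => a b' c c0 b0 a0 ab b1 a1.
have [h|h] := leP a b'.
  have : a ^+ 2 <= b' ^+ 2 by rewrite ler_sqr ?nnegrE.
  have : 0 <= c * (L * (Y + L)) by rewrite mulr_ge0 // mulr_ge0 // addr_ge0.
  lra.
have : (a - b') * (a + b') <= c * L * (2 * (Y + L)).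
  by apply: ler_pM; [lra|lra|lra|lra].
lra.
Qed.

End LassoRegularity.

(** * Expectation of the closed form *)

Section PhiIntegral.
Variables (R : realType) (m p : nat) (lambda : R) (S : {set 'I_p}).
Implicit Types (D : 'M[R]_(m, p)).

Lemma lasso_phiE D (y : 'cV[R]_m) (sg : 'cV[R]_p) :
  lasso_phi lambda S D y sg = 2^-1 * frob y ^+ 2 - 2^-1 * fdot y (projS S D *m y)
    + lambda * fdot sg (pinvS S D *m y) - 2^-1 * lambda ^+ 2 * fdot sg (invgram S D *m sg).
Proof.
rewrite /lasso_phi /lasso_sol /lasso_rhs.
have e1 : fdot (selmx R S *m (D^T *m y)) (invgram S D *m (selmx R S *m (D^T *m y)))
    = fdot y (projS S D *m y).
  by rewrite fdot_mulmxl fdot_mulmxl trmxK trmx_selmx /projS /pinvS !mulmxA.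
have e2 : invgram S D *m (selmx R S *m (D^T *m y)) = pinvS S D *m y.
  by rewrite /pinvS !mulmxA.
have e3 : fdot (selmx R S *m (D^T *m y)) (invgram S D *m sg) = fdot sg (pinvS S D *m y).
  by rewrite fdotC fdot_mulmxl trmx_invgram e2.
rewrite mulmxBr -scalemxAr fdotBl !fdotBr e1 !fdotZl !fdotZr e2 e3; lra.
Qed.

Lemma trmx_projS D : (projS S D)^T = projS S D.
Proof.
by rewrite /projS /pinvS !trmx_mul trmxK trmx_selmx trmx_invgram !mulmxA.
Qed.

(** The terms in [y] alone cancel, and the rest is a sum of bilinear forms in [x], [sg] and [e],
    whose integrals depend on second moments only. *)
Lemma lasso_phi_sub D0 D (x sg : 'cV[R]_p) (e : 'cV[R]_m) :
  lasso_phi lambda S D (D0 *m x + e) sg - lasso_phi lambda S D0 (D0 *m x + e) sg =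
  - 2^-1 * fdot x ((D0^T *m (projS S D - projS S D0) *m D0) *m x)
  + (- fdot x ((D0^T *m (projS S D - projS S D0)) *m e))
  + (- 2^-1 * fdot e ((projS S D - projS S D0) *m e))
  + lambda * fdot sg (((pinvS S D - pinvS S D0) *m D0) *m x)
  + lambda * fdot sg ((pinvS S D - pinvS S D0) *m e)
  + (- 2^-1 * lambda ^+ 2 * fdot sg ((invgram S D - invgram S D0) *m sg)).
Proof.
rewrite !lasso_phiE; set y := D0 *m x + e.
set M := projS S D - projS S D0; set L := pinvS S D - pinvS S D0.
have -> : fdot sg ((invgram S D - invgram S D0) *m sg) =
  fdot sg (invgram S D *m sg) - fdot sg (invgram S D0 *m sg) by rewrite mulmxBl fdotBr.
have e1 : fdot y (projS S D *m y) - fdot y (projS S D0 *m y) = fdot y (M *m y).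
  by rewrite -fdotBr -mulmxBl.
have e2 : fdot sg (pinvS S D *m y) - fdot sg (pinvS S D0 *m y) = fdot sg (L *m y).
  by rewrite -fdotBr -mulmxBl.
have e3 : fdot y (M *m y) = fdot x ((D0^T *m M *m D0) *m x)
    + 2 * fdot x ((D0^T *m M) *m e) + fdot e (M *m e).
  rewrite /y mulmxDr fdotDl !fdotDr !fdot_mulmxl !mulmxA.
  have -> : fdot e (M *m D0 *m x) = fdot x (D0^T *m M *m e).
    have MT : M^T = M by rewrite /M linearB /= !trmx_projS.
    by rewrite -mulmxA fdotC fdot_mulmxl MT fdot_mulmxl mulmxA.
  ring.
have e4 : fdot sg (L *m y) = fdot sg ((L *m D0) *m x) + fdot sg (L *m e).
  by rewrite /y mulmxDr fdotDr mulmxA.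
move: e1 e2; rewrite e3 e4 => + /(congr1 ( *%R lambda)); lra.
Qed.

Context (d : measure_display) (T : measurableType d) (P : probability T R).
Variables (A : set T) (x sg : T -> 'cV[R]_p) (e : T -> 'cV[R]_m).
Hypothesis mA : measurable A.

Definition products_integrable k l (u : T -> 'cV[R]_k) (v : T -> 'cV[R]_l) :=
  forall i j, P.-integrable A (EFin \o (fun t => u t i 0 * v t j 0)).

Definition second_moment k l (u : T -> 'cV[R]_k) (v : T -> 'cV[R]_l) (W : 'M[R]_(k, l)) :=
  forall i j, \int[P]_(t in A) (u t i 0 * v t j 0) = W i j.

(** Moments are integrals over the event [A], not conditional expectations; [c] will be the
    probability of the support. *)
Lemma Rintegral_phi_sub D0 D (Ex2 Eax Eeps2 c : R) :
  products_integrable x x -> products_integrable x e -> products_integrable e e ->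
  products_integrable sg x -> products_integrable sg e -> products_integrable sg sg ->
  second_moment x x ((c * Ex2) *: selmx R S) -> second_moment x e 0 ->
  second_moment e e (c * Eeps2)%:M -> second_moment sg x ((c * Eax) *: selmx R S) ->
  second_moment sg e 0 -> second_moment sg sg (c *: selmx R S) ->
  P.-integrable A (EFin \o (fun t => lasso_phi lambda S D (D0 *m x t + e t) (sg t)
      - lasso_phi lambda S D0 (D0 *m x t + e t) (sg t))) /\
  \int[P]_(t in A) (lasso_phi lambda S D (D0 *m x t + e t) (sg t)
      - lasso_phi lambda S D0 (D0 *m x t + e t) (sg t))
  = c * phi_gap Ex2 Eax Eeps2 lambda D0 D S.
Proof.
move=> ixx ixe iee isx ise iss mxx mxe mee msx mse mss.
have ZI f k : P.-integrable A (EFin \o f) -> P.-integrable A (EFin \o (fun t => k * f t)).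
  by move=> fi; exact: (integrableZl mA k fi).
have DI f g : P.-integrable A (EFin \o f) -> P.-integrable A (EFin \o g) ->
    P.-integrable A (EFin \o (fun t => f t + g t)).
  by move=> fi gi; exact: (integrableD mA fi gi).
pose M := projS S D - projS S D0; pose L := pinvS S D - pinvS S D0.
have i1 := ZI _ (- 2^-1) (integrable_fdot mA ixx (D0^T *m M *m D0)).
have i2 := ZI _ (-1) (integrable_fdot mA ixe (D0^T *m M)).
have i3 := ZI _ (- 2^-1) (integrable_fdot mA iee M).
have i4 := ZI _ lambda (integrable_fdot mA isx (L *m D0)).
have i5 := ZI _ lambda (integrable_fdot mA ise L).
have i6 := ZI _ (- 2^-1 * lambda ^+ 2) (integrable_fdot mA iss (invgram S D - invgram S D0)).
have -> : (fun t => lasso_phi lambda S D (D0 *m x t + e t) (sg t)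
      - lasso_phi lambda S D0 (D0 *m x t + e t) (sg t)) =
  (fun t => - 2^-1 * fdot (x t) ((D0^T *m M *m D0) *m x t)
  + -1 * fdot (x t) ((D0^T *m M) *m e t)
  + (- 2^-1 * fdot (e t) (M *m e t))
  + lambda * fdot (sg t) ((L *m D0) *m x t)
  + lambda * fdot (sg t) (L *m e t)
  + (- 2^-1 * lambda ^+ 2 * fdot (sg t) ((invgram S D - invgram S D0) *m sg t))).
  by apply/funext => t; rewrite lasso_phi_sub mulN1r.
have j2 := DI _ _ i1 i2; have j3 := DI _ _ j2 i3; have j4 := DI _ _ j3 i4.
have j5 := DI _ _ j4 i5.
split; first exact: DI.
rewrite !RintegralD // !RintegralZl; try exact: integrable_fdot; try exact: mA.
rewrite (Rintegral_fdot mA ixx _ mxx) (Rintegral_fdot mA ixe _ mxe) (Rintegral_fdot mA iee _ mee).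
rewrite (Rintegral_fdot mA isx _ msx) (Rintegral_fdot mA ise _ mse) (Rintegral_fdot mA iss _ mss).
rewrite !fdot0l -[in (_ * _)%:M]scalemx1 !fdotZl !(fdotE (selmx R S)) trmx_selmx fdotE trmx1 mul1mx.
rewrite /phi_gap -/M -/L; ring.
Qed.

End PhiIntegral.

(** * Closed and compact sets of matrices *)

Section FrobeniusTopology.
Variables (R : realType) (a b : nat).
Implicit Types (S : set 'M[R]_(a, b)) (D : 'M[R]_(a, b)).

(** Stated through [frob_closure], the form in which the constraint sets are given; it is linked
    below to the topology of the entrywise maximum norm. *)
Definition frob_closed S := forall D, frob_closure S D -> S D.

Lemma normr_le_frob D : `|D| <= frob D.
Proof.
rewrite [leLHS]/Num.Def.normr /= mx_normrE; apply: bigmax_le => [|i _].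
  exact: frob_ge0.
exact: normr_entry_le.
Qed.

Lemma entry_le_normr D i j : `|D i j| <= `|D|.
Proof.
rewrite [leRHS]/Num.Def.normr /= mx_normrE.
exact: (le_bigmax _ (fun ij => `|D ij.1 ij.2|) (i, j)).
Qed.

(** A crude constant suffices; the successor keeps it positive for empty matrices. *)
Lemma frob_le_normr D : frob D <= (a * b).+1%:R * `|D|.
Proof.
rewrite -ler_sqr ?nnegrE ?frob_ge0 ?mulr_ge0 // frob_sqrE.
apply: le_trans (_ : _ <= \sum_(i < a) \sum_(j < b) `|D| ^+ 2) _.
  apply: ler_sum => i _; apply: ler_sum => j _.
  by rewrite -real_normK ?num_real // ler_sqr ?nnegrE // entry_le_normr.
rewrite !sumr_const !card_ord -mulrnA -[leLHS]mulr_natl exprMn ler_wpM2r ?sqr_ge0 //.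
by rewrite -natrX ler_nat mulnC (leq_trans (leqnSn _)) // -mulnn leq_pmulr.
Qed.

Lemma frob_closed_closed S : frob_closed S -> closed S.
Proof.
move=> Sc D clD; apply: Sc => e e0.
have k0 : 0 < (a * b).+1%:R :> R by rewrite ltr0n.
have [|D' [SD' /= DD']] := clD (ball D (e / (a * b).+1%:R)).
  by apply: nbhsx_ballx; rewrite divr_gt0.
exists D' => //; apply: le_lt_trans (frob_le_normr _) _.
by move: DD'; rewrite -ball_normE /ball_ /= ltr_pdivlMr // mulrC.
Qed.

Lemma frob_closed_ball D0 (k : R) : frob_closed [set D | frob (D - D0) <= k].
Proof.
move=> D clD /=; apply/ler_addgt0Pr => e e0; have [D' /= h1 h2] := clD e e0.
have -> : D - D0 = (D - D') + (D' - D0) by rewrite addrA subrK.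
by rewrite (le_trans (frobD _ _)) // addrC lerD // ltW.
Qed.

(** The ball is a closed subset of the image under [vec_mx] of a bounded closed set of row
    vectors. *)
Lemma compact_frob_ball D0 (k : R) : compact [set D | frob (D - D0) <= k].
Proof.
pose B := [set v : 'rV[R]_(a * b) | `|v| <= k + frob D0].
have cB : compact B.
  apply: bounded_closed_compact.
    by exists (k + frob D0); split; rewrite ?num_real // => x xk v /= vB; rewrite (le_trans vB) // ltW.
  have -> : B = Num.norm @^-1` [set x | x <= k + frob D0] by [].
  apply: closed_comp; last exact: closed_le.
  by move=> v _; exact: norm_continuous.
have vc : continuous (@vec_mx R a b).
  move=> v U /= /nbhs_ballP[e /= e0 eU]; apply/nbhs_ballP; exists e => //= w vw.
  apply: eU; move: vw; rewrite -!ball_normE /ball_ /=; apply: le_lt_trans.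
  rewrite -linearB /= [leLHS]/Num.Def.normr /= mx_normrE.
  apply: bigmax_le => //= -[i j] _ /=; rewrite mxE.
  rewrite [leRHS]/Num.Def.normr /= mx_normrE.
  exact: (le_bigmax _ (fun ij => `|(v - w) ij.1 ij.2|) (0, mxvec_index i j)).
apply: (@subclosed_compact _ _ (@vec_mx R a b @` B)).
- by apply: frob_closed_closed; exact: frob_closed_ball.
- by apply: continuous_compact => //; exact: continuous_subspaceT.
move=> D /= Dk; exists (mxvec D); last exact: mxvecK.
rewrite /B /= [leLHS]/Num.Def.normr /= mx_normrE; apply: bigmax_le => [|[i l] _].
  by rewrite addr_ge0 ?frob_ge0 // (le_trans (frob_ge0 _) Dk).
case/mxvec_indexP: l => j l /=; rewrite (ord1 i) mxvecE.
rewrite (le_trans (normr_entry_le _ _ _)) // -[D](subrK D0) (le_trans (frobD _ _)) //.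
by rewrite lerD2r.
Qed.

Lemma oblique_frob_closed : frob_closed (@oblique R a b).
Proof.
move=> D clD j; apply/eqP; rewrite -subr_eq0 -normr_le0.
apply/ler_addgt0Pr => e e0; rewrite add0r; have [D' oD' DD'] := clD e e0.
rewrite -(oD' j) ler_norml; have h := frob_col_le (D - D') j.
have cB : col j (D - D') = col j D - col j D' by apply/matrixP => i k; rewrite !mxE.
have e1 : frob (col j D) <= frob (col j D') + frob (col j (D - D')).
  by rewrite -{1}(subrK (col j D') (col j D)) addrC cB frobD.
have e2 : frob (col j D') <= frob (col j D) + frob (col j (D - D')).
  by rewrite cB frobBC -{1}(subrK (col j D) (col j D')) addrC frobD.
apply/andP; split; lra.
Qed.

Lemma frob_closure_closed S : frob_closed (frob_closure S).
Proof.
move=> D clD e e0; have e20 : 0 < e / 2 by rewrite divr_gt0.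
have [D' clD' h1] := clD _ e20; have [D'' SD'' h2] := clD' _ e20.
exists D'' => //; have -> : D - D'' = (D - D') + (D' - D'') by rewrite addrA subrK.
by apply: le_lt_trans (frobD _ _) _; lra.
Qed.

Lemma frob_closedI S S' : frob_closed S -> frob_closed S' -> frob_closed (S `&` S').
Proof.
move=> Sc Sc' D clD; split; [apply: Sc|apply: Sc'] => e e0.
  by have [D' [h1 _] h2] := clD e e0; exists D'.
by have [D' [_ h1] h2] := clD e e0; exists D'.
Qed.

Lemma compact_frob_closed S : compact S -> frob_closed S.
Proof.
move=> /(compact_closed (@norm_hausdorff _ _)) Sc D clD; apply: Sc => U.
move=> /nbhs_ballP[e /= e0 eU]; have [D' SD' h] := clD e e0.
exists D'; split => //; apply: eU; rewrite -ball_normE /ball_ /=.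
exact: le_lt_trans (normr_le_frob _) h.
Qed.

End FrobeniusTopology.

(** * Mixed radix digits *)

Section MixedRadix.
Variables (N : nat) (f : 'I_N -> nat).
Hypothesis f0 : forall n, (0 < f n)%N.

(** [weight n.+1] is the place value of digit [n], and [weight 0] the number of indices. *)
Let weight (j : nat) : nat := (\prod_(k < N | j <= k) f k)%N.

Let weight_rec (n : 'I_N) : weight n = (f n * weight n.+1)%N.
Proof.
rewrite /weight (bigD1 n) //=; congr (_ * _)%N; apply: eq_bigl => k.
by rewrite ltn_neqAle andbC eq_sym.
Qed.

Lemma kdigit_lt (n : 'I_N) i : (kdigit f n i < f n)%N.
Proof. by rewrite ltn_mod. Qed.

Let modn_weight (n : 'I_N) i :
  (i %% weight n = kdigit f n i * weight n.+1 + i %% weight n.+1)%N.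
Proof.
have w0 : (0 < weight n.+1)%N by apply: prodn_gt0 => k.
rewrite weight_rec {1}(divn_eq i (weight n.+1)) {1}(divn_eq (i %/ weight n.+1) (f n)).
rewrite mulnDl -mulnA -addnA modnMDl modn_small //.
apply: leq_trans (_ : (kdigit f n i).+1 * weight n.+1 <= _)%N.
  by rewrite mulSn addnC ltn_add2r ltn_mod.
by rewrite leq_mul2r ltn_mod f0 orbT.
Qed.

Lemma kdigit_inj (i i' : 'I_(dimprod f)) :
  (forall n, kdigit f n i = kdigit f n i') -> i = i'.
Proof.
(* Induction on the number [k] of trailing digits: [weight (N - k)] is the range they span. *)
move=> h; suff e k : (i %% weight (N - k) = i' %% weight (N - k))%N.
  apply/val_inj; have := e N; rewrite subnn.
  have -> : weight 0 = dimprod f by apply: eq_bigl.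
  by rewrite !modn_small.
elim: k => [|k ih].
  by rewrite subn0 /weight big1 ?modn1 // => n; rewrite leqNgt ltn_ord.
have [kN|Nk] := ltnP k N; last first.
  have /eqP -> : (N - k.+1 == N - k)%N by rewrite (eqP (leqW Nk)) (eqP Nk).
  exact: ih.
have nN : (N - k.+1 < N)%N by rewrite ltn_subrL (leq_ltn_trans _ kN).
have := modn_weight (Ordinal nN) i; have := modn_weight (Ordinal nN) i'; rewrite /= h.
by rewrite subnSK // ih => -> ->.
Qed.

(** Indices and digit strings are equally many, so the injectivity of the digits gives
    surjectivity. *)
Lemma kdigit_surj (u : 'I_N -> nat) : (forall n, u n < f n)%N ->
  exists i : 'I_(dimprod f), forall n, kdigit f n i = u n.
Proof.
move=> uf; pose dig (i : 'I_(dimprod f)) : {dffun forall n : 'I_N, 'I_(f n)} :=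
  [ffun n => Ordinal (kdigit_lt n i)].
have dig_inj : injective dig.
  move=> i i' /ffunP e; apply: kdigit_inj => n.
  by have := e n; rewrite !ffunE => /(congr1 val).
have [|g _ gK] := inj_card_bij dig_inj.
  rewrite card_dep_ffun card_ord foldrE big_image /= leq_eqVlt.
  by apply/orP; left; apply/eqP/eq_bigr => n _; rewrite card_ord.
exists (g [ffun n => Ordinal (uf n)]) => n.
by have /ffunP/(_ n) := gK [ffun n => Ordinal (uf n)]; rewrite !ffunE => /(congr1 val).
Qed.

(** The fallback [i] is reached only if [x] is not a valid digit. *)
Definition setdigit (n : 'I_N) (i : 'I_(dimprod f)) (x : nat) : 'I_(dimprod f) :=
  odflt i [pick i' : 'I_(dimprod f) |
    [forall k, kdigit f k i' == (if k == n then x else kdigit f k i)]].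

Lemma kdigit_setdigit n i x k : (x < f n)%N ->
  kdigit f k (setdigit n i x) = if k == n then x else kdigit f k i.
Proof.
move=> xf; rewrite /setdigit; case: pickP => [i' /forallP/(_ k)/eqP //|h].
have [|i' e] := kdigit_surj (u := fun k => if k == n then x else kdigit f k i).
  by move=> l; case: eqP => [->|_] //; exact: kdigit_lt.
by have /forallP[] := h i'; move=> l; apply/eqP.
Qed.

End MixedRadix.

(** * Closedness of Kronecker models *)

Section KroneckerRankOne.
Variables (R : realType) (N : nat) (ms ps : 'I_N -> nat).
Hypotheses (ms0 : forall n, (0 < ms n)%N) (ps0 : forall n, (0 < ps n)%N).

Local Notation mat := 'M[R]_(dimprod ms, dimprod ps).

Lemma mx_at_matrix a b (g : nat -> nat -> R) x y : (x < a)%N -> (y < b)%N ->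
  mx_at (\matrix_(i < a, j < b) g i j) x y = g x y.
Proof. by move=> xa yb; rewrite /mx_at !insubT /= mxE. Qed.

Definition swapdigit f (n : 'I_N) (i i' : 'I_(dimprod f)) : 'I_(dimprod f) :=
  setdigit n i (kdigit f n i').

Lemma kdigit_swapdigit f (f0 : forall n, (0 < f n)%N) n (i i' : 'I_(dimprod f)) k :
  kdigit f k (swapdigit n i i') = if k == n then kdigit f n i' else kdigit f k i.
Proof. by rewrite kdigit_setdigit // kdigit_lt. Qed.

(** The vanishing of the 2 x 2 minors of the unfoldings that isolate one digit pair. These quadratic
    equations characterize single Kronecker products and pass to limits. *)
Definition swap_invariant (D : mat) := forall n i j i' j',
  D i j * D i' j' = D (swapdigit n i i') (swapdigit n j j') * D (swapdigit n i' i) (swapdigit n j' j).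

Lemma kron_swap_invariant (A : forall n, 'M[R]_(ms n, ps n)) : swap_invariant (kron A).
Proof.
move=> n i j i' j'; rewrite !mxE -!big_split; apply: eq_bigr => k _ /=.
rewrite !kdigit_swapdigit //; case: eqVneq => [->|_] //.
by rewrite mulrC.
Qed.

Lemma swap_invariant_kron (D : mat) : (0 < N)%N -> swap_invariant D ->
  exists A : forall n, 'M[R]_(ms n, ps n), D = kron A.
Proof.
move=> N0 sD; pose n0 := Ordinal N0.
have [->|/matrix0Pn[i0 [j0 c0]]] := eqVneq D 0.
  exists (fun=> 0); apply/matrixP => i j; rewrite !mxE (bigD1 n0) //=.
  rewrite /mx_at; case: insub => [x|]; last by rewrite mul0r.
  by case: insub => [x'|]; rewrite ?mxE mul0r.
have [c cE] : exists c, c = D i0 j0 by eexists.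
rewrite -cE in c0.
(* Factor [n] is the slice of [D] through the nonzero entry (i0, j0), divided by c. As D = c times
   the product of the scaled slices, factor [n0] carries the extra [c]. *)
pose g n x y := D (setdigit n i0 x) (setdigit n j0 y) / c * (if n == n0 then c else 1).
exists (fun n => \matrix_(a < ms n, b < ps n) g n a b).
apply/matrixP => i j; rewrite mxE.
under eq_bigr do rewrite mx_at_matrix ?kdigit_lt //.
rewrite /g big_split /= -big_mkcond /= big_pred1_eq.
(* Hybrid indices: the first [k] digits come from [i], the others from [i0]. Going from [k] to
   [k.+1] is one swap against the pivot and yields one slice factor. *)
have hyb (f : 'I_N -> nat) (f0 : forall n, (0 < f n)%N) (i1 i2 : 'I_(dimprod f)) k : exists h : 'I_(dimprod f),
    forall n, kdigit f n h = if (n < k)%N then kdigit f n i1 else kdigit f n i2.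
  by apply: kdigit_surj => // n; case: ifP => _; exact: kdigit_lt.
have [hi hiE] := boolp.choice (hyb _ ms0 i i0).
have [hj hjE] := boolp.choice (hyb _ ps0 j j0).
have H k : (k <= N)%N -> D (hi k) (hj k) =
    (\prod_(n < N | (n < k)%N)
      (D (setdigit n i0 (kdigit ms n i)) (setdigit n j0 (kdigit ps n j)) / c)) * c.
  elim: k => [_|k ih kN].
    have -> : hi 0%N = i0 by apply: (kdigit_inj ms0) => n; rewrite hiE.
    have -> : hj 0%N = j0 by apply: (kdigit_inj ps0) => n; rewrite hjE.
    by rewrite -cE big_pred0 ?mul1r // => n; rewrite ltn0.
  pose n := Ordinal kN.
  have := sD n (hi k.+1) (hj k.+1) i0 j0.
  have sw1 (f : 'I_N -> nat) (f0 : forall n, (0 < f n)%N) (h : nat -> 'I_(dimprod f)) (i1 i2 : 'I_(dimprod f)) :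
      (forall k n, kdigit f n (h k) = if (n < k)%N then kdigit f n i1 else kdigit f n i2) ->
      swapdigit n (h k.+1) i2 = h k /\ swapdigit n i2 (h k.+1) = setdigit n i2 (kdigit f n i1).
    move=> hE; split; apply: (kdigit_inj f0) => l; rewrite kdigit_swapdigit // ?hE.
      have [->|ln] := eqVneq l n; first by rewrite ltnn.
      rewrite ltnS leq_eqVlt (_ : (l == k :> nat) = false) //.
      by apply/negbTE; apply: contraNneq ln => lk; apply/eqP/val_inj.
    by rewrite ltnS leqnn kdigit_setdigit // kdigit_lt.
  have [-> ->] := sw1 _ ms0 _ _ _ hiE; have [-> ->] := sw1 _ ps0 _ _ _ hjE.
  rewrite -cE ih ?(ltnW kN) // => e.
  rewrite (bigD1 n) //= (eq_bigl (fun l : 'I_N => (l < k)%N)); last first.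
    move=> l; rewrite ltnS [in RHS]ltn_neqAle andbC; congr (_ && _).
  apply: (mulIf c0); rewrite e; move: (\prod_(_ < _ | _) _) => q.
  by rewrite mulrAC -!mulrA [_ * (c^-1 * _)]mulrA; field.
have := H N (leqnn N).
have -> : hi N = i by apply: (kdigit_inj ms0) => n; rewrite hiE ltn_ord.
have -> : hj N = j by apply: (kdigit_inj ps0) => n; rewrite hjE ltn_ord.
by move=> ->; congr (_ * _); apply: eq_bigl => n; rewrite ltn_ord.
Qed.

Lemma mul_perturb (x y x' y' M e : R) : `|x| <= M -> `|y| <= M ->
  `|x - x'| <= e -> `|y - y'| <= e -> e <= 1 -> `|x * y - x' * y'| <= e * (2 * M + 1).
Proof.
move=> xM yM xe ye e1.
have -> : x * y - x' * y' = (x - x') * y + x * (y - y') - (x - x') * (y - y') by ring.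
have e0 : 0 <= e by apply: le_trans xe.
have h1 : `|(x - x') * y| <= e * M by rewrite normrM ler_pM.
have h2 : `|x * (y - y')| <= M * e by rewrite normrM ler_pM.
have h3 : `|(x - x') * (y - y')| <= e * 1 by rewrite normrM ler_pM // (le_trans ye).
rewrite (le_trans (ler_normB _ _)) // (le_trans (lerD (ler_normD _ _) (lexx _))) //; lra.
Qed.

Lemma swap_invariant_frob_closed : frob_closed [set D | swap_invariant D].
Proof.
move=> D clD n i j i' j'; apply/eqP; rewrite -subr_eq0 -normr_le0.
apply/ler_addgt0Pr => e e0; rewrite add0r; pose M := frob D.
have M0 : 0 <= M by exact: frob_ge0.
pose e' := Num.min 1 (e / (2 * (2 * M + 1))).
have k0 : 0 < 2 * (2 * M + 1) by lra.
have e'0 : 0 < e' by rewrite lt_min ltr01 divr_gt0.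
have e'1 : e' <= 1 by rewrite ge_min lexx.
have e'e : e' * (2 * (2 * M + 1)) <= e by rewrite -ler_pdivlMr // ge_min lexx orbT.
have [D' sD' DD'] := clD e' e'0.
have ent k l : `|D k l| <= M by exact: normr_entry_le.
have dif k l : `|D k l - D' k l| <= e'.
  have := normr_entry_le (D - D') k l; rewrite !mxE => h; exact: le_trans h (ltW DD').
have h1 := mul_perturb (ent i j) (ent i' j') (dif i j) (dif i' j') e'1.
have h2 := mul_perturb (ent (swapdigit n i i') (swapdigit n j j'))
  (ent (swapdigit n i' i) (swapdigit n j' j)) (dif _ _) (dif _ _) e'1.
move: h1; rewrite (sD' n i j i' j') => h1.
apply: le_trans (_ : _ <= e' * (2 * M + 1) + e' * (2 * M + 1)) _; last lra.
move: h1 h2; move: (D' _ _ * D' _ _) => q h1 h2.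
have -> (u v : R) : u - v = (u - q) - (v - q) by ring.
by rewrite (le_trans (ler_normB _ _)) // lerD.
Qed.

Lemma kron_frob_closed : (0 < N)%N ->
  frob_closed [set D : mat | exists A : forall n, 'M[R]_(ms n, ps n), D = kron A].
Proof.
move=> N0 D clD; apply: swap_invariant_kron => //; apply: swap_invariant_frob_closed.
move=> e e0; have [D' [A ->] h] := clD e e0; exists (kron A) => //.
exact: kron_swap_invariant.
Qed.

Lemma Kset1_frob_closed : (0 < N)%N -> frob_closed (Kset ms ps 1 : set mat).
Proof.
move=> N0.
suff -> : Kset ms ps 1 = @oblique R _ _ `&`
    [set D : mat | exists A : forall n, 'M[R]_(ms n, ps n), D = kron A].
  by apply: frob_closedI; [exact: oblique_frob_closed|exact: kron_frob_closed].
apply/seteqP; split => D [oD]; last first.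
  move=> [A DA]; split => //; exists 1%N => //; exists (fun=> A).
  by rewrite big_ord1.
(* Separation rank 0 would mean D = 0, against its unit columns. *)
move=> [[|[|//]] _ [F DF]]; split => //; last by exists (F ord0); rewrite DF big_ord1.
have p0 : (0 < dimprod ps)%N by apply: prodn_gt0 => n.
have := oD (Ordinal p0); rewrite DF big_ord0 (_ : col _ 0 = 0) ?frob0.
  by move/eqP; rewrite eq_sym oner_eq0.
by apply/matrixP => i j; rewrite !mxE.
Qed.

(** The bound [c] puts each summand in a compact set, and sums are images of products of compact
    sets under addition. *)
Lemma compact_kron_sum (c : R) r : (0 < N)%N ->
  compact [set D : mat | exists F : 'I_r -> forall n : 'I_N, 'M[R]_(ms n, ps n),
    D = \sum_(k < r) kron (F k) /\ forall k, frob (kron (F k)) <= c].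
Proof.
move=> N0; pose K1 := [set D : mat | exists A : forall n, 'M[R]_(ms n, ps n), D = kron A].
have cK : compact (K1 `&` [set D : mat | frob (D - 0) <= c]).
  rewrite setIC; apply: compact_closedI; first exact: compact_frob_ball.
  by apply: frob_closed_closed; exact: kron_frob_closed.
elim: r => [|r ih].
  rewrite (_ : [set D | _] = [set 0]); first exact: compact_set1.
  apply/seteqP; split => [D [F [-> _]]|D ->] /=; first by rewrite big_ord0.
  by exists (fun _ _ => 0); rewrite big_ord0; split => // -[].
have := compact_setX ih cK.
move=> /(continuous_compact (f := fun z : mat * mat => z.1 + z.2)).
have ac : {within [set D : mat | exists F : 'I_r -> forall n : 'I_N, 'M[R]_(ms n, ps n),
    D = \sum_(k < r) kron (F k) /\ forall k, frob (kron (F k)) <= c]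
    `*` (K1 `&` [set D : mat | frob (D - 0) <= c]),
    continuous (fun z : mat * mat => z.1 + z.2)}.
  by apply: continuous_subspaceT => z; exact: add_continuous.
move=> /(_ ac); congr compact; apply/seteqP; split => D.
  move=> [[D1 D2] /= [[F [-> hF]] [[A ->]]]]; rewrite subr0 => hA <-.
  exists (fun k => if unlift ord_max k is Some k' then F k' else A); split.
    rewrite big_ord_recr /= unlift_none; congr (_ + _).
    apply: eq_bigr => k _.
    have -> : widen_ord (leqnSn r) k = lift ord_max k by apply/val_inj; rewrite /= /bump leqNgt ltn_ord.
    by rewrite liftK.
  by move=> k; case: unliftP => [k' _|_].
move=> [F [-> hF]]; exists (\sum_(k < r) kron (F (widen_ord (leqnSn r) k)), kron (F ord_max)) => /=.
  split; first by exists (fun k => F (widen_ord (leqnSn r) k)).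
  by split; [exists (F ord_max)|rewrite subr0].
by rewrite big_ord_recr.
Qed.

Lemma cKset_frob_closed (c : R) r : (0 < N)%N -> frob_closed (cKset ms ps c r : set mat).
Proof.
move=> N0; apply: frob_closedI; first exact: oblique_frob_closed.
by apply: compact_frob_closed; exact: compact_kron_sum.
Qed.

End KroneckerRankOne.

(* If [M] has rank at least [r.+1], then [X *m M *m Y] is the identity of size [r.+1]
   for suitable [X] and [Y]; a matrix [M'] close to [M] gives a product close to the identity,
   hence injective, so [M'] has rank at least [r.+1] as well. *)
Lemma rank_le_frob_closed (R : realType) (a b r : nat) :
  frob_closed [set M : 'M[R]_(a, b) | (\rank M <= r)%N].
Proof.
move=> M clM /=; rewrite leqNgt; apply/negP => rM.
pose X : 'M[R]_(r.+1, a) := pid_mx r.+1 *m invmx (col_ebase M).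
pose Y : 'M[R]_(b, r.+1) := invmx (row_ebase M) *m pid_mx r.+1.
have XMY : X *m M *m Y = 1%:M.
  have -> : X *m M *m Y = X *m col_ebase M *m pid_mx (\rank M) *m (row_ebase M *m Y).
    by rewrite -{1}(mulmx_ebase M) !mulmxA.
  have XC : X *m col_ebase M = pid_mx r.+1 by rewrite /X mulmxKV ?col_ebase_unit.
  have RY : row_ebase M *m Y = pid_mx r.+1 by rewrite /Y mulKVmx ?row_ebase_unit.
  have [ra rb] : (r < a)%N /\ (r < b)%N.
    by split; apply: leq_trans rM _; rewrite ?rank_leq_row ?rank_leq_col.
  rewrite XC RY !mul_pid_mx -pid_mx_1; congr pid_mx.
  by rewrite (minn_idPl rM) (minn_idPr ra) minnn (minn_idPr rb).
pose k := frob X * frob Y + 1; have k0 : 0 < k by rewrite ltr_wpDl ?mulr_ge0 ?frob_ge0.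
have [|M' rM' MM'] := clM k^-1; first by rewrite invr_gt0.
suff : (r < \rank M')%N by rewrite ltnNge rM'.
have /eqP rX : \rank (X *m M' *m Y) == r.+1.
  rewrite -/(row_free _) -kermx_eq0; set Z := kermx _.
  have ZM : Z *m (X *m M' *m Y) = 0 by exact: mulmx_ker.
  (* By the choice of [k], |X| |M - M'| |Y| < 1, so this equation forces Z = 0. *)
  have ZE : Z = Z *m (X *m (M - M') *m Y).
    by rewrite mulmxBr mulmxBl XMY mulmxBr mulmx1 ZM subr0.
  rewrite -frob_eq0 eq_le frob_ge0 andbT leNgt; apply/negP => Z0.
  have : frob Z <= frob Z * (frob X * frob (M - M') * frob Y).
    rewrite {1}ZE (le_trans (frob_mulmx _ _)) // ler_wpM2l ?frob_ge0 //.
    rewrite (le_trans (frob_mulmx _ _)) // ler_wpM2r ?frob_ge0 //.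
    exact: frob_mulmx.
  rewrite -[X in X <= _]mulr1 ler_pM2l //; apply/negP; rewrite -ltNge mulrAC.
  apply: le_lt_trans (_ : _ <= k * frob (M - M')) _.
    by rewrite ler_wpM2r ?frob_ge0 // lerDl.
  by rewrite -ltr_pdivlMl // mulr1.
by rewrite -rX (leq_trans (mxrankM_maxl _ _)) // mxrankM_maxr.
Qed.

(** * Separation rank of two factors as an ordinary matrix rank *)

Section SeparationRankTwo.
Variables (R : realType) (ms ps : 'I_2 -> nat).
Hypotheses (ms0 : forall n, (0 < ms n)%N) (ps0 : forall n, (0 < ps n)%N).

Local Notation mat := 'M[R]_(dimprod ms, dimprod ps).
Local Notation cell n := ('I_(ms n) * 'I_(ps n))%type.
Local Notation n0 := (ord0 : 'I_2).
Local Notation n1 := (ord_max : 'I_2).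

Let pair_index (f : 'I_2 -> nat) (f0 : forall n, (0 < f n)%N) (x : 'I_(f n0)) (y : 'I_(f n1)) :
  exists i : 'I_(dimprod f), kdigit f n0 i = x /\ kdigit f n1 i = y.
Proof.
have [|i iE] := kdigit_surj f0 (u := fun n => if n == n0 then x : nat else y).
  by move=> n; case: (unliftP ord0 n) => [k ->|->] /=; rewrite ?ltn_ord //
    (_ : lift _ k = n1) ?ltn_ord //; apply/val_inj; rewrite (ord1 k).
by exists i; rewrite !iE.
Qed.

Definition join_digits (f : 'I_2 -> nat) (f0 : forall n, (0 < f n)%N) x y : 'I_(dimprod f) :=
  sval (cid (pair_index f0 x y)).

(** The Van Loan-Pitsianis rearrangement: rows are indexed by the entries of the first factor and
    columns by those of the second, so a Kronecker product becomes an outer product of rank at most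
    one. *)
Definition rearrange (D : mat) : 'M[R]_(#|{: cell n0}|, #|{: cell n1}|) :=
  \matrix_(u, v) D (join_digits ms0 (enum_val u).1 (enum_val v).1)
                   (join_digits ps0 (enum_val u).2 (enum_val v).2).

Lemma kdigit_join0 f f0 x y : kdigit f n0 (@join_digits f f0 x y) = x.
Proof. by rewrite /join_digits; case: cid => i []. Qed.

Lemma kdigit_join1 f f0 x y : kdigit f n1 (@join_digits f f0 x y) = y.
Proof. by rewrite /join_digits; case: cid => i []. Qed.

Lemma kron2E (A : forall n, 'M[R]_(ms n, ps n)) i j : kron A i j =
  mx_at (A n0) (kdigit ms n0 i) (kdigit ps n0 j)
  * mx_at (A n1) (kdigit ms n1 i) (kdigit ps n1 j).
Proof.
by rewrite mxE big_ord_recl big_ord1 (_ : lift _ _ = n1) //; apply/val_inj.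
Qed.

Lemma mx_at_ord a b (A : 'M[R]_(a, b)) (i : 'I_a) (j : 'I_b) : mx_at A i j = A i j.
Proof. by rewrite /mx_at !valK. Qed.

Lemma rank_rearrange_kron_sum (D : mat) r : kron_sum r D -> (\rank (rearrange D) <= r)%N.
Proof.
move=> [F DF].
pose X : 'M[R]_(#|{: cell n0}|, r) := \matrix_(u, k) F k n0 (enum_val u).1 (enum_val u).2.
pose Y : 'M[R]_(r, #|{: cell n1}|) := \matrix_(k, v) F k n1 (enum_val v).1 (enum_val v).2.
suff -> : rearrange D = X *m Y by rewrite (leq_trans (mxrankM_maxl _ _)) // rank_leq_col.
apply/matrixP => u v; rewrite [LHS]mxE DF summxE mxE; apply: eq_bigr => k _.
by rewrite kron2E !kdigit_join0 !kdigit_join1 !mx_at_ord !mxE.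
Qed.

Lemma kron_sum_rank_rearrange (D : mat) : kron_sum (\rank (rearrange D)) D.
Proof.
set r := \rank _; pose X := col_base (rearrange D); pose Y := row_base (rearrange D).
pose XA (k : 'I_r) : 'M[R]_(ms n0, ps n0) := \matrix_(a, b) X (enum_rank (a, b)) k.
pose YA (k : 'I_r) : 'M[R]_(ms n1, ps n1) := \matrix_(a, b) Y k (enum_rank (a, b)).
(* The type of the factor depends on [n]; reading entries through [mx_at] avoids a cast in the case
   distinction. *)
exists (fun k n => \matrix_(a < ms n, b < ps n)
   (if n == n0 then mx_at (XA k) a b else mx_at (YA k) a b)).
apply/matrixP => i j; rewrite summxE.
pose d (f : 'I_2 -> nat) (f0 : forall n, (0 < f n)%N) n (l : 'I_(dimprod f)) : 'I_(f n) :=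
  Ordinal (kdigit_lt f0 n l).
have dE f f0 l : l = join_digits f0 (d f f0 n0 l) (d f f0 n1 l).
  apply: (kdigit_inj f0) => n; case: (unliftP ord0 n) => [k ->|->].
    by rewrite (_ : lift _ k = n1) ?kdigit_join1 //; apply/val_inj; rewrite (ord1 k).
  by rewrite kdigit_join0.
have -> : D i j = rearrange D (enum_rank (d ms ms0 n0 i, d ps ps0 n0 j))
                              (enum_rank (d ms ms0 n1 i, d ps ps0 n1 j)).
  by rewrite mxE !enum_rankK /= -!dE.
rewrite -(mulmx_base (rearrange D)) mxE; apply: eq_bigr => k _.
rewrite kron2E !mx_at_matrix ?kdigit_lt //=.
by rewrite -[kdigit ms n0 i]/(val (d ms ms0 n0 i)) -[kdigit ps n0 j]/(val (d ps ps0 n0 j))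
  -[kdigit ms n1 i]/(val (d ms ms0 n1 i)) -[kdigit ps n1 j]/(val (d ps ps0 n1 j))
  !mx_at_ord !mxE.
Qed.

(** Each entry of the rearrangement is an entry of [D], so it respects limits, and bounded rank is a
    closed condition. *)
Lemma Kset2_frob_closed r : frob_closed (Kset ms ps r : set mat).
Proof.
move=> D clD; split.
  by apply: oblique_frob_closed => e e0; have [D' [oD' _] h] := clD e e0; exists D'.
exists (\rank (rearrange D)); last exact: kron_sum_rank_rearrange.
apply: (@rank_le_frob_closed R) => e e0.
pose k := (#|{: cell n0}| * #|{: cell n1}|).+1%:R : R.
have k0 : 0 < k by rewrite ltr0n.
have [|D' [_ [r' r'r sD']] DD'] := clD (e / k); first by rewrite divr_gt0.
exists (rearrange D').
  exact: leq_trans (rank_rearrange_kron_sum sD') r'r.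
apply: le_lt_trans (frob_le_normr _) _; rewrite -/k mulrC -ltr_pdivlMr //.
apply: le_lt_trans DD'; rewrite [leLHS]/Num.Def.normr /= mx_normrE.
apply: bigmax_le => [|[u v] _] /=; first exact: frob_ge0.
rewrite !mxE.
have := normr_entry_le (D - D') (join_digits ms0 (enum_val u).1 (enum_val v).1)
  (join_digits ps0 (enum_val u).2 (enum_val v).2).
by rewrite !mxE.
Qed.

End SeparationRankTwo.

(** * The expected LASSO objective *)

Lemma ae_witness (R : realType) (d : measure_display) (T : measurableType d)
    (P : probability T R) (A : set T) (Q : T -> Prop) : measurable A ->
  P A != 0%E -> {ae P, forall t, Q t} -> exists2 t, A t & Q t.
Proof.
move=> mA PA [N [mN PN QN]]; apply: contrapT => h; move/negP: PA; apply.
rewrite -measure_le0 -PN le_measure ?inE // => t At; apply: QN => Qt; apply: h.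
by exists t.
Qed.

Lemma lipschitz_local_min (R : realType) (a b : nat) (C : set 'M[R]_(a, b))
    (F : 'M[R]_(a, b) -> R) (D0 : 'M[R]_(a, b)) (rho L : R) :
  frob_closed C -> C D0 -> 0 < rho -> 0 <= L ->
  (forall D D', C D -> C D' -> F D <= F D' + frob (D - D') * L) ->
  (forall D, C D -> frob (D - D0) = rho -> F D0 < F D) ->
  exists Dstar, C Dstar /\ frob (Dstar - D0) < rho /\
    exists2 delta : R, 0 < delta &
      forall D, C D -> frob (D - Dstar) < delta -> F Dstar <= F D.
Proof.
move=> Cc CD0 rho0 L0 lip gap; pose K := C `&` [set D | frob (D - D0) <= rho].
have KD0 : K D0 by split; rewrite //= subrr frob0 ltW.
have cK : compact K.
  rewrite /K setIC; apply: compact_closedI; first exact: compact_frob_ball.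
  exact: frob_closed_closed.
have cF : {within K, continuous F}.
  apply/subspace_continuousP => D [CD _]; apply/cvgrPdist_lt => e e0.
  have k0 : 0 < (a * b).+1%:R * (L + 1) :> R by rewrite mulr_gt0 // ltr_wpDl.
  near=> D'; have [CD' _] : K D' by near: D'; exact: withinT.
  have h : `|D - D'| < e / ((a * b).+1%:R * (L + 1)).
    near: D'; apply: cvg_within; apply/nbhs_ballP.
    exists (e / ((a * b).+1%:R * (L + 1))) => /=; first by rewrite divr_gt0.
    by move=> D' ; rewrite -ball_normE.
  have h1 := lip _ _ CD CD'; have h2 := lip _ _ CD' CD.
  rewrite frobBC in h2; have h3 := frob_le_normr (D - D').
  have h4 : frob (D - D') * (L + 1) < e.
    apply: le_lt_trans (_ : _ <= (a * b).+1%:R * (L + 1) * `|D - D'|) _.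
      by rewrite mulrAC ler_wpM2r // addr_ge0.
    by rewrite mulrC -ltr_pdivlMr.
  have h5 := frob_ge0 (D - D').
  rewrite /from_subspace ltr_norml; apply/andP; split; lra.
have [Ds DsK Dmin] := compact_EVT_min (ex_intro _ D0 KD0) cK cF.
move: DsK; rewrite inE => -[CDs Dsrho].
have le0 : F Ds <= F D0 by apply: Dmin; rewrite inE.
have lt_rho : frob (Ds - D0) < rho.
  rewrite lt_def Dsrho andbT; apply: contraTneq le0 => e.
  by rewrite -ltNge; exact: gap.
(* This radius keeps the neighbourhood inside the ball on which [Ds] is minimal. *)
exists Ds; split => //; split => //; exists (rho - frob (Ds - D0)); first by rewrite subr_gt0.
move=> D CD hD; apply: Dmin; rewrite inE; split => //=.
have -> : D - D0 = (D - Ds) + (Ds - D0) by rewrite addrA subrK.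
by rewrite (le_trans (frobD _ _)) // -lerBrDr ltW.
Unshelve. all: by end_near. Qed.

Section Sparsify.
Variables (R : realType) (d : measure_display) (T : measurableType d).
Variables (P : probability T R) (m p s : nat) (D0 : 'M[R]_(m, p)).
Variables (J : T -> {set 'I_p}) (x0 : T -> 'cV[R]_p) (eps : T -> 'cV[R]_m).
Hypotheses (sp : (s <= p)%N) (hJm : forall S, measurable [set t | J t = S]).
Hypothesis hx0m : forall i, measurable_fun setT (fun t => x0 t i 0).
Hypothesis hepsm : forall i, measurable_fun setT (fun t => eps t i 0).
Hypothesis hJcard : forall t, #|J t| = s.
Hypothesis hJunif : forall S : {set 'I_p}, #|S| = s ->
  P [set t | J t = S] = (('C(p, s))%:R^-1)%:E.
Hypothesis hsupp : {ae P, forall t, forall j, j \notin J t -> x0 t j 0 = 0}.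
Variables (Ex2 Eax Mx xlow Eeps2 Meps lambda : R).
Hypotheses (hMx : 0 < Mx) (hxlow : 0 < xlow) (hMeps : 0 < Meps) (hlambda : 0 < lambda).
Hypothesis hxx : forall S : {set 'I_p}, #|S| = s -> forall i j, i \in S -> j \in S ->
  (\int[P]_(t in [set t | J t = S]) (x0 t i 0 * x0 t j 0)%:E
    = (Ex2 * (i == j)%:R)%:E * P [set t | J t = S])%E.
Hypothesis hss : forall S : {set 'I_p}, #|S| = s -> forall i j, i \in S -> j \in S ->
  (\int[P]_(t in [set t | J t = S]) (sgv (x0 t) i 0 * sgv (x0 t) j 0)%:E
    = ((i == j)%:R)%:E * P [set t | J t = S])%E.
Hypothesis hsx : forall S : {set 'I_p}, #|S| = s -> forall i j, i \in S -> j \in S ->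
  (\int[P]_(t in [set t | J t = S]) (sgv (x0 t) i 0 * x0 t j 0)%:E
    = (Eax * (i == j)%:R)%:E * P [set t | J t = S])%E.
Hypothesis hxM : {ae P, forall t, frob (x0 t) <= Mx}.
Hypothesis hxlowb : {ae P, forall t, forall j, j \in J t -> xlow <= `|x0 t j 0|}.
Hypothesis hee : forall S : {set 'I_p}, #|S| = s -> forall i j : 'I_m,
  (\int[P]_(t in [set t | J t = S]) (eps t i 0 * eps t j 0)%:E
    = (Eeps2 * (i == j)%:R)%:E * P [set t | J t = S])%E.
Hypothesis hxe : forall S : {set 'I_p}, #|S| = s -> forall (i : 'I_p) (j : 'I_m),
  (\int[P]_(t in [set t | J t = S]) (x0 t i 0 * eps t j 0)%:E = 0)%E.
Hypothesis hse : forall S : {set 'I_p}, #|S| = s -> forall (i : 'I_p) (j : 'I_m),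
  (\int[P]_(t in [set t | J t = S]) (sgv (x0 t) i 0 * eps t j 0)%:E = 0)%E.
Hypothesis heM : {ae P, forall t, frob (eps t) <= Meps}.

Let y t : 'cV[R]_m := D0 *m x0 t + eps t.
Let Js S := [set t | J t = S].
Let c : R := ('C(p, s))%:R^-1.

Lemma measurable_obs i : measurable_fun setT (fun t => y t i 0).
Proof.
have -> : (fun t => y t i 0) = (fun t => \sum_j D0 i j * x0 t j 0 + eps t i 0).
  by apply/funext => t; rewrite /y !mxE.
apply: measurable_funD => //; apply: measurable_sum => j.
by apply: measurable_funM.
Qed.

Lemma measurable_sgv i : measurable_fun setT (fun t => sgv (x0 t) i 0).
Proof.
have -> : (fun t => sgv (x0 t) i 0) = (@Num.sg R) \o (fun t => x0 t i 0).
  by apply/funext => t; rewrite /= mxE.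
apply: measurableT_comp => //; apply: nondecreasing_measurable => // a b; have [a0|a0|->] := ltrgt0P a; have [b0|b0|->] := ltrgt0P b;
  rewrite ?sgr0 ?(gtr0_sg a0) ?(ltr0_sg a0) ?(gtr0_sg b0) ?(ltr0_sg b0) => ab; lra.
Qed.

Lemma obs_bounded : {ae P, forall t, frob (y t) <= frob D0 * Mx + Meps}.
Proof.
apply: filterS2 hxM heM => t xM eM; rewrite (le_trans (frobD _ _)) // lerD //.
by rewrite (le_trans (frob_mulmx _ _)) // ler_wpM2l ?frob_ge0.
Qed.

Lemma entry_bounded n (u : T -> 'cV[R]_n) k : {ae P, forall t, frob (u t) <= k} ->
  {ae P, forall t, forall i, `|u t i 0| <= k}.
Proof. by apply: filterS => t uk i; exact: le_trans (normr_entry_le _ _ _) uk. Qed.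

Lemma product_bounded n l (u : T -> 'cV[R]_n) (v : T -> 'cV[R]_l) a b (A : set T) :
  measurable A ->
  (forall i, measurable_fun setT (fun t => u t i 0)) ->
  (forall i, measurable_fun setT (fun t => v t i 0)) ->
  {ae P, forall t, forall i, `|u t i 0| <= a} ->
  {ae P, forall t, forall i, `|v t i 0| <= b} -> products_integrable P A u v.
Proof.
move=> mA mu mv ua vb i j; apply: (@ae_bounded_integrable _ _ _ _ _ _ (a * b)) => //.
  by apply: measurable_funM; apply: measurable_funS (mu i) || apply: measurable_funS (mv j).
apply: filterS2 ua vb => t ta tb _; rewrite normrM.
by apply: ler_pM.
Qed.

Let x_bd := entry_bounded hxM.
Let e_bd := entry_bounded heM.
Let sg_bd : {ae P, forall t, forall i, `|sgv (x0 t) i 0| <= 1}.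
Proof. by apply: filterS x_bd => t _ i; exact: normr_sgv_le1. Qed.

Let Rint_fine (A : set T) (f : T -> R) (k : R) :
  (\int[P]_(t in A) (f t)%:E = k%:E)%E -> \int[P]_(t in A) f t = k.
Proof. by rewrite /Rintegral => ->. Qed.

Lemma second_moment_supported n l (u : T -> 'cV[R]_n) (v : T -> 'cV[R]_l) S i j :
  products_integrable P (Js S) u v ->
  {ae P, forall t, Js S t -> u t i 0 * v t j 0 = 0} ->
  \int[P]_(t in Js S) (u t i 0 * v t j 0) = 0.
Proof.
move=> uv h; rewrite (ae_eq_Rintegral (hJm S) (uv i j) (g := fun=> 0)) //.
  by rewrite Rintegral_cst // mul0r.
exact: (finite_measure_integrable_cst P 0 (hJm S)).
Qed.

Let supp_x (S : {set 'I_p}) (i : 'I_p) : i \notin S -> {ae P, forall t, Js S t -> x0 t i 0 = 0}.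
Proof. by move=> iS; apply: filterS hsupp => t h JS; apply: h; rewrite JS. Qed.

Let supp_sg (S : {set 'I_p}) (i : 'I_p) : i \notin S -> {ae P, forall t, Js S t -> sgv (x0 t) i 0 = 0}.
Proof.
by move=> iS; apply: filterS (supp_x iS) => t h JS; rewrite mxE h // sgr0.
Qed.

(** Moments are prescribed only for indices in [S]; elsewhere the products vanish almost surely,
    hence [selmx] in place of the identity. *)
Let moment_selmx (u v : T -> 'cV[R]_p) (k : R) (S : {set 'I_p}) : #|S| = s ->
  products_integrable P (Js S) u v ->
  (forall i, i \notin S -> {ae P, forall t, Js S t -> u t i 0 = 0}) ->
  (forall i, i \notin S -> {ae P, forall t, Js S t -> v t i 0 = 0}) ->
  (forall i j, i \in S -> j \in S ->
    (\int[P]_(t in Js S) (u t i 0 * v t j 0)%:E = (k * (i == j)%:R)%:E * P (Js S))%E) ->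
  second_moment P (Js S) u v ((c * k) *: selmx R S).
Proof.
move=> Ss uv uS vS h i j; rewrite !mxE.
have [iS|iS] := boolP (i \in S); last first.
  rewrite mul0rn mulr0; apply: second_moment_supported => //.
  by apply: filterS (uS _ iS) => t ht JS; rewrite ht // mul0r.
have [jS|jS] := boolP (j \in S); last first.
  have /negPf -> : i != j by apply: contraNneq jS => <-.
  rewrite mulr0n mulr0; apply: second_moment_supported => //.
  by apply: filterS (vS _ jS) => t ht JS; rewrite ht // mulr0.
apply: Rint_fine; rewrite h // /Js hJunif // -EFinM -/c.
by rewrite mulrC mulrA.
Qed.

Lemma Rintegral_phi_gap (S : {set 'I_p}) (D : 'M[R]_(m, p)) : #|S| = s ->
  P.-integrable (Js S) (EFin \o (fun t => lasso_phi lambda S D (y t) (sgv (x0 t))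
      - lasso_phi lambda S D0 (y t) (sgv (x0 t)))) /\
  \int[P]_(t in Js S) (lasso_phi lambda S D (y t) (sgv (x0 t))
      - lasso_phi lambda S D0 (y t) (sgv (x0 t)))
  = c * phi_gap Ex2 Eax Eeps2 lambda D0 D S.
Proof.
move=> Ss; have mJ := hJm S.
have ixx : products_integrable P (Js S) x0 x0 by exact: product_bounded x_bd x_bd.
have ixe : products_integrable P (Js S) x0 eps by exact: product_bounded x_bd e_bd.
have iee : products_integrable P (Js S) eps eps by exact: product_bounded e_bd e_bd.
have msg := measurable_sgv.
have isx : products_integrable P (Js S) (fun t => sgv (x0 t)) x0.
  exact: product_bounded sg_bd x_bd.
have ise : products_integrable P (Js S) (fun t => sgv (x0 t)) eps.
  exact: product_bounded sg_bd e_bd.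
have iss : products_integrable P (Js S) (fun t => sgv (x0 t)) (fun t => sgv (x0 t)).
  exact: product_bounded sg_bd sg_bd.
apply: Rintegral_phi_sub => //.
- apply: moment_selmx => //; [exact: supp_x|exact: supp_x|exact: hxx].
- by move=> i j; rewrite mxE; apply: Rint_fine; exact: hxe.
- move=> i j; rewrite mxE; apply: Rint_fine; rewrite hee // hJunif // -EFinM -/c.
  by rewrite mulrC mulrA mulr_natr.
- apply: moment_selmx => //; [exact: supp_sg|exact: supp_x|exact: hsx].
- by move=> i j; rewrite mxE; apply: Rint_fine; exact: hse.
- rewrite -[c]mulr1; apply: moment_selmx => //; [exact: supp_sg|exact: supp_sg|].
  by move=> i j iS jS; rewrite mul1r; exact: hss.
Qed.

Lemma exists_support : exists S : {set 'I_p}, #|S| = s.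
Proof.
have : (0 < #|[set B : {set 'I_p} | B \subset finset.setT & #|B| == s]%SET|)%N.
  by rewrite cards_draws cardsT card_ord bin_gt0.
by move=> /card_gt0P[S]; rewrite inE => /andP[_ /eqP Ss]; exists S.
Qed.

Let c_gt0 : 0 < c.
Proof. by rewrite invr_gt0 ltr0n bin_gt0. Qed.

Let fine_Js (S : {set 'I_p}) : #|S| = s -> fine (P (Js S)) = c.
Proof. by move=> Ss; rewrite /Js hJunif. Qed.

(** [Ex2] and [Eax] are numbers tied to [x0] only by moment identities. Their inequalities come from
    integrating |x_i| >= xlow and (|x_i| - Eax)^2 >= 0 over one support event. *)
Lemma coefficient_bounds : (0 < s)%N ->
  [/\ xlow <= Eax, Eax ^+ 2 <= Ex2 & Num.sqrt s%:R * xlow <= Mx].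
Proof.
move=> s0; have [S Ss] := exists_support; have mJ := hJm S.
have /card_gt0P[i iS] : (0 < #|S|)%N by rewrite Ss.
have ixx : products_integrable P (Js S) x0 x0 by exact: product_bounded x_bd x_bd.
have isx : products_integrable P (Js S) (fun t => sgv (x0 t)) x0.
  by apply: product_bounded sg_bd x_bd => //; exact: measurable_sgv.
have Isx : \int[P]_(t in Js S) (sgv (x0 t) i 0 * x0 t i 0) = Eax * c.
  by apply: Rint_fine; rewrite hsx // eqxx mulr1 /Js hJunif.
have Ixx : \int[P]_(t in Js S) (x0 t i 0 * x0 t i 0) = Ex2 * c.
  by apply: Rint_fine; rewrite hxx // eqxx mulr1 /Js hJunif.
have icst k : P.-integrable (Js S) (EFin \o (fun=> k)).
  exact: (finite_measure_integrable_cst P k mJ).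
have Icst k : \int[P]_(t in Js S) k = k * c by rewrite Rintegral_cst // fine_Js.
split.
- rewrite -(ler_pM2r c_gt0) -Isx -Icst; apply: ae_le_Rintegral => //.
  apply: filterS hxlowb => t h JS; rewrite mxE -normrEsg; apply: h.
  by rewrite JS.
- have iZ := integrableZl mJ (- (2 * Eax)) (isx i i).
  have : 0 <= \int[P]_(t in Js S) (x0 t i 0 * x0 t i 0
      + (- (2 * Eax)) * (sgv (x0 t) i 0 * x0 t i 0) + Eax ^+ 2).
    apply: Rintegral_ge0 => t _; rewrite mxE -normrEsg -expr2 -real_normK ?num_real //.
    have := sqr_ge0 (`|x0 t i 0| - Eax); lra.
  have iD := integrableD mJ (ixx i i) iZ.
  rewrite (RintegralD mJ iD (icst _)) (RintegralD mJ (ixx i i) iZ) (RintegralZl _ mJ (isx i i)).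
  rewrite Ixx Isx Icst => h; rewrite -(ler_pM2r c_gt0); lra.
(* A pointwise bound: the event has positive probability, so it contains a sample with [s] entries
   of size at least [xlow]. *)
- have PJ : P (Js S) != 0%E by rewrite /Js hJunif // eqe lt0r_neq0.
  have : {ae P, forall t, frob (x0 t) <= Mx /\
      (forall j, j \in J t -> xlow <= `|x0 t j 0|)} by apply: filterS2 hxM hxlowb.
  move=> /(ae_witness mJ PJ)[t JS [xM xl]]; apply: le_trans xM.
  rewrite -ler_sqr ?nnegrE ?mulr_ge0 ?sqrtr_ge0 ?frob_ge0 // ?(ltW hxlow) //.
  rewrite [leLHS]exprMn [X in X * _ <= _]sqr_sqrtr ?ler0n // -Ss -sum1_card natr_sum.
  rewrite mulr_suml big_mkcond frob_sqrE; apply: ler_sum => k _; rewrite big_ord1.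
  case: ifP => [kS|_]; last exact: sqr_ge0.
  rewrite mul1r -[leRHS]real_normK ?num_real // ler_sqr ?nnegrE ?(ltW hxlow) //.
  by apply: xl; rewrite JS.
Qed.

Let F (D : 'M[R]_(m, p)) : R := \int[P]_t lasso_obj lambda (y t) D.

Lemma integrable_lasso_obj (D : 'M[R]_(m, p)) :
  P.-integrable setT (EFin \o (fun t => lasso_obj lambda (y t) D)).
Proof.
apply: (@ae_bounded_integrable _ _ _ _ _ _ (2^-1 * (frob D0 * Mx + Meps) ^+ 2)) => //.
  by apply: measurable_lasso_obj => //; exact: measurable_obs.
apply: filterS obs_bounded => t yt _; rewrite ger0_norm ?lasso_obj_ge0 //.
apply: le_trans (lasso_obj_le_sqr hlambda _ _) _; rewrite ler_wpM2l //.
rewrite ler_sqr ?nnegrE ?frob_ge0 //; exact: le_trans (frob_ge0 _) yt.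
Qed.

Lemma fPE D : fP P lambda y D = (F D)%:E.
Proof.
by rewrite /fP /F /Rintegral fineK //; apply: integrable_fin_num => //; exact: integrable_lasso_obj.
Qed.

Lemma expected_lasso_lipschitz : exists2 L : R, 0 <= L &
  forall D D', oblique D -> oblique D' -> F D <= F D' + frob (D - D') * L.
Proof.
pose Y := frob D0 * Mx + Meps; pose L' := (2^-1 * Y ^+ 2 + 1) / lambda.
have Y0 : 0 <= Y by rewrite addr_ge0 ?mulr_ge0 ?frob_ge0 ?(ltW hMx) ?(ltW hMeps).
have L'0 : 0 <= L' by rewrite divr_ge0 ?(ltW hlambda) // addr_ge0 // mulr_ge0 ?sqr_ge0.
exists (L' * (Y + L')); first by apply: mulr_ge0 => //; exact: addr_ge0.
move=> D D' oD oD'; set k := frob _ * _.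
have ik : P.-integrable setT (EFin \o (fun=> k)) by exact: finite_measure_integrable_cst.
have <- : \int[P]_t k = k by rewrite Rintegral_cst // (congr1 fine (probability_setT P)) mulr1.
rewrite -RintegralD //; last exact: integrable_lasso_obj.
apply: ae_le_Rintegral => //; first exact: integrable_lasso_obj.
  exact: (integrableD _ (integrable_lasso_obj D') ik).
apply: filterS obs_bounded => t yt _.
exact: (lasso_obj_lipschitz hlambda oD oD' yt).
Qed.

Lemma expected_lasso_gap (rho : R) D : (0 < s)%N -> oblique D0 -> oblique D ->
  frob (D - D0) = rho ->
  lambda <= xlow / 4 -> s%:R <= p%:R / (16 * (opnorm D0 + 1) ^+ 2) ->
  cum_coherence s D0 <= 4^-1 ->
  lambda / Eax * Cmin Ex2 Eax s D0 < rho ->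
  Meps / Mx < 7 / 2 * (lambda / Eax * Cmax Eax Mx s D0 - rho) ->
  F D0 < F D.
Proof.
move=> s0 oD0 oD Drho lx sD mu4 rho1 rho3.
have [xa aX sx] := coefficient_bounds s0.
have [x0_ M0 l0] : [/\ 0 < xlow, 0 < Mx & 0 < lambda] by [].
have a0 : 0 < Eax by apply: lt_le_trans xa.
have X0 : 0 < Ex2 by apply: lt_le_trans aX; rewrite exprn_gt0.
have p0 : (0 < p)%N by apply: leq_trans sp.
have p0R : 0 < p%:R :> R by rewrite ltr0n.
set K := opnorm D0 + 1 in sD; set A0 := frob (gramoff D0).
have K1 : 1 <= K by have := opnorm_ge0 D0; rewrite /K; lra.
have K20 : 0 < 16 * K ^+ 2 by rewrite mulr_gt0 // exprn_gt0 // (lt_le_trans ltr01).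
have Kpi : 16 * (K ^+ 2 * (s%:R / p%:R)) <= 1.
  have -> : 16 * (K ^+ 2 * (s%:R / p%:R)) = s%:R * (16 * K ^+ 2) / p%:R by ring.
  by rewrite ler_pdivrMr // mul1r -ler_pdivlMr.
have CminE : lambda / Eax * Cmin Ex2 Eax s D0 =
    24 * (lambda * Eax * (K ^+ 2 * (s%:R / p%:R) * A0)) / Ex2.
  by rewrite /Cmin -/K -/(gramoff D0) -/A0; field; rewrite !lt0r_neq0.
have CmaxE : lambda / Eax * Cmax Eax Mx s D0 =
    2 * lambda / (7 * Mx) * (1 - 2 * cum_coherence s D0).
  by rewrite /Cmax; field; rewrite !lt0r_neq0.
have Cge0 : 0 <= lambda * Eax * (K ^+ 2 * (s%:R / p%:R) * A0).
  apply: mulr_ge0; first by rewrite ltW ?mulr_gt0.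
  by rewrite mulr_ge0 ?frob_ge0 // mulr_ge0 ?sqr_ge0 // divr_ge0 ?ler0n.
have rho0 : 0 < rho.
  by apply: le_lt_trans rho1; rewrite CminE divr_ge0 ?(ltW X0) // mulr_ge0.
have rho1' : 24 * (lambda * Eax * (K ^+ 2 * (s%:R / p%:R) * A0)) <= Ex2 * rho.
  by move: rho1; rewrite CminE ltr_pdivrMr // [rho * _]mulrC => /ltW.
have rho3' : Meps + 7 / 2 * rho * Mx < lambda * (1 - 2 * cum_coherence s D0).
  move: rho3; rewrite CmaxE ltr_pdivrMr //.
  have -> : 7 / 2 * (2 * lambda / (7 * Mx) * (1 - 2 * cum_coherence s D0) - rho) * Mx =
     lambda * (1 - 2 * cum_coherence s D0) - 7 / 2 * rho * Mx.
    by field; rewrite !lt0r_neq0.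
  by rewrite ltrBrDr.
have mu0 := cum_coherence_ge0 s D0.
have me0 : 0 < Meps by [].
set rs := Num.sqrt s%:R in sx.
have rs1 : 1 <= rs by rewrite -sqrtr1 ler_wsqrtr // ler1n.
have lrs : lambda * rs <= Mx / 4.
  by have := ler_wpM2r (le_trans ler01 rs1) lx; lra.
have lmu : lambda * (1 - 2 * cum_coherence s D0) <= lambda by nra.
(* Multiply 7/2 rho Mx < lambda by sqrt s and use lambda sqrt s <= Mx / 4. *)
have rsrho : 14 * (rs * rho) <= 1.
  have h : 7 / 2 * rho * Mx < lambda by lra.
  have rs0 : 0 <= rs by apply: le_trans rs1.
  have h2 : 7 / 2 * rho * Mx * rs <= lambda * rs by rewrite ler_wpM2r // ltW.
  rewrite -(ler_pM2r M0); lra.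
have rho14 : 14 * rho <= 1 by nra.
have muD := cum_coherence_perturb oD oD0 mu4; rewrite -/rs Drho in muD.
(* 1/4 + 3/2 * 1/14 = 5/14. *)
have muD1 : cum_coherence s D <= 2 / 5 by lra.
(* The growth of the coherence costs 3 lambda sqrt s rho <= 3/4 Mx rho; together with rho Mx this
   stays below the reserve 7/2 rho Mx. *)
have muD2 : Meps + rho * Mx <= lambda * (1 - 2 * cum_coherence s D).
  have h : lambda * cum_coherence s D <= lambda * (cum_coherence s D0 + 3 / 2 * rs * rho).
    by rewrite ler_wpM2l // ltW.
  have h2 : lambda * rs * rho <= Mx / 4 * rho by rewrite ler_wpM2r // ltW.
  have := mulr_gt0 M0 rho0; lra.
have Mel : Meps <= lambda by have := mulr_gt0 rho0 M0; lra.
have muD2' : cum_coherence s D <= 2^-1 by lra.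
have gap : 0 < \sum_(S : {set 'I_p} | #|S| == s) phi_gap Ex2 Eax Eeps2 lambda D0 D S.
  apply: (@sum_phi_gap_gt0 _ _ _ _ _ _ _ _ _ _ K); rewrite ?Drho ?s0 //; lra.
pose f t := lasso_obj lambda (y t) D - lasso_obj lambda (y t) D0.
have fi : P.-integrable setT (EFin \o f).
  exact: (integrableB _ (integrable_lasso_obj D) (integrable_lasso_obj D0)).
have FE : F D - F D0 = \int[P]_t f t by rewrite /f RintegralB //; exact: integrable_lasso_obj.
rewrite -subr_gt0 FE.
have Fsum : \int[P]_t f t = \sum_(S : {set 'I_p}) \int[P]_(t in Js S) f t.
  have JT : \big[setU/set0]_(S : {set 'I_p}) Js S = setT.
    apply/seteqP; split => // t _; rewrite -bigcup_seq.
    by exists (J t) => //=; exact: mem_index_enum.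
  rewrite /Rintegral -[X in fine (integral _ X _)]JT integral_bigsetU_EFin //.
  - by rewrite -sum_fine // => S _; apply: integrable_fin_num; [exact: hJm|exact: (@integrableS _ _ _ _ setT _ _ measurableT (hJm S) _ fi)].
  - exact: index_enum_uniq.
  - by move=> S S' _ _ [t [<- <-]].
  - by rewrite JT; exact: measurable_int fi.
rewrite Fsum; apply: (@lt_le_trans _ _ (\sum_(S : {set 'I_p} | #|S| == s)
    c * phi_gap Ex2 Eax Eeps2 lambda D0 D S)).
  by rewrite -mulr_sumr mulr_gt0.
rewrite [leLHS]big_mkcond; apply: ler_sum => S _; case: ifP => [/eqP Ss|/eqP Ss]; last first.
  rewrite (_ : Js S = set0) ?Rintegral_set0 //.
  by apply/seteqP; split => // t JS; apply: Ss; rewrite -JS.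
have [pi pE] := Rintegral_phi_gap D Ss; rewrite -pE.
apply: ae_le_Rintegral => //; first exact: hJm.
  exact: (@integrableS _ _ _ _ setT _ _ measurableT (hJm S) _ fi).
have bounds : {ae P, forall t, frob (x0 t) <= Mx /\ frob (eps t) <= Meps}.
  by apply: filterS2 hxM heM.
apply: filterS3 hsupp hxlowb bounds => t tS tl [tM te] JS; rewrite /f.
have tS' j : j \notin S -> x0 t j 0 = 0 by rewrite -JS; exact: tS.
have tl' j : j \in S -> xlow <= `|x0 t j 0| by rewrite -JS; exact: tl.
apply: lerB.
- have Dle : frob (D - D0) <= rho by rewrite Drho.
  apply: (lasso_phi_le_recovery hlambda Ss tS' tM te oD Dle muD2'); exact: muD2.
- exact: (lasso_obj_le_phi_recovery hlambda Ss oD0 tS' tl' te).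
Qed.

(* For [s = 0] the signal is pure noise of norm at most [lambda], the LASSO solution is [0] for
   every oblique dictionary and the objective is constant. *)
Lemma expected_lasso_noise D : s = 0%N -> oblique D -> Meps <= lambda -> F D0 <= F D.
Proof.
move=> s0 oD Ml; apply: ae_le_Rintegral => //; [exact: integrable_lasso_obj..|].
have supp0 : {ae P, forall t, x0 t = 0}.
  apply: filterS hsupp => t h; apply/matrixP => i j; rewrite (ord1 j) mxE; apply: h.
  by have := hJcard t; rewrite s0 => /eqP; rewrite cards_eq0 => /eqP ->; rewrite finset.in_set0.
apply: filterS2 supp0 heM => t x00 et _.
apply: le_trans (lasso_obj_le_sqr hlambda _ _) _.
have yl : frob (y t) <= lambda by rewrite /y x00 mulmx0 add0r (le_trans et).
apply: le_trans (lasso_dual (y t) (u := y t) _); first by rewrite -frob_sqr; lra.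
move=> j; have -> : (D^T *m y t) j 0 = fdot (col j D) (y t).
  by rewrite mxE fdot_col; apply: eq_bigr => k _; rewrite !mxE.
by rewrite (le_trans (normr_fdot_le _ _)) // oD mul1r.
Qed.

Theorem lasso_local_minimum (C : set 'M[R]_(m, p)) (rho : R) :
  frob_closed C -> C `<=` @oblique R m p -> C D0 ->
  lambda <= xlow / 4 -> s%:R <= p%:R / (16 * (opnorm D0 + 1) ^+ 2) ->
  cum_coherence s D0 <= 4^-1 ->
  lambda / Eax * Cmin Ex2 Eax s D0 < rho ->
  rho < lambda / Eax * Cmax Eax Mx s D0 ->
  Meps / Mx < 7 / 2 * (lambda / Eax * Cmax Eax Mx s D0 - rho) ->
  exists Dstar, C Dstar /\ frob (Dstar - D0) < rho /\
    exists2 delta : R, 0 < delta &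
      forall D, C D -> frob (D - Dstar) < delta ->
        (fP P lambda (fun t => (D0 *m x0 t + eps t)%R) Dstar
          <= fP P lambda (fun t => (D0 *m x0 t + eps t)%R) D)%E.
Proof.
move=> Cc Co CD0 lx sD mu4 rho1 rho2 rho3.
have fE D : fP P lambda (fun t => (D0 *m x0 t + eps t)%R) D = (F D)%:E by exact: fPE.
have [s0|s0] := posnP s.
  have Cmin0 : Cmin Ex2 Eax s D0 = 0 by rewrite /Cmin s0 mul0r mulr0 mul0r.
  have rho0 : 0 < rho by move: rho1; rewrite Cmin0 mulr0.
  (* For s = 0 the moment identities do not constrain [Eax]. If it were 0, the upper bound on [rho]
     would be 0 by the convention for inverses, against rho > 0. *)
  have a0 : Eax != 0.
    apply: contraTneq rho2 => ->; rewrite invr0 mulr0 mul0r -leNgt; exact: ltW.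
  have mu0 := cum_coherence_ge0 s D0; have [l0 M0] : 0 < lambda /\ 0 < Mx by [].
  have Ml : Meps <= lambda.
    move: rho3; rewrite ltr_pdivrMr //.
    have -> : 7 / 2 * (lambda / Eax * Cmax Eax Mx s D0 - rho) * Mx =
        lambda * (1 - 2 * cum_coherence s D0) - 7 / 2 * rho * Mx.
      by rewrite /Cmax; field; rewrite a0 lt0r_neq0.
    have := mulr_gt0 rho0 M0; have := mulr_ge0 (ltW l0) mu0; lra.
  exists D0; split; first exact: CD0.
  split; first by rewrite subrr frob0.
  exists 1; first exact: ltr01.
  move=> D CD _; rewrite fE [leRHS]fE lee_fin.
  exact: (expected_lasso_noise s0 (Co _ CD) Ml).
have [L L0 lip] := expected_lasso_lipschitz.
have [xa aX sx] := coefficient_bounds s0.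
have x_gt0 : 0 < xlow by [].
have rho0 : 0 < rho.
  apply: le_lt_trans rho1; rewrite /Cmin mulr_ge0 ?divr_ge0 ?(ltW hlambda) //; first lra.
  rewrite mulr_ge0 ?frob_ge0 // mulr_ge0 ?divr_ge0 ?ler0n //.
  rewrite mulr_ge0 ?sqr_ge0 // mulr_ge0 // divr_ge0 ?sqr_ge0 //.
  exact: le_trans (sqr_ge0 _) aX.
have [||Ds [CDs [Dsrho [delta d0 Dmin]]]] :=
  lipschitz_local_min (F := F) Cc CD0 rho0 L0.
- by move=> D D' CD CD'; apply: lip; exact: Co.
- by move=> D CD Drho; apply: (expected_lasso_gap s0 (Co _ CD0) (Co _ CD) Drho).
exists Ds; split; first exact: CDs.
split; first exact: Dsrho.
exists delta; first exact: d0.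
by move=> D CD hD; rewrite fE [leRHS]fE lee_fin; exact: Dmin.
Qed.

End Sparsify.

Theorem theorem1 (R : realType) (d : measure_display) (T : measurableType d)
  (P : probability T R)
  (N : nat) (ms ps : 'I_N -> nat)
  (hN : (2 <= N)%N) (hms : forall n, (0 < ms n)%N) (hps : forall n, (0 < ps n)%N)
  (r : nat) (C : set 'M[R]_(dimprod ms, dimprod ps))
  (hC : (N = 2%N /\ C = Kset ms ps r) \/ C = Kset ms ps 1 \/
        (exists2 c : R, 0 < c & C = cKset ms ps c r) \/
        C = frob_closure (Kset ms ps r))
  (D0 : 'M[R]_(dimprod ms, dimprod ps)) (hD0 : C D0)
  (s : nat) (hs : (s <= dimprod ps)%N)
  (J : T -> {set 'I_(dimprod ps)})
  (x0 : T -> 'cV[R]_(dimprod ps)) (eps : T -> 'cV[R]_(dimprod ms))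
  (hJm : forall S, measurable [set t | J t = S])
  (hx0m : forall i, measurable_fun setT (fun t => x0 t i 0))
  (hepsm : forall i, measurable_fun setT (fun t => eps t i 0))
  (* support chosen uniformly at random among the s-subsets of [p] *)
  (hJcard : forall t, #|J t| = s)
  (hJunif : forall S : {set 'I_(dimprod ps)}, #|S| = s ->
     P [set t | J t = S] = (('C(dimprod ps, s))%:R^-1)%:E)
  (hsupp : {ae P, forall t, forall j, j \notin J t -> x0 t j 0 = 0})
  (* coefficient assumption *)
  (Ex2 Eax Mx xlow : R) (hMx : 0 < Mx) (hxlow : 0 < xlow)
  (hxx : forall S : {set 'I_(dimprod ps)}, #|S| = s -> forall i j, i \in S -> j \in S ->
     (\int[P]_(t in [set t | J t = S]) (x0 t i 0 * x0 t j 0)%:E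
       = (Ex2 * (i == j)%:R)%:E * P [set t | J t = S])%E)
  (hss : forall S : {set 'I_(dimprod ps)}, #|S| = s -> forall i j, i \in S -> j \in S ->
     (\int[P]_(t in [set t | J t = S]) (sgv (x0 t) i 0 * sgv (x0 t) j 0)%:E
       = ((i == j)%:R)%:E * P [set t | J t = S])%E)
  (hsx : forall S : {set 'I_(dimprod ps)}, #|S| = s -> forall i j, i \in S -> j \in S ->
     (\int[P]_(t in [set t | J t = S]) (sgv (x0 t) i 0 * x0 t j 0)%:E
       = (Eax * (i == j)%:R)%:E * P [set t | J t = S])%E)
  (hxM : {ae P, forall t, frob (x0 t) <= Mx})
  (hxlowb : {ae P, forall t, forall j, j \in J t -> xlow <= `|x0 t j 0|})
  (* noise assumption *)
  (Eeps2 Meps : R) (hMeps : 0 < Meps)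
  (hee : forall S : {set 'I_(dimprod ps)}, #|S| = s -> forall i j : 'I_(dimprod ms),
     (\int[P]_(t in [set t | J t = S]) (eps t i 0 * eps t j 0)%:E
       = (Eeps2 * (i == j)%:R)%:E * P [set t | J t = S])%E)
  (hxe : forall S : {set 'I_(dimprod ps)}, #|S| = s ->
     forall (i : 'I_(dimprod ps)) (j : 'I_(dimprod ms)),
     (\int[P]_(t in [set t | J t = S]) (x0 t i 0 * eps t j 0)%:E = 0)%E)
  (hse : forall S : {set 'I_(dimprod ps)}, #|S| = s ->
     forall (i : 'I_(dimprod ps)) (j : 'I_(dimprod ms)),
     (\int[P]_(t in [set t | J t = S]) (sgv (x0 t) i 0 * eps t j 0)%:E = 0)%E)
  (heM : {ae P, forall t, frob (eps t) <= Meps})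
  (* parameter assumption *)
  (lambda : R) (hlambda : 0 < lambda)
  (hCC : Cmin Ex2 Eax s D0 <= Cmax Eax Mx s D0)
  (hlx : lambda <= xlow / 4)
  (hsD : s%:R <= (dimprod ps)%:R / (16 * (opnorm D0 + 1) ^+ 2))
  (hmu : cum_coherence s D0 <= 4^-1)
  (hMM : Meps / Mx < 7 / 2 * (Cmax Eax Mx s D0 - Cmin Ex2 Eax s D0) * (lambda / Eax))
  (rho : R)
  (hrho1 : lambda / Eax * Cmin Ex2 Eax s D0 < rho)
  (hrho2 : rho < lambda / Eax * Cmax Eax Mx s D0)
  (hrho3 : Meps / Mx < 7 / 2 * (lambda / Eax * Cmax Eax Mx s D0 - rho)) :
  exists Dstar, C Dstar /\ frob (Dstar - D0) < rho /\
    exists2 delta : R, 0 < delta &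
      forall D, C D -> frob (D - Dstar) < delta ->
        (fP P lambda (fun t => (D0 *m x0 t + eps t)%R) Dstar
          <= fP P lambda (fun t => (D0 *m x0 t + eps t)%R) D)%E.
Proof.
have N0 : (0 < N)%N by apply: leq_trans hN.
have Kset_oblique r' : Kset ms ps r' `<=` @oblique R _ _ by move=> D [].
have [Cc Co] : frob_closed C /\ C `<=` @oblique R _ _.
  case: hC => [[N2 ->]|[->|[[c c0 ->]|->]]].
  - split; last exact: Kset_oblique.
    by subst N; exact: Kset2_frob_closed.
  - by split; [exact: Kset1_frob_closed|exact: Kset_oblique].
  - by split; [exact: cKset_frob_closed|move=> D []].
  - split; first exact: frob_closure_closed.
    move=> D clD; apply: oblique_frob_closed => e e0.
    by have [D' [oD' _] h] := clD e e0; exists D'.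
by apply: (@lasso_local_minimum _ _ _ P _ _ s D0 J x0 eps hs hJm hx0m hepsm hJcard hJunif hsupp
  Ex2 Eax Mx xlow Eeps2 Meps lambda).
Qed.
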